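(* Let $(Y_1,Y_2)$ be one of the pairs $(\widetilde X,\widetilde X)$, $(\widetilde X,\widetilde\Xi)$, $(\widetilde\Xi,\widetilde X)$, and let $k_{11}=t_{11}\tau_{22}-qt_{12}\tau_{21}$, $k_{22}=-q^{-1}t_{21}\tau_{12}+t_{22}\tau_{11}$ in $\mathrm{Pol}(Y_1\times Y_2)_q$. Let $f(\lambda)$ be the unique polynomial vector-function with values in $D(Y_1\times Y_2)_q^\prime$ such that $f(q^{2l})=k_{22}^lk_{11}^l$ for all $l\in\mathbb Z_+$. Then for every $l\in\mathbb C$ the distribution $k_{22}^lk_{11}^l:=f(q^{2l})$ is invariant, i.e. $\xi\cdot f(q^{2l})=\varepsilon(\xi)f(q^{2l})$ for all $\xi\in U_q\mathfrak{sl}_2$.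
   Context: Fix $0<q<1$ and $h>0$ with $q=e^{-h/2}$. $U_q\mathfrak{sl}_2$ is the Hopf algebra generated by $H,X^\pm$ (and $e^{\pm hH/4}$) with $[H,X^\pm]=\pm2X^\pm$, $[X^+,X^-]=\frac{e^{hH/2}-e^{-hH/2}}{e^{h/2}-e^{-h/2}}$, $\Delta(H)=H\otimes1+1\otimes H$, $\Delta(X^\pm)=X^\pm\otimes e^{hH/4}+e^{-hH/4}\otimes X^\pm$, $\varepsilon(H)=\varepsilon(X^\pm)=0$, $S(H)=-H$, $S(X^\pm)=-q^{\mp1}X^\pm$; in all modules considered $H$ acts diagonally with integer eigenvalues (componentwise on formal series). For $Y\in\{\widetilde X,\widetilde\Xi\}$ put $\delta_{\widetilde X}=1$, $\delta_{\widetilde\Xi}=0$, $P_{\widetilde X}=q^{-2\mathbb Z_+}$, $P_{\widetilde\Xi}=q^{2\mathbb Z}$. $\mathrm{Pol}(Y)_q$ is the unital $U_q\mathfrak{sl}_2$-module $*$-algebra with generators $t_{ij}$, $i,j=1,2$, relations $t_{11}t_{12}=qt_{12}t_{11}$, $t_{21}t_{22}=qt_{22}t_{21}$, $t_{11}t_{21}=qt_{21}t_{11}$, $t_{12}t_{22}=qt_{22}t_{12}$, $t_{12}t_{21}=t_{21}t_{12}$, $t_{11}t_{22}-t_{22}t_{11}=(q-q^{-1})t_{12}t_{21}$, $t_{11}t_{22}-qt_{12}t_{21}=\delta_Y$, involution $t_{11}^*=-t_{22}$, $t_{12}^*=-qt_{21}$, and action $X^+t_{i1}=0$, $X^+t_{i2}=t_{i1}$,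 $X^-t_{i1}=t_{i2}$, $X^-t_{i2}=0$, $Ht_{i1}=t_{i1}$, $Ht_{i2}=-t_{i2}$. Let $M^{\prime\prime}=\{(i_1,i_2,j_1,j_2)\in\mathbb Z_+^4: i_1j_1=i_2j_2=0\}$. Each $f\in\mathrm{Pol}(Y)_q$ is uniquely a finite sum $\sum_{M^{\prime\prime}}t_{11}^{i_1}t_{12}^{i_2}\psi_{i_1i_2j_1j_2}(t_{12}t_{12}^* )t_{12}^{*j_2}t_{11}^{*j_1}$ with polynomial coefficients; $\mathrm{Pol}(Y)_q$ carries the weakest topology making all $f\mapsto\psi_{i_1i_2j_1j_2}(a)$, $a\in P_Y$, continuous. Its completion $D(Y)_q^\prime$ is the space of formal series of this form with coefficients arbitrary functions on $P_Y$; $D(Y)_q$ is the subspace of series with only finitely many nonzero values $\psi_{i_1i_2j_1j_2}(a)$; multiplication is transferred by continuity, making $D(Y)_q$ an algebra and $D(Y)_q^\prime$ a bimodule over $D(Y)_q$ and $\mathrm{Pol}(Y)_q$. Integrals: on $D(\widetilde X)_q$, $\int f\,d\nu=(1-q^2)\sum_{m=0}^\infty\psi_{0000}(q^{-2m})q^{-2m}$; on $D(\widetilde\Xi)_q$, $\int f\,d\nu=(1-q^2)\sum_{m=-\infty}^\infty\psi_{0000}(q^{-2m})q^{-2m}$. $\nu_j$ denotes this integral on $D(Y_j)_q$. $\mathrm{Pol}(Y_1\times Y_2)_q=\mathrm{Pol}(Y_1)_q^{\mathrm{op}}\otimes\mathrm{Pol}(Y_2)_q$, $D(Y_1\times Y_2)_q=D(Y_1)_q^{\mathrm{op}}\otimes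 D(Y_2)_q$ (op = opposite multiplication, so $(a\otimes b)(c\otimes d)=ca\otimes bd$); as $U_q\mathfrak{sl}_2$-modules these are tensor products of modules (action via $\Delta$). In them $t_{ij}$ denotes $t_{ij}\otimes1$ and $\tau_{ij}$ denotes $1\otimes t_{ij}$. $D(Y_1\times Y_2)_q^\prime$ is the completion of $\mathrm{Pol}(Y_1\times Y_2)_q$ in the weakest topology making $l_1\otimes l_2$ continuous for all continuous linear functionals $l_j$ on $\mathrm{Pol}(Y_j)_q$; it contains $D(Y_1\times Y_2)_q$, and the $U_q\mathfrak{sl}_2$-action extends to it by continuity. For $\psi\in D(Y_1\times Y_2)_q$, the functional $K\mapsto\int_{Y_{1q}}\int_{Y_{2q}}K\psi\,d\nu_1d\nu_2$ on $D(Y_1\times Y_2)_q^\prime$ is the extension by continuity of $K\mapsto(\nu_1\otimes\nu_2)(K\psi)$ from $K\in\mathrm{Pol}(Y_1\times Y_2)_q$. A function $f(\lambda)$ of a complex variable $\lambda\neq0$ with values in $D(Y_1\times Y_2)_q^\prime$ is called a polynomial vector-function if for every $\psi\in D(Y_1\times Y_2)_q$ the integral $\int_{Y_{1q}}\int_{Y_{2q}}f(\lambda)\psi\,d\nu_1d\nu_2$ belongs to $\mathbb C[\lambda,\lambda^{-1}]$. (A unique $f$ as in the claim exists.) *)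

(* Defs.v *)
From HB Require Import structures.
From mathcomp Require Import all_boot all_order all_algebra generic_quotient.
From mathcomp Require Import all_classical all_reals all_analysis.
From mathcomp Require Import complex ring lra.

Set Implicit Arguments.
Unset Strict Implicit.
Unset Printing Implicit Defensive.

Import Order.TTheory GRing.Theory Num.Theory.
Import numFieldNormedType.Exports.
Import ArrowAsProduct.

Local Open Scope classical_set_scope.
Local Open Scope ring_scope.
Local Open Scope complex_scope.
Local Open Scope quotient_scope.

(* The complex numbers, packed so that the topology of a numClosedFieldType
   is found by unification. *)
Definition Cx (R : realType) : numClosedFieldType := R[i].

Inductive ncterm (K G : Type) : Type :=
| NCgen of G
| NCone
| NCadd of ncterm K G & ncterm K G
| NCmul of ncterm K G & ncterm K G
| NCscale of K & ncterm K G.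
Arguments NCgen {K G}.
Arguments NCone {K G}.

HB.instance Definition _ K G := gen_eqMixin (ncterm K G).
HB.instance Definition _ K G := gen_choiceMixin (ncterm K G).

Declare Scope nc_scope.
Delimit Scope nc_scope with nc.
Bind Scope nc_scope with ncterm.
Notation "1" := NCone : nc_scope.
Notation "s + t" := (NCadd s t) : nc_scope.
Notation "s * t" := (NCmul s t) : nc_scope.
Notation "c *: s" := (NCscale c s) : nc_scope.
Notation "- s" := (NCscale (- 1)%R s) : nc_scope.
Notation "s - t" := (NCadd s (NCscale (- 1)%R t)) : nc_scope.
Arguments NCscale {K G} c%_R s%_nc.

Fixpoint nceval (K : pzRingType) (A : algType K) (G : Type) (g : G -> A)
    (s : ncterm K G) : A :=
  match s with
  | NCgen x => g x
  | NCone => 1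
  | NCadd s t => nceval g s + nceval g t
  | NCmul s t => nceval g s * nceval g t
  | NCscale c s => c *: nceval g s
  end.

(* [augm] is a one-dimensional representation compatible with the relations;
   it only serves to guarantee that the presented algebra is not zero. *)
Record presentation (K : comNzRingType) := Presentation {
  gens : Type;
  rels : ncterm K gens -> ncterm K gens -> Prop;
  augm : gens -> K^o;
  augmP : forall s t, rels s t -> nceval augm s = nceval augm t
}.

Section PresentedAlgebra.
Variables (K : comNzRingType) (P : presentation K).
Local Notation T := (ncterm K (gens P)).

(* The least congruence containing the relations and the axioms of unital
   associative K-algebras. *)
Inductive nceq : T -> T -> Prop :=
| nceq_rel s t of rels s t : nceq s t
| nceq_refl s : nceq s s
| nceq_sym s t of nceq s t : nceq t s
| nceq_trans s t u of nceq s t & nceq t u : nceq s u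
| nceq_add s s' t t' of nceq s s' & nceq t t' : nceq (s + t)%nc (s' + t')%nc
| nceq_mul s s' t t' of nceq s s' & nceq t t' : nceq (s * t)%nc (s' * t')%nc
| nceq_scale c s s' of nceq s s' : nceq (c *: s)%nc (c *: s')%nc
| nceq_addA s t u : nceq (s + (t + u))%nc (s + t + u)%nc
| nceq_addC s t : nceq (s + t)%nc (t + s)%nc
| nceq_add0 s : nceq (0%R *: 1 + s)%nc s
| nceq_addN s : nceq (- s + s)%nc (0%R *: 1)%nc
| nceq_scaleA a b s : nceq (a *: (b *: s))%nc ((a * b)%R *: s)%nc
| nceq_scale1 s : nceq (1%R *: s)%nc s
| nceq_scaleDr a s t : nceq (a *: (s + t))%nc (a *: s + a *: t)%nc
| nceq_scaleDl a b s : nceq ((a + b)%R *: s)%nc (a *: s + b *: s)%nc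
| nceq_mulA s t u : nceq (s * (t * u))%nc (s * t * u)%nc
| nceq_mul1l s : nceq (1 * s)%nc s
| nceq_mul1r s : nceq (s * 1)%nc s
| nceq_mulDl s t u : nceq ((s + t) * u)%nc (s * u + t * u)%nc
| nceq_mulDr s t u : nceq (s * (t + u))%nc (s * t + s * u)%nc
| nceq_scaleAl a s t : nceq (a *: (s * t))%nc (a *: s * t)%nc
| nceq_scaleAr a s t : nceq (a *: (s * t))%nc (s * (a *: t))%nc.

Lemma nceval_nceq (A : algType K) (g : gens P -> A) :
  (forall s t, rels s t -> nceval g s = nceval g t) ->
  forall s t, nceq s t -> nceval g s = nceval g t.
Proof.
move=> grel s t; elim=> {s t} //=.
- by move=> s t u _ -> _ ->.
- by move=> s s' t t' _ -> _ ->.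
- by move=> s s' t t' _ -> _ ->.
- by move=> c s s' _ ->.
- by move=> s t u; rewrite addrA.
- by move=> s t; rewrite addrC.
- by move=> s; rewrite scale0r add0r.
- by move=> s; rewrite scaleN1r addNr scale0r.
- by move=> a b s; rewrite scalerA.
- by move=> s; rewrite scale1r.
- by move=> a s t; rewrite scalerDr.
- by move=> a b s; rewrite scalerDl.
- by move=> s t u; rewrite mulrA.
- by move=> s; rewrite mul1r.
- by move=> s; rewrite mulr1.
- by move=> s t u; rewrite mulrDl.
- by move=> s t u; rewrite mulrDr.
- by move=> a s t; rewrite scalerAl.
- by move=> a s t; rewrite scalerAr.
Qed.

Definition nceqb (s t : T) : bool := `[< nceq s t >].

Lemma nceqb_refl : reflexive nceqb.
Proof. by move=> s; apply/asboolP; apply: nceq_refl. Qed.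
Lemma nceqb_sym : symmetric nceqb.
Proof. by move=> s t; apply/asboolP/asboolP; apply: nceq_sym. Qed.
Lemma nceqb_trans : transitive nceqb.
Proof.
move=> t s u /asboolP st /asboolP tu; apply/asboolP; exact: nceq_trans st tu.
Qed.
Canonical nceq_equiv := EquivRel nceqb nceqb_refl nceqb_sym nceqb_trans.

Definition palg : Type := {eq_quot nceq_equiv}.
HB.instance Definition _ := Choice.on palg.
HB.instance Definition _ := EqQuotient.on palg.

Definition palg_class (s : T) : palg := \pi_palg s.

Lemma palg_classP s t : palg_class s = palg_class t <-> nceq s t.
Proof.
split=> [/eqP|st]; first by rewrite eqmodE => /asboolP.
by apply/eqP; rewrite eqmodE; apply/asboolP.
Qed.

Lemma palg_repr (x : palg) : palg_class (repr x) = x.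
Proof. exact: reprK. Qed.

Lemma palg_ind (Q : palg -> Prop) : (forall s, Q (palg_class s)) -> forall x, Q x.
Proof. by move=> Qs x; rewrite -(palg_repr x). Qed.

Lemma repr_palg s : nceq (repr (palg_class s)) s.
Proof. by apply/palg_classP; rewrite palg_repr. Qed.

Definition palg_zero := palg_class (0%R *: 1)%nc.
Definition palg_one := palg_class 1%nc.
Definition palg_add (x y : palg) : palg := palg_class (repr x + repr y)%nc.
Definition palg_mul (x y : palg) : palg := palg_class (repr x * repr y)%nc.
Definition palg_opp (x : palg) : palg := palg_class (- repr x)%nc.
Definition palg_scale (c : K) (x : palg) : palg := palg_class (c *: repr x)%nc.

Lemma palg_addE s t : palg_add (palg_class s) (palg_class t) = palg_class (s + t)%nc.
Proof. by apply/palg_classP; apply: nceq_add; apply: repr_palg. Qed.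
Lemma palg_mulE s t : palg_mul (palg_class s) (palg_class t) = palg_class (s * t)%nc.
Proof. by apply/palg_classP; apply: nceq_mul; apply: repr_palg. Qed.
Lemma palg_scaleE c s : palg_scale c (palg_class s) = palg_class (c *: s)%nc.
Proof. by apply/palg_classP; apply: nceq_scale; apply: repr_palg. Qed.
Lemma palg_oppE s : palg_opp (palg_class s) = palg_class (- s)%nc.
Proof. exact: palg_scaleE. Qed.

Lemma palg_addA : associative palg_add.
Proof.
by elim/palg_ind=> s; elim/palg_ind=> t; elim/palg_ind=> u;
  rewrite !palg_addE; apply/palg_classP; constructor.
Qed.
Lemma palg_addC : commutative palg_add.
Proof.
by elim/palg_ind=> s; elim/palg_ind=> t; rewrite !palg_addE; apply/palg_classP; constructor.
Qed.
Lemma palg_add0 : left_id palg_zero palg_add.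
Proof. by elim/palg_ind=> s; rewrite !palg_addE; apply/palg_classP; constructor. Qed.
Lemma palg_addN : left_inverse palg_zero palg_opp palg_add.
Proof.
by elim/palg_ind=> s; rewrite palg_oppE palg_addE; apply/palg_classP; constructor.
Qed.
HB.instance Definition _ := GRing.isZmodule.Build palg palg_addA palg_addC palg_add0 palg_addN.

Lemma palg_mulA : associative palg_mul.
Proof.
by elim/palg_ind=> s; elim/palg_ind=> t; elim/palg_ind=> u;
  rewrite !palg_mulE; apply/palg_classP; constructor.
Qed.
Lemma palg_mul1l : left_id palg_one palg_mul.
Proof. by elim/palg_ind=> s; rewrite palg_mulE; apply/palg_classP; constructor. Qed.
Lemma palg_mul1r : right_id palg_one palg_mul.
Proof. by elim/palg_ind=> s; rewrite palg_mulE; apply/palg_classP; constructor. Qed.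
Lemma palg_mulDl : left_distributive palg_mul palg_add.
Proof.
by elim/palg_ind=> s; elim/palg_ind=> t; elim/palg_ind=> u;
  rewrite !(palg_mulE, palg_addE); apply/palg_classP; constructor.
Qed.
Lemma palg_mulDr : right_distributive palg_mul palg_add.
Proof.
by elim/palg_ind=> s; elim/palg_ind=> t; elim/palg_ind=> u;
  rewrite !(palg_mulE, palg_addE); apply/palg_classP; constructor.
Qed.
Lemma palg_oner_neq0 : palg_one != palg_zero.
Proof.
apply/eqP => /palg_classP /(nceval_nceq (@augmP _ P)) /=.
by rewrite scale0r => /eqP; rewrite oner_eq0.
Qed.
HB.instance Definition _ := GRing.Zmodule_isNzRing.Build palg
  palg_mulA palg_mul1l palg_mul1r palg_mulDl palg_mulDr palg_oner_neq0.

Lemma palg_scaleA a b x : palg_scale a (palg_scale b x) = palg_scale (a * b) x.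
Proof. by elim/palg_ind: x => s; rewrite !palg_scaleE; apply/palg_classP; constructor. Qed.
Lemma palg_scale1 : left_id 1 palg_scale.
Proof. by elim/palg_ind=> s; rewrite !palg_scaleE; apply/palg_classP; constructor. Qed.
Lemma palg_scaleDr : right_distributive palg_scale palg_add.
Proof.
by move=> a; elim/palg_ind=> s; elim/palg_ind=> t;
  rewrite !(palg_scaleE, palg_addE); apply/palg_classP; constructor.
Qed.
Lemma palg_scaleDl x : {morph palg_scale^~ x : a b / (a + b)%R >-> palg_add a b}.
Proof.
by move=> a b; elim/palg_ind: x => s; rewrite !(palg_scaleE, palg_addE); apply/palg_classP; constructor.
Qed.
HB.instance Definition _ := GRing.Zmodule_isLmodule.Build K palg
  palg_scaleA palg_scale1 palg_scaleDr palg_scaleDl.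

Lemma palg_scaleAl (a : K) (x y : palg) : a *: (x * y) = (a *: x) * y.
Proof.
elim/palg_ind: x => s; elim/palg_ind: y => t.
have : palg_scale a (palg_mul (palg_class s) (palg_class t)) =
       palg_mul (palg_scale a (palg_class s)) (palg_class t); last by [].
by rewrite !(palg_scaleE, palg_mulE); apply/palg_classP; constructor.
Qed.
HB.instance Definition _ := GRing.Lmodule_isLalgebra.Build K palg palg_scaleAl.

Lemma palg_scaleAr (a : K) (x y : palg) : a *: (x * y) = x * (a *: y).
Proof.
elim/palg_ind: x => s; elim/palg_ind: y => t.
have : palg_scale a (palg_mul (palg_class s) (palg_class t)) =
       palg_mul (palg_class s) (palg_scale a (palg_class t)); last by [].
by rewrite !(palg_scaleE, palg_mulE); apply/palg_classP; constructor.
Qed.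
HB.instance Definition _ := GRing.Lalgebra_isAlgebra.Build K palg palg_scaleAr.

Definition palg_gen (x : gens P) : palg := palg_class (NCgen x).

Lemma palg_classD s t : palg_class (s + t)%nc = palg_class s + palg_class t.
Proof. by rewrite -palg_addE. Qed.
Lemma palg_classM s t : palg_class (s * t)%nc = palg_class s * palg_class t.
Proof. by rewrite -palg_mulE. Qed.
Lemma palg_classZ c s : palg_class (c *: s)%nc = c *: palg_class s.
Proof. by rewrite -palg_scaleE. Qed.
Lemma palg_class1 : palg_class 1%nc = 1.
Proof. by []. Qed.

End PresentedAlgebra.
Arguments palg_gen {K P}.

(* The algebra morphism sending each generator x to [g x]; only meaningful when
   [g] respects the relations. *)
Definition palg_lift (K : comNzRingType) (P : presentation K) (A : algType K)
  (g : gens P -> A) (x : palg P) : A := nceval g (repr x).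

Inductive tterm (K : Type) (V W : Type) : Type :=
| Tpure of V & W
| Tadd of tterm K V W & tterm K V W
| Tscale of K & tterm K V W.
Arguments Tpure {K V W}.

HB.instance Definition _ K V W := gen_eqMixin (tterm K V W).
HB.instance Definition _ K V W := gen_choiceMixin (tterm K V W).

Fixpoint teval (K : pzRingType) (V W : Type) (L : lmodType K)
    (b : V -> W -> L) (s : tterm K V W) : L :=
  match s with
  | Tpure v w => b v w
  | Tadd s t => teval b s + teval b t
  | Tscale c s => c *: teval b s
  end.

Section Tensor.
Variables (K : comNzRingType) (V W : lmodType K).
Local Notation T := (tterm K V W).

Inductive teq : T -> T -> Prop :=
| teq_refl s : teq s s
| teq_sym s t of teq s t : teq t s
| teq_trans s t u of teq s t & teq t u : teq s u
| teq_add s s' t t' of teq s s' & teq t t' : teq (Tadd s t) (Tadd s' t')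
| teq_scale c s s' of teq s s' : teq (Tscale c s) (Tscale c s')
| teq_addA s t u : teq (Tadd s (Tadd t u)) (Tadd (Tadd s t) u)
| teq_addC s t : teq (Tadd s t) (Tadd t s)
| teq_add0 s : teq (Tadd (Tpure 0 0) s) s
| teq_addN s : teq (Tadd (Tscale (- 1) s) s) (Tpure 0 0)
| teq_scaleA a b s : teq (Tscale a (Tscale b s)) (Tscale (a * b) s)
| teq_scale1 s : teq (Tscale 1 s) s
| teq_scaleDr a s t : teq (Tscale a (Tadd s t)) (Tadd (Tscale a s) (Tscale a t))
| teq_scaleDl a b s : teq (Tscale (a + b) s) (Tadd (Tscale a s) (Tscale b s))
| teq_pureDl v v' w : teq (Tpure (v + v') w) (Tadd (Tpure v w) (Tpure v' w))
| teq_pureDr v w w' : teq (Tpure v (w + w')) (Tadd (Tpure v w) (Tpure v w'))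
| teq_pureZl a v w : teq (Tpure (a *: v) w) (Tscale a (Tpure v w))
| teq_pureZr a v w : teq (Tpure v (a *: w)) (Tscale a (Tpure v w)).

Definition teqb (s t : T) : bool := `[< teq s t >].

Lemma teqb_refl : reflexive teqb.
Proof. by move=> s; apply/asboolP; apply: teq_refl. Qed.
Lemma teqb_sym : symmetric teqb.
Proof. by move=> s t; apply/asboolP/asboolP; apply: teq_sym. Qed.
Lemma teqb_trans : transitive teqb.
Proof.
move=> t s u /asboolP st /asboolP tu; apply/asboolP; exact: teq_trans st tu.
Qed.
Canonical teq_equiv := EquivRel teqb teqb_refl teqb_sym teqb_trans.

Definition tens : Type := {eq_quot teq_equiv}.
HB.instance Definition _ := Choice.on tens.
HB.instance Definition _ := EqQuotient.on tens.

Definition tens_class (s : T) : tens := \pi_tens s.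

Lemma tens_classP s t : tens_class s = tens_class t <-> teq s t.
Proof.
split=> [/eqP|st]; first by rewrite eqmodE => /asboolP.
by apply/eqP; rewrite eqmodE; apply/asboolP.
Qed.

Lemma tens_repr (x : tens) : tens_class (repr x) = x.
Proof. exact: reprK. Qed.

Lemma tens_ind (Q : tens -> Prop) : (forall s, Q (tens_class s)) -> forall x, Q x.
Proof. by move=> Qs x; rewrite -(tens_repr x). Qed.

Lemma repr_tens s : teq (repr (tens_class s)) s.
Proof. by apply/tens_classP; rewrite tens_repr. Qed.

Definition tens_zero := tens_class (Tpure 0 0).
Definition tens_add (x y : tens) : tens := tens_class (Tadd (repr x) (repr y)).
Definition tens_scale (c : K) (x : tens) : tens := tens_class (Tscale c (repr x)).
Definition tens_opp (x : tens) : tens := tens_scale (- 1) x.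

Lemma tens_addE s t :
  tens_add (tens_class s) (tens_class t) = tens_class (Tadd s t).
Proof. by apply/tens_classP; apply: teq_add; apply: repr_tens. Qed.
Lemma tens_scaleE c s : tens_scale c (tens_class s) = tens_class (Tscale c s).
Proof. by apply/tens_classP; apply: teq_scale; apply: repr_tens. Qed.

Lemma tens_addA : associative tens_add.
Proof.
by elim/tens_ind=> s; elim/tens_ind=> t; elim/tens_ind=> u;
  rewrite !tens_addE; apply/tens_classP; constructor.
Qed.
Lemma tens_addC : commutative tens_add.
Proof.
by elim/tens_ind=> s; elim/tens_ind=> t; rewrite !tens_addE; apply/tens_classP; constructor.
Qed.
Lemma tens_add0 : left_id tens_zero tens_add.
Proof. by elim/tens_ind=> s; rewrite !tens_addE; apply/tens_classP; constructor. Qed.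
Lemma tens_addN : left_inverse tens_zero tens_opp tens_add.
Proof.
elim/tens_ind=> s; rewrite /tens_opp tens_scaleE tens_addE.
by apply/tens_classP; constructor.
Qed.
HB.instance Definition _ :=
  GRing.isZmodule.Build tens tens_addA tens_addC tens_add0 tens_addN.

Lemma tens_scaleA a b x : tens_scale a (tens_scale b x) = tens_scale (a * b) x.
Proof. by elim/tens_ind: x => s; rewrite !tens_scaleE; apply/tens_classP; constructor. Qed.
Lemma tens_scale1 : left_id 1 tens_scale.
Proof. by elim/tens_ind=> s; rewrite !tens_scaleE; apply/tens_classP; constructor. Qed.
Lemma tens_scaleDr : right_distributive tens_scale tens_add.
Proof.
by move=> a; elim/tens_ind=> s; elim/tens_ind=> t;
  rewrite !(tens_scaleE, tens_addE); apply/tens_classP; constructor.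
Qed.
Lemma tens_scaleDl x : {morph tens_scale^~ x : a b / (a + b)%R >-> tens_add a b}.
Proof.
by move=> a b; elim/tens_ind: x => s;
  rewrite !(tens_scaleE, tens_addE); apply/tens_classP; constructor.
Qed.
HB.instance Definition _ := GRing.Zmodule_isLmodule.Build K tens
  tens_scaleA tens_scale1 tens_scaleDr tens_scaleDl.

Definition tpure (v : V) (w : W) : tens := tens_class (Tpure v w).

(* The linear map sending each v (x) w to [b v w]; only meaningful when [b] is
   bilinear. *)
Definition tlift (L : lmodType K) (b : V -> W -> L) (x : tens) : L :=
  teval b (repr x).

Section Lift.
Variables (L : lmodType K) (b : V -> W -> L).
Hypothesis b_linl : forall w, linear (b^~ w).
Hypothesis b_linr : forall v, linear (b v).

Lemma teval_teq s t : teq s t -> teval b s = teval b t.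
Proof.
have b0 : b 0 0 = 0.
  by have := b_linr 0 (- 1) 0 0; rewrite scaler0 addr0 scaleN1r addNr.
elim=> {s t} //=.
- by move=> s t u _ -> _ ->.
- by move=> s s' t t' _ -> _ ->.
- by move=> c s s' _ ->.
- by move=> s t u; rewrite addrA.
- by move=> s t; rewrite addrC.
- by move=> s; rewrite b0 add0r.
- by move=> s; rewrite b0 scaleN1r addNr.
- by move=> a c s; rewrite scalerA.
- by move=> s; rewrite scale1r.
- by move=> a s t; rewrite scalerDr.
- by move=> a c s; rewrite scalerDl.
- by move=> v v' w; have := b_linl w 1 v v'; rewrite !scale1r.
- by move=> v w w'; have := b_linr v 1 w w'; rewrite !scale1r.
- move=> a v w; have b0w : b 0 w = 0.
    by have := b_linl w (- 1) 0 0; rewrite scaler0 addr0 scaleN1r addNr.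
  by have := b_linl w a v 0; rewrite b0w !addr0.
- move=> a v w; have bv0 : b v 0 = 0.
    by have := b_linr v (- 1) 0 0; rewrite scaler0 addr0 scaleN1r addNr.
  by have := b_linr v a w 0; rewrite bv0 !addr0.
Qed.

Lemma tlift_class s : tlift b (tens_class s) = teval b s.
Proof. exact/teval_teq/repr_tens. Qed.

Lemma tlift_pure v w : tlift b (tpure v w) = b v w.
Proof. exact: tlift_class. Qed.

Lemma tlift_linear : linear (tlift b).
Proof.
move=> a; elim/tens_ind=> s; elim/tens_ind=> t.
have -> : a *: tens_class s + tens_class t = tens_class (Tadd (Tscale a s) t).
  by rewrite -tens_addE -tens_scaleE.
by rewrite !tlift_class.
Qed.

End Lift.

Lemma tpure_linl w : linear (tpure^~ w).
Proof.
move=> a v v'; rewrite -[RHS]/(tens_add (tens_scale a (tpure v w)) (tpure v' w)).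
rewrite /tpure tens_scaleE tens_addE; apply/tens_classP.
apply: teq_trans (teq_pureDl _ _ _) _.
by apply: teq_add; [apply: teq_pureZl|apply: teq_refl].
Qed.

Lemma tpure_linr v : linear (tpure v).
Proof.
move=> a w w'; rewrite -[RHS]/(tens_add (tens_scale a (tpure v w)) (tpure v w')).
rewrite /tpure tens_scaleE tens_addE; apply/tens_classP.
apply: teq_trans (teq_pureDr _ _ _) _.
by apply: teq_add; [apply: teq_pureZr|apply: teq_refl].
Qed.

(* Every linear map is determined by its values on pure tensors. *)
Lemma tens_pure_ind (Q : tens -> Prop) :
    (forall v w, Q (tpure v w)) ->
    (forall x y, Q x -> Q y -> Q (x + y)) ->
    (forall c x, Q x -> Q (c *: x)) ->
  forall x, Q x.
Proof.
move=> Qp QD QZ; elim/tens_ind; elim=> [v w|s Qs t Qt|c s Qs].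
- exact: Qp.
- by have := QD _ _ Qs Qt; rewrite -[_ + _]/(tens_add _ _) tens_addE.
- by have := QZ c _ Qs; rewrite -[_ *: _]/(tens_scale _ _) tens_scaleE.
Qed.

End Tensor.

HB.instance Definition _ (K : comNzRingType) (A : algType K) :=
  GRing.Lmodule.copy A^c A.

Section ConverseAlgebra.
Variables (K : comNzRingType) (A : algType K).
Lemma conv_scaleAl (a : K) (x y : A^c) :
  a *: (x * y : A^c) = (a *: x : A^c) * y :> A^c.
Proof. exact: (@scalerAr K A a y x). Qed.
HB.instance Definition _ := GRing.Lmodule_isLalgebra.Build K A^c conv_scaleAl.
Lemma conv_scaleAr (a : K) (x y : A^c) :
  a *: (x * y : A^c) = x * (a *: y : A^c) :> A^c.
Proof. exact: (@scalerAl K A a y x). Qed.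
HB.instance Definition _ := GRing.Lalgebra_isAlgebra.Build K A^c conv_scaleAr.
End ConverseAlgebra.

Section TensorAlgebra.
Variables (K : comNzRingType) (A B : algType K).
Local Notation T := (tens A B).

Lemma tpureDl (a a' : A) (b : B) :
  tpure (a + a') b = tpure a b + tpure a' b :> T.
Proof. by have := tpure_linl b 1 a a'; rewrite !scale1r. Qed.
Lemma tpureDr (a : A) (b b' : B) :
  tpure a (b + b') = tpure a b + tpure a b' :> T.
Proof. by have := tpure_linr a 1 b b'; rewrite !scale1r. Qed.
Lemma tpure0l (b : B) : tpure 0 b = 0 :> T.
Proof. by apply: (addrI (tpure 0 b)); rewrite -tpureDl !addr0. Qed.
Lemma tpure0r (a : A) : tpure a 0 = 0 :> T.
Proof. by apply: (addrI (tpure a 0)); rewrite -tpureDr !addr0. Qed.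
Lemma tpureZl k (a : A) (b : B) : tpure (k *: a) b = k *: tpure a b :> T.
Proof. by have := tpure_linl b k a 0; rewrite tpure0l !addr0. Qed.
Lemma tpureZr k (a : A) (b : B) : tpure a (k *: b) = k *: tpure a b :> T.
Proof. by have := tpure_linr a k b 0; rewrite tpure0r !addr0. Qed.

Definition tens_mul_pure (a : A) (b : B) (y : T) : T :=
  tlift (fun c d => tpure (a * c) (b * d)) y.

(* (a (x) b) (c (x) d) = a c (x) b d; the opposite factor of Pol(Y_1 x Y_2)_q
   is obtained by taking A to be a converse algebra. *)
Definition tens_mul (x y : T) : T := tlift (fun a b => tens_mul_pure a b y) x.

Definition tens_one : T := tpure 1 1.

Lemma tens_mul_purel a b : linear (tens_mul_pure a b).
Proof.
apply: tlift_linear => [d|c] k u v.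
- by rewrite mulrDr -scalerAr tpureDl tpureZl.
- by rewrite mulrDr -scalerAr tpureDr tpureZr.
Qed.

Lemma tens_mul_pureE a b c d :
  tens_mul_pure a b (tpure c d) = tpure (a * c) (b * d).
Proof.
rewrite /tens_mul_pure tlift_pure // => [d'|c'] k u v.
- by rewrite mulrDr -scalerAr tpureDl tpureZl.
- by rewrite mulrDr -scalerAr tpureDr tpureZr.
Qed.

Lemma tens_mul_pureDl y b : linear (fun a => tens_mul_pure a b y).
Proof.
have addE a b' x1 y1 : tens_mul_pure a b' (x1 + y1) =
    tens_mul_pure a b' x1 + tens_mul_pure a b' y1.
  by have := tens_mul_purel a b' 1 x1 y1; rewrite !scale1r.
have mp0 a b' : tens_mul_pure a b' 0 = 0.
  by apply: (addrI (tens_mul_pure a b' 0)); rewrite -addE !addr0.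
move=> k u v; elim/tens_pure_ind: y => [c d|x y hx hy|l x hx].
- by rewrite !tens_mul_pureE mulrDl -scalerAl tpureDl tpureZl.
- by rewrite !addE hx hy scalerDr addrACA.
- have scE a b' z : tens_mul_pure a b' (l *: z) = l *: tens_mul_pure a b' z.
    by have := tens_mul_purel a b' l z 0; rewrite mp0 !addr0.
  by rewrite !scE hx scalerDr !scalerA mulrC.
Qed.

Lemma tens_mul_pureDr y a : linear (fun b => tens_mul_pure a b y).
Proof.
have addE a' b x1 y1 : tens_mul_pure a' b (x1 + y1) =
    tens_mul_pure a' b x1 + tens_mul_pure a' b y1.
  by have := tens_mul_purel a' b 1 x1 y1; rewrite !scale1r.
have mp0 a' b : tens_mul_pure a' b 0 = 0.
  by apply: (addrI (tens_mul_pure a' b 0)); rewrite -addE !addr0.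
move=> k u v; elim/tens_pure_ind: y => [c d|x y hx hy|l x hx].
- by rewrite !tens_mul_pureE mulrDl -scalerAl tpureDr tpureZr.
- by rewrite !addE hx hy scalerDr addrACA.
- have scE a' b z : tens_mul_pure a' b (l *: z) = l *: tens_mul_pure a' b z.
    by have := tens_mul_purel a' b l z 0; rewrite mp0 !addr0.
  by rewrite !scE hx scalerDr !scalerA mulrC.
Qed.

Lemma tens_mul_purelE a b y : tens_mul (tpure a b) y = tens_mul_pure a b y.
Proof.
rewrite /tens_mul tlift_pure // => c; [exact: tens_mul_pureDl|exact: tens_mul_pureDr].
Qed.

Lemma tens_mulE a b c d :
  tens_mul (tpure a b) (tpure c d) = tpure (a * c) (b * d).
Proof. by rewrite tens_mul_purelE tens_mul_pureE. Qed.

Lemma tens_mul_linl y : linear (tens_mul^~ y).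
Proof.
by apply: tlift_linear => c; [exact: tens_mul_pureDl|exact: tens_mul_pureDr].
Qed.

Lemma tens_mulDl : left_distributive tens_mul +%R.
Proof. by move=> x y z; have := tens_mul_linl z 1 x y; rewrite !scale1r. Qed.
Lemma tens_mul0l x : tens_mul 0 x = 0.
Proof. by apply: (addrI (tens_mul 0 x)); rewrite -tens_mulDl !addr0. Qed.
Lemma tens_mulZl k x y : tens_mul (k *: x) y = k *: tens_mul x y.
Proof. by have := tens_mul_linl y k x 0; rewrite tens_mul0l !addr0. Qed.

Lemma tens_mul_linr x : linear (tens_mul x).
Proof.
move=> k u v; elim/tens_pure_ind: x => [a b|x y hx hy|l x hx].
- by rewrite !tens_mul_purelE tens_mul_purel.
- by rewrite !tens_mulDl hx hy scalerDr addrACA.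
- by rewrite !tens_mulZl hx scalerDr !scalerA mulrC.
Qed.

Lemma tens_mulDr : right_distributive tens_mul +%R.
Proof. by move=> x y z; have := tens_mul_linr x 1 y z; rewrite !scale1r. Qed.
Lemma tens_mul0r x : tens_mul x 0 = 0.
Proof. by apply: (addrI (tens_mul x 0)); rewrite -tens_mulDr !addr0. Qed.
Lemma tens_mulZr k x y : tens_mul x (k *: y) = k *: tens_mul x y.
Proof. by have := tens_mul_linr x k y 0; rewrite tens_mul0r !addr0. Qed.

Lemma tens_mulA : associative tens_mul.
Proof.
move=> x y z; elim/tens_pure_ind: x => [a b|x x' hx hx'|k x hx]; last 2 first.
- by rewrite !tens_mulDl hx hx'.
- by rewrite !tens_mulZl hx.
elim/tens_pure_ind: y => [c d|y y' hy hy'|k y hy]; last 2 first.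
- by rewrite tens_mulDl !tens_mulDr hy hy' tens_mulDl.
- by rewrite tens_mulZl !tens_mulZr hy tens_mulZl.
elim/tens_pure_ind: z => [e f|z z' hz hz'|k z hz].
- by rewrite !tens_mulE !mulrA.
- by rewrite !tens_mulDr hz hz'.
- by rewrite !tens_mulZr hz.
Qed.

Lemma tens_mul1l : left_id tens_one tens_mul.
Proof.
elim/tens_pure_ind => [a b|x y hx hy|k x hx].
- by rewrite tens_mulE !mul1r.
- by rewrite tens_mulDr hx hy.
- by rewrite tens_mulZr hx.
Qed.

Lemma tens_mul1r : right_id tens_one tens_mul.
Proof.
elim/tens_pure_ind => [a b|x y hx hy|k x hx].
- by rewrite tens_mulE !mulr1.
- by rewrite tens_mulDl hx hy.
- by rewrite tens_mulZl hx.
Qed.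

HB.instance Definition _ := GRing.Zmodule_isPzRing.Build T
  tens_mulA tens_mul1l tens_mul1r tens_mulDl tens_mulDr.

End TensorAlgebra.

(* Extension by continuity of [g : V -> T] along [iota : V -> X]: the limit of
   [g v] as [iota v] tends to [x]. *)
Definition cont_ext (V : Type) (X T : topologicalType) (t0 : T)
    (iota : V -> X) (g : V -> T) (x : X) : T :=
  xget t0 [set y | g @ filter_from (nbhs x) (fun A => iota @^-1` A) --> y].

Section Uq.
Variables (R : realType) (q h : R).
Local Notation C := (Cx R).

(* [gE] and [gEi] are e^{hH/4} and e^{-hH/4}. *)
Variant Ugen := gH | gXp | gXm | gE | gEi.

Local Notation H := (NCgen gH).
Local Notation Xp := (NCgen gXp).
Local Notation Xm := (NCgen gXm).
Local Notation E := (NCgen gE).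
Local Notation Ei := (NCgen gEi).
Local Notation term := (ncterm C Ugen).

Variant Urel : term -> term -> Prop :=
| U_EEi : Urel (E * Ei) 1
| U_EiE : Urel (Ei * E) 1
| U_HE : Urel (H * E) (E * H)
| U_EXp : Urel (E * Xp) ((expR (h / 2))%:C *: Xp * E)
| U_EXm : Urel (E * Xm) ((expR (- (h / 2)))%:C *: Xm * E)
| U_HXp : Urel (H * Xp - Xp * H) (2%:R *: Xp)
| U_HXm : Urel (H * Xm - Xm * H) ((- 2%:R)%R *: Xm)
| U_XpXm : Urel (Xp * Xm - Xm * Xp)
    (((expR (h / 2) - expR (- (h / 2)))^-1)%R%:C *: (E * E - Ei * Ei)).

Definition Ucounit_gen (g : Ugen) : C^o :=
  match g with gH | gXp | gXm => 0 | gE | gEi => 1 end.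

Lemma Ucounit_rel s t :
  Urel s t -> nceval Ucounit_gen s = nceval Ucounit_gen t.
Proof.
by case=> /=; rewrite ?(mulr0, mul0r, scaler0, addr0, mulr1, scale1r, scaleN1r, subrr, scaler0).
Qed.

Definition Uq_presentation : presentation C := Presentation Ucounit_rel.
Definition Uq := palg Uq_presentation.

Definition Ucounit (xi : Uq) : C := palg_lift (P := Uq_presentation) (A := C^o) Ucounit_gen xi.

(* The coproduct on generators, as a list of pure tensors; [None] is 1. *)
Definition Ucoprod (g : Ugen) : seq (option Ugen * option Ugen) :=
  match g with
  | gH => [:: (Some gH, None); (None, Some gH)]
  | gXp => [:: (Some gXp, Some gE); (Some gEi, Some gXp)]
  | gXm => [:: (Some gXm, Some gE); (Some gEi, Some gXm)]
  | gE => [:: (Some gE, Some gE)]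
  | gEi => [:: (Some gEi, Some gEi)]
  end.

(* The action of an element of U_q on a module on which the generators act by
   the linear operators [op]; when these satisfy [Urel], it does not depend on
   the representative. *)
Fixpoint Uterm_act (V : lmodType C) (op : Ugen -> V -> V) (s : term) (v : V) : V :=
  match s with
  | NCgen g => op g v
  | NCone => v
  | NCadd s t => Uterm_act op s v + Uterm_act op t v
  | NCmul s t => Uterm_act op s (Uterm_act op t v)
  | NCscale c s => c *: Uterm_act op s v
  end.
Definition Uact (V : lmodType C) (op : Ugen -> V -> V) (xi : Uq) : V -> V :=
  Uterm_act op (repr xi).

Variant qspace := Xtilde | Xitilde.

Definition qdelta (Y : qspace) : C :=
  match Y with Xtilde => 1 | Xitilde => 0 end.

Variant tgen := T11 | T12 | T21 | T22.

Local Notation t11 := (NCgen T11).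
Local Notation t12 := (NCgen T12).
Local Notation t21 := (NCgen T21).
Local Notation t22 := (NCgen T22).

Variant Pol_rel (Y : qspace) : ncterm C tgen -> ncterm C tgen -> Prop :=
| Pol_11_12 : Pol_rel Y (t11 * t12) (q%:C *: (t12 * t11))
| Pol_21_22 : Pol_rel Y (t21 * t22) (q%:C *: (t22 * t21))
| Pol_11_21 : Pol_rel Y (t11 * t21) (q%:C *: (t21 * t11))
| Pol_12_22 : Pol_rel Y (t12 * t22) (q%:C *: (t22 * t12))
| Pol_12_21 : Pol_rel Y (t12 * t21) (t21 * t12)
| Pol_11_22 : Pol_rel Y (t11 * t22 - t22 * t11)
                        ((q - q^-1)%R%:C *: (t12 * t21))
| Pol_det : Pol_rel Y (t11 * t22 - q%:C *: (t12 * t21)) (qdelta Y *: 1).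

Definition Pol_augm (Y : qspace) (t : tgen) : C^o :=
  match t with T11 | T22 => qdelta Y | T12 | T21 => 0 end.

Lemma Pol_augm_rel Y s t :
  Pol_rel Y s t -> nceval (Pol_augm Y) s = nceval (Pol_augm Y) t.
Proof.
by case: Y; case=> /=;
  rewrite ?(mulr0, mul0r, mulr1, scaler0, addr0, subrr, scaleN1r, scale0r,
            scale1r) ?oppr0 ?addr0.
Qed.

Definition Pol_presentation (Y : qspace) : presentation C :=
  Presentation (@Pol_augm_rel Y).
Definition Pol (Y : qspace) := palg (Pol_presentation Y).

Definition tY Y (t : tgen) : Pol Y := palg_gen (P := Pol_presentation Y) t.

(* t_11^* = - t_22 and t_12^* = - q t_21; the involution is not needed on other
   elements. *)
Definition t11s Y : Pol Y := - tY Y T22.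
Definition t12s Y : Pol Y := - q%:C *: tY Y T21.

Definition Pol_act_gen Y (g : Ugen) (t : tgen) : Pol Y :=
  match g, t with
  | gXp, (T11 | T21) => 0
  | gXp, T12 => tY Y T11
  | gXp, T22 => tY Y T21
  | gXm, T11 => tY Y T12
  | gXm, T21 => tY Y T22
  | gXm, (T12 | T22) => 0
  | gH, (T11 | T21) => tY Y t
  | gH, (T12 | T22) => - tY Y t
  | gE, (T11 | T21) => (expR (h / 4))%:C *: tY Y t
  | gE, (T12 | T22) => (expR (- (h / 4)))%:C *: tY Y t
  | gEi, (T11 | T21) => (expR (- (h / 4)))%:C *: tY Y t
  | gEi, (T12 | T22) => (expR (h / 4))%:C *: tY Y t
  end.

(* Extension to products by the module algebra axiom
   xi (f g) = sum (xi_(1) f) (xi_(2) g), xi 1 = eps(xi) 1. *)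
Fixpoint Pol_act_term Y (g : Ugen) (s : ncterm C tgen) : Pol Y :=
  match s with
  | NCgen t => Pol_act_gen Y g t
  | NCone => (Ucounit_gen g : C) *: 1
  | NCadd s t => Pol_act_term Y g s + Pol_act_term Y g t
  | NCmul s t => \sum_(d <- Ucoprod g)
      (if d.1 is Some g1 then Pol_act_term Y g1 s
       else palg_class (P := Pol_presentation Y) s) *
      (if d.2 is Some g2 then Pol_act_term Y g2 t
       else palg_class (P := Pol_presentation Y) t)
  | NCscale c s => c *: Pol_act_term Y g s
  end.

(* Compatibility with the relations is [Pol_act_nceq] below. *)
Definition Pol_act Y (g : Ugen) (f : Pol Y) : Pol Y := Pol_act_term Y g (repr f).

Section WellDefined.
Variable Y : qspace.
Hypothesis hq : q = expR (- (h / 2)).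
Local Notation A := (Pol Y).
Local Notation c := ((expR (h / 4))%:C : C).
Local Notation ci := ((expR (- (h / 4)))%:C : C).

Lemma cci : c * ci = 1.
Proof. by rewrite -rmorphM /= -expRD subrr expR0. Qed.
Lemma qcici : q%:C = ci * ci :> C.
Proof.
rewrite hq -[in RHS]rmorphM /= -expRD; congr (expR _)%:C.
by lra.
Qed.
Lemma qVcc : (q^-1)%:C = c * c :> C.
Proof.
rewrite hq -expRN opprK -[in RHS]rmorphM /= -expRD; congr (expR _)%:C.
by lra.
Qed.

Lemma Pol_relE s t : Pol_rel Y s t ->
  palg_class (P := Pol_presentation Y) s = palg_class (P := Pol_presentation Y) t.
Proof. by move=> r; apply/palg_classP; apply: nceq_rel. Qed.

Lemma r1112 : tY Y T11 * tY Y T12 = (ci * ci) *: (tY Y T12 * tY Y T11).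
Proof. by rewrite -qcici; have := Pol_relE (Pol_11_12 Y); rewrite palg_classZ !palg_classM. Qed.
Lemma r2122 : tY Y T21 * tY Y T22 = (ci * ci) *: (tY Y T22 * tY Y T21).
Proof. by rewrite -qcici; have := Pol_relE (Pol_21_22 Y); rewrite palg_classZ !palg_classM. Qed.
Lemma r1121 : tY Y T11 * tY Y T21 = (ci * ci) *: (tY Y T21 * tY Y T11).
Proof. by rewrite -qcici; have := Pol_relE (Pol_11_21 Y); rewrite palg_classZ !palg_classM. Qed.
Lemma r1222 : tY Y T12 * tY Y T22 = (ci * ci) *: (tY Y T22 * tY Y T12).
Proof. by rewrite -qcici; have := Pol_relE (Pol_12_22 Y); rewrite palg_classZ !palg_classM. Qed.
Lemma r1221 : tY Y T12 * tY Y T21 = tY Y T21 * tY Y T12.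
Proof. by have := Pol_relE (Pol_12_21 Y); rewrite !palg_classM. Qed.
Lemma r1122 : tY Y T11 * tY Y T22 = qdelta Y *: 1 + (ci * ci) *: (tY Y T21 * tY Y T12).
Proof.
rewrite -qcici -r1221; have := Pol_relE (Pol_det Y).
rewrite palg_classD !palg_classZ !palg_classM scaleN1r palg_class1 => <-.
by rewrite subrK.
Qed.
Lemma r2211 : tY Y T22 * tY Y T11 = qdelta Y *: 1 + (c * c) *: (tY Y T21 * tY Y T12).
Proof.
have := Pol_relE (Pol_11_22 Y).
rewrite palg_classD !palg_classZ !palg_classM scaleN1r => e.
have -> : tY Y T22 * tY Y T11 = tY Y T11 * tY Y T22 - (tY Y T11 * tY Y T22 - tY Y T22 * tY Y T11).
  by rewrite opprB addrC subrK.
rewrite [X in _ - X]e.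
rewrite -[X in _ - _ *: X]/(tY Y T12 * tY Y T21).
rewrite r1122 r1221 rmorphB /= scalerBl opprB -addrA; congr (_ + _).
by rewrite qcici qVcc addrC subrK.
Qed.

Definition lc (m : A) (a b : C) := a *: 1 + b *: m.
Lemma lc_cst m a : a *: 1 = lc m a 0. Proof. by rewrite /lc scale0r addr0. Qed.
Lemma lc_scale m b : b *: m = lc m 0 b. Proof. by rewrite /lc scale0r add0r. Qed.
Lemma lc_unit m : m = lc m 0 1. Proof. by rewrite -lc_scale scale1r. Qed.
Lemma lcD m a b a' b' : lc m a b + lc m a' b' = lc m (a + a') (b + b').
Proof. by rewrite /lc addrACA -!scalerDl. Qed.
Lemma lcN m a b : - lc m a b = lc m (- a) (- b).
Proof. by rewrite /lc opprD -!scaleNr. Qed.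
Lemma lcE m a b a' b' : a = a' -> b = b' -> lc m a b = lc m a' b'.
Proof. by move=> -> ->. Qed.
Lemma cN0 : c != 0.
Proof. by apply/eqP => c0; have := cci; rewrite c0 mul0r => /eqP; rewrite eq_sym oner_eq0. Qed.
Lemma ciE : ci = c^-1.
Proof. by apply: (mulfI cN0); rewrite cci divff ?cN0. Qed.

Ltac lc_go m dN0 :=
  rewrite ?(lc_cst m) ?(lc_scale m);
  rewrite ?(lcN, lcD);
  apply: lcE; field; rewrite ?dN0 //.
Ltac lc_solve dN0 :=
  try (by []); try (by rewrite addNr subrr);
  match goal with |- context [@GRing.mul ?S (tY Y ?x) (tY Y ?y)] =>
    lc_go (@GRing.mul S (tY Y x) (tY Y y)) dN0 | _ => idtac end.

Lemma Pol_act_rel s t : Pol_rel Y s t ->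
  forall g, Pol_act_term Y g s = Pol_act_term Y g t.
Proof.
move=> [] g; rewrite /= ?scaleN1r; case: g;
rewrite /Ucoprod !(big_cons, big_nil) /= ?addr0;
rewrite -?[palg_class (NCgen _)]/(tY Y _)
  ?(mulNr, mulrN, mulr0, mul0r, scaler0, addr0, add0r, oppr0, opprK, scalerN);
rewrite -?(scalerAl, scalerAr) ?scalerA.
all: rewrite ?r1112 ?r2122 ?r1121 ?r1222 ?r1221 ?r1122 ?r2211 ?scalerDr ?scalerA.
all: rewrite ?rmorphB /= ?qcici ?qVcc ?scaleNr ?opprK.
all: rewrite ?ciE; move: cN0; move: c => d dN0.
all: lc_solve dN0.
Qed.

Lemma Pol_act_nceq s t : nceq (P := Pol_presentation Y) s t ->
  forall g, Pol_act_term Y g s = Pol_act_term Y g t.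
Proof.
elim=> {s t} /=.
- exact: Pol_act_rel.
- by [].
- by move=> s t _ e g; rewrite e.
- by move=> s t u _ e _ e' g; rewrite e e'.
- by move=> s s' t t' _ e _ e' g; rewrite e e'.
- move=> s s' t t' sE e tE e' g.
  have := (palg_classP (P := Pol_presentation Y) _ _).2 sE.
  have := (palg_classP (P := Pol_presentation Y) _ _).2 tE.
  by case: g; rewrite /Ucoprod !(big_cons, big_nil) /= => e2 e1; rewrite ?e ?e' ?e1 ?e2.
- by move=> a s s' _ e g; rewrite e.
- by move=> s t u g; rewrite addrA.
- by move=> s t g; rewrite addrC.
- by move=> s g; rewrite scale0r add0r.
- by move=> s g; rewrite scaleN1r addNr scale0r.
- by move=> a b s g; rewrite scalerA.
- by move=> s g; rewrite scale1r.
- by move=> a s t g; rewrite scalerDr.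
- by move=> a b s g; rewrite scalerDl.
- by move=> s t u; case; rewrite /Ucoprod !(big_cons, big_nil) /= !(big_cons, big_nil) /= !addr0 ?palg_classM ?mulrDr ?mulrDl ?addrA ?mulrA.
- by move=> s; case; rewrite /Ucoprod !(big_cons, big_nil) /= ?palg_class1 ?scale0r ?scale1r ?mul0r ?mul1r ?addr0 ?add0r.
- by move=> s; case; rewrite /Ucoprod !(big_cons, big_nil) /= ?palg_class1 ?scale0r ?scale1r ?mulr0 ?mulr1 ?addr0 ?add0r.
- by move=> s t u; case; rewrite /Ucoprod !(big_cons, big_nil) /= ?palg_classD ?mulrDl ?addr0 // addrACA.
- by move=> s t u; case; rewrite /Ucoprod !(big_cons, big_nil) /= ?palg_classD ?mulrDr ?addr0 // addrACA.
- by move=> a s t; case; rewrite /Ucoprod !(big_cons, big_nil) /= ?palg_classZ ?scalerAl ?addr0 // ?scalerDr ?scalerAl.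
- by move=> a s t; case; rewrite /Ucoprod !(big_cons, big_nil) /= ?palg_classZ ?scalerAr ?addr0 // ?scalerDr ?scalerAr.
Qed.

Lemma Pol_actE g s : Pol_act g (palg_class (P := Pol_presentation Y) s) =
  Pol_act_term Y g s.
Proof. by apply: Pol_act_nceq; apply: repr_palg. Qed.

Lemma Pol_act_linear g : linear (@Pol_act Y g).
Proof.
move=> a; elim/palg_ind=> s; elim/palg_ind=> t.
by rewrite -palg_classZ -palg_classD !Pol_actE.
Qed.

Lemma Pol_act1 g : Pol_act g (1 : A) = (Ucounit_gen g : C) *: 1.
Proof. by rewrite -palg_class1 Pol_actE. Qed.

Lemma Pol_actM g (x y : A) : Pol_act g (x * y) = \sum_(d <- Ucoprod g)
  oapp (@Pol_act Y) id d.1 x * oapp (@Pol_act Y) id d.2 y.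
Proof.
elim/palg_ind: x => s; elim/palg_ind: y => t.
rewrite -palg_classM Pol_actE /=; apply: eq_bigr => -[d1 d2] _ /=.
by case: d1 => [g1|]; case: d2 => [g2|] /=; rewrite ?Pol_actE.
Qed.

Lemma Pol_act_tY g t : Pol_act g (tY Y t) = Pol_act_gen Y g t.
Proof. exact: Pol_actE. Qed.

End WellDefined.

Definition in_Mpp (m : nat * nat * nat * nat) : bool :=
  let: (i1, i2, j1, j2) := m in (i1 * j1 == 0)%N && (i2 * j2 == 0)%N.
Definition Mpp := {m | in_Mpp m}.
Definition Mpp0 : Mpp := exist in_Mpp (0, 0, 0, 0)%N isT.

Definition PY (Y : qspace) : set R :=
  match Y with
  | Xtilde => [set q ^- (2 * m) | m in [set: nat]]
  | Xitilde => [set q ^ (2 * m) | m in [set: int]]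
  end.

(* t_11^i1 t_12^i2 psi(t_12 t_12^* ) t_12^*^j2 t_11^*^j1 *)
Definition normal_term Y (m : Mpp) (psi : {poly C}) : Pol Y :=
  let: (i1, i2, j1, j2) := val m in
  tY Y T11 ^+ i1 * tY Y T12 ^+ i2 * horner_alg (tY Y T12 * t12s Y) psi
    * t12s Y ^+ j2 * t11s Y ^+ j1.

Definition is_normal_form Y (f : Pol Y) (c : Mpp -> {poly C}) : Prop :=
  finite_set [set m | c m != 0] /\
  f = \sum_(m \in [set: Mpp]) normal_term Y m (c m).

(* The coefficients psi_{i1 i2 j1 j2} of f. *)
Definition coefs Y (f : Pol Y) : Mpp -> {poly C} :=
  xget (fun=> 0) [set c | is_normal_form f c].

Definition idx Y : Type := (Mpp * PY Y)%type.

(* D(Y)_q', with the topology of pointwise convergence of the values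
   psi_{i1 i2 j1 j2}(a). *)
Definition Dprime Y : Type := idx Y -> C.

Definition Pol_series Y (f : Pol Y) : Dprime Y :=
  fun i => (coefs f i.1).[(val i.2)%:C].

Definition finsupp Y : {pred Dprime Y} :=
  [pred f : Dprime Y | `[< finite_set [set i | f i != 0] >]].

Lemma finsupp_submod Y : submod_closed (@finsupp Y).
Proof.
split=> [|a f g /asboolP fin_f /asboolP fin_g]; apply/asboolP.
  by rewrite (_ : [set _ | _] = set0) //; apply/seteqP; split=> i //=; rewrite eqxx.
apply: (@sub_finite_set _ _ ([set i | f i != 0] `|` [set i | g i != 0])).
  move=> i /=; have [fi0|] := eqVneq (f i) 0; last by left.
  have [gi0|] := eqVneq (g i) 0; last by right.
  rewrite -[(a *: f + g) i]/(a * f i + g i) fi0 gi0 mulr0 addr0.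
  by rewrite eqxx.
by rewrite finite_setU.
Qed.
HB.instance Definition _ Y :=
  GRing.isSubmodClosed.Build C (idx Y -> C) (@finsupp Y) (@finsupp_submod Y).

(* D(Y)_q, as a vector space *)
Record Dfin Y := MkDfin { dval : idx Y -> C; _ : dval \in @finsupp Y }.
HB.instance Definition _ Y := [isSub for @dval Y].
HB.instance Definition _ Y := [Choice of Dfin Y by <:].
HB.instance Definition _ Y := [SubChoice_isSubLmodule of Dfin Y by <:].

(* Multiplication of D(Y)_q by Pol(Y)_q, extended by continuity from Pol(Y)_q;
   the extension preserves D(Y)_q, so the default value is never used. *)
Definition Dmulr Y (f : Dfin Y) (a : Pol Y) : Dfin Y :=
  insubd (0 : Dfin Y) (cont_ext (0 : idx Y -> C) (@Pol_series Y) (fun p => Pol_series (p * a)) (dval f)).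
Definition Dmull Y (a : Pol Y) (f : Dfin Y) : Dfin Y :=
  insubd (0 : Dfin Y) (cont_ext (0 : idx Y -> C) (@Pol_series Y) (fun p => Pol_series (a * p)) (dval f)).

(* psi_{0000}(a) *)
Definition psi0 Y (f : Dfin Y) (a : R) : C :=
  oapp (fun a' : PY Y => dval f (Mpp0, a')) 0 (insub a).

Definition nu Y (f : Dfin Y) : C^o :=
  (1 - q ^+ 2)%:C *
  match Y with
  | Xtilde => \sum_(m \in [set: nat]) psi0 f (q ^- (2 * m)) * (q ^- (2 * m))%:C
  | Xitilde => \sum_(m \in [set: int])
                 psi0 f (q ^ (- (2 * m))) * (q ^ (- (2 * m)))%:C
  end.

(* Pol(Y)_q carries the initial topology for its embedding in D(Y)_q', that is
   the weakest one making all f |-> psi_{i1 i2 j1 j2}(a) continuous. *)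
Definition Pol_dual Y : Type :=
  {l : Pol Y -> C | linear (l : Pol Y -> C^o) /\
     continuous (l : @initial_topology (Pol Y) (Dprime Y) (@Pol_series Y) -> C)}.

Section Product.
Variables Y1 Y2 : qspace.

Definition Pol2 : Type := tens (Pol Y1)^c (Pol Y2).
HB.instance Definition _ := GRing.Lmodule.on Pol2.
HB.instance Definition _ := GRing.PzRing.on Pol2.

Definition t_ (t : tgen) : Pol2 := tpure (tY Y1 t : (Pol Y1)^c) 1.
Definition tau_ (t : tgen) : Pol2 := tpure (1 : (Pol Y1)^c) (tY Y2 t).

Definition k11 : Pol2 := t_ T11 * tau_ T22 - q%:C *: (t_ T12 * tau_ T21).
Definition k22 : Pol2 :=
  (- q^-1)%:C *: (t_ T21 * tau_ T12) + t_ T22 * tau_ T11.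

Definition Pol2_act (g : Ugen) (K : Pol2) : Pol2 :=
  tlift (fun (a : (Pol Y1)^c) (b : Pol Y2) => \sum_(d <- Ucoprod g)
    tpure (oapp (@Pol_act Y1) id d.1 a : (Pol Y1)^c)
          (oapp (@Pol_act Y2) id d.2 b) : Pol2) K.

(* The completion of Pol(Y_1 x Y_2)_q for the weakest topology making all
   l_1 (x) l_2 continuous is the closure of its image in the product of copies
   of C indexed by the pairs (l_1, l_2). *)
Definition Pol2_compl (K : Pol2) : Pol_dual Y1 * Pol_dual Y2 -> C :=
  fun l => tlift (fun (a : (Pol Y1)^c) (b : Pol Y2) => sval l.1 a * sval l.2 b : C^o) K.

Definition Dprime2 : set (Pol_dual Y1 * Pol_dual Y2 -> C) :=
  closure (range Pol2_compl).

Definition Dprime2_act (xi : Uq)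
    (F : Pol_dual Y1 * Pol_dual Y2 -> C) : Pol_dual Y1 * Pol_dual Y2 -> C :=
  cont_ext (0 : Pol_dual Y1 * Pol_dual Y2 -> C) Pol2_compl (fun K => Pol2_compl (Uact Pol2_act xi K)) F.

Definition Dfin2 : Type := tens (Dfin Y1) (Dfin Y2).
HB.instance Definition _ := GRing.Lmodule.on Dfin2.

(* (a (x) b) (f (x) g) = f a (x) b g *)
Definition Pol2_mul_Dfin2 (K : Pol2) (psi : Dfin2) : Dfin2 :=
  tlift (fun (a : (Pol Y1)^c) (b : Pol Y2) =>
    tlift (fun f g => tpure (Dmulr f a) (Dmull b g)) psi : Dfin2) K.

Definition nu2 (psi : Dfin2) : C := tlift (fun f g => nu f * nu g : C^o) psi.

Definition integral2 (F : Pol_dual Y1 * Pol_dual Y2 -> C) (psi : Dfin2) : C :=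
  cont_ext (0 : C) Pol2_compl (fun K => nu2 (Pol2_mul_Dfin2 K psi)) F.

Definition polynomial_vector_function
    (f : C -> Pol_dual Y1 * Pol_dual Y2 -> C) : Prop :=
  (forall lambda, lambda != 0 -> Dprime2 (f lambda)) /\
  (forall psi : Dfin2, exists (p : {poly C}) (n : nat),
     forall lambda, lambda != 0 ->
       integral2 (f lambda) psi = p.[lambda] / lambda ^+ n).

End Product.

(* q^z = e^{z ln q} for complex z *)
Definition cexp (z : C) : C :=
  (expR (complex.Re z))%:C * (cos (complex.Im z) +i* sin (complex.Im z)).
Definition qpow (z : C) : C := cexp ((ln q)%:C * z).

End Uq.

(* Main.v *)
Require Import Defs.
From mathcomp Require Import all_boot all_order all_algebra finmap.
From mathcomp Require Import all_classical all_reals all_analysis.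
From mathcomp Require Import complex ring lra zify.

(* Pol(Y)_q acts on functions v(m, j) by t_11 e_m = e_(m+1), t_12 e_m = z q^(-m) e_m
   (z shifting j), so that t_12 t_12^* = q^(-2m) on e_m; the coefficient
   psi_(i1 i2 j1 j2)(q^(-2k)) of f is, up to a nonzero factor, the matrix entry of
   f in row k + i1, column k + j1 and z-degree i2 - j2.  In terms of matrix
   entries, multiplication by a fixed element and the action of a generator of
   U_q are given by finite sums, hence are continuous; every continuous functional
   is a finite combination of entries; and integration against a matrix unit
   of D(Y)_q returns an entry.  Consequently every value of f(lambda) at a pair of
   continuous functionals is a Laurent polynomial in lambda, and so is every
   value of xi . f(lambda) - eps(xi) f(lambda).  It vanishes for
   lambda = q^(2l), l in Z_+, because k_11 and k_22 are invariant and a product of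
   invariants is invariant; hence it vanishes identically. *)

Set Implicit Arguments.
Unset Strict Implicit.
Unset Printing Implicit Defensive.

Import Order.TTheory GRing.Theory Num.Theory.
Import numFieldNormedType.Exports.
Import ArrowAsProduct.

Local Open Scope classical_set_scope.
Local Open Scope ring_scope.
Local Open Scope complex_scope.

(** The hypothesis on f concerns integrals, the conclusion concerns values at pairs of continuous
    functionals, and the completions are reached only through limits along Pol(Y)_q, whose
    coefficients [coefs] are chosen rather than computed. Matrix entries bring all of these to one
    kind of quantity. The model is forced by the relations: once t_11 is the shift and t_12 acts by
    z q^(-m) with t_12 t_12^* = q^(-2m), the identity t_12^* = -q t_21 gives t_21 and the
    determinant relation gives t_22. Without the shift z, t_12 and t_12^* would be the same
    operator. For X~ the entry of t_22 from e_0 to e_(-1) is a multiple of q^0 - 1 = 0; this zero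
    confines the formulas to rows and columns m >= 0, hence to values of the coefficients on P_Y,
    the only ones that are continuous. X^+ and X^- become twisted commutators because t_12 and t_21,
    not invertible in Pol(Y)_q, are invertible in the model. *)

Section LinearMaps.
Variables (K : pzRingType) (U V : lmodType K) (f : U -> V).
Hypothesis f_linear : linear f.

Lemma linear_addE x y : f (x + y) = f x + f y.
Proof. by have := f_linear 1 x y; rewrite !scale1r. Qed.
Lemma linear_0E : f 0 = 0.
Proof. by apply: (addrI (f 0)); rewrite -linear_addE !addr0. Qed.
Lemma linear_scaleE k x : f (k *: x) = k *: f x.
Proof. by have := f_linear k x 0; rewrite linear_0E !addr0. Qed.

End LinearMaps.

(** * Representations of presented algebras and the matrix model *)

Section PresentedRepresentation.
Variables (K : comNzRingType) (P : presentation K) (V : lmodType K).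
Variable op : gens P -> V -> V.

(** A term is read directly as a map on [V], without collecting the operators into an algebra of
    endomorphisms. *)
Fixpoint term_op (s : ncterm K (gens P)) (v : V) : V :=
  match s with
  | NCgen g => op g v
  | NCone => v
  | NCadd s t => term_op s v + term_op t v
  | NCmul s t => term_op s (term_op t v)
  | NCscale c s => c *: term_op s v
  end.

Definition palg_op (x : palg P) (v : V) : V := term_op (repr x) v.

Hypothesis op_linear : forall g, linear (op g).

Lemma term_op_linear s : linear (term_op s).
Proof.
elim: s => [g||s IHs t IHt|s IHs t IHt|c s IHs] a u v //=.
- exact: op_linear.
- by rewrite IHs IHt scalerDr addrACA.
- by rewrite IHt IHs.
- by rewrite IHs scalerDr !scalerA mulrC.
Qed.

Hypothesis op_rel : forall s t, rels s t -> forall v, term_op s v = term_op t v.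

Lemma term_op_nceq s t : nceq s t -> forall v, term_op s v = term_op t v.
Proof.
have opD r := linear_addE (term_op_linear r).
have opZ r := linear_scaleE (term_op_linear r).
elim=> {s t} //=.
- by move=> s t u _ e1 _ e2 v; rewrite e1 e2.
- by move=> s s' t t' _ e1 _ e2 v; rewrite e1 e2.
- by move=> s s' t t' _ e1 _ e2 v; rewrite e1 e2.
- by move=> c s s' _ e v; rewrite e.
- by move=> s t u v; rewrite addrA.
- by move=> s t v; rewrite addrC.
- by move=> s v; rewrite scale0r add0r.
- by move=> s v; rewrite scaleN1r addNr scale0r.
- by move=> a b s v; rewrite scalerA.
- by move=> s v; rewrite scale1r.
- by move=> a s t v; rewrite scalerDr.
- by move=> a b s v; rewrite scalerDl.
Qed.

Lemma palg_op_class s v : palg_op (palg_class s) v = term_op s v.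
Proof. exact/term_op_nceq/repr_palg. Qed.

Lemma palg_opD x y v : palg_op (x + y) v = palg_op x v + palg_op y v.
Proof.
by elim/palg_ind: x => s; elim/palg_ind: y => t; rewrite -palg_classD !palg_op_class.
Qed.

Lemma palg_opM x y v : palg_op (x * y) v = palg_op x (palg_op y v).
Proof.
by elim/palg_ind: x => s; elim/palg_ind: y => t; rewrite -palg_classM !palg_op_class.
Qed.

Lemma palg_opZ c x v : palg_op (c *: x) v = c *: palg_op x v.
Proof. by elim/palg_ind: x => s; rewrite -palg_classZ !palg_op_class. Qed.

Lemma palg_op1 v : palg_op 1 v = v.
Proof. by rewrite -palg_class1 palg_op_class. Qed.

Lemma palg_op0 v : palg_op 0 v = 0.
Proof. by have := palg_opZ 0 0 v; rewrite !scale0r. Qed.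

Lemma palg_opN x v : palg_op (- x) v = - palg_op x v.
Proof. by rewrite -scaleN1r palg_opZ scaleN1r. Qed.

Lemma palg_op_gen g v : palg_op (palg_gen g) v = op g v.
Proof. exact: palg_op_class. Qed.

End PresentedRepresentation.

Lemma palg_gen_ind (K : comNzRingType) (P : presentation K) (Q : palg P -> Prop) :
    (forall g, Q (palg_gen g)) -> Q 1 ->
    (forall x y, Q x -> Q y -> Q (x + y)) ->
    (forall x y, Q x -> Q y -> Q (x * y)) ->
    (forall c x, Q x -> Q (c *: x)) ->
  forall x, Q x.
Proof.
move=> Qg Q1 QD QM QZ; elim/palg_ind; elim=> [g||s Qs t Qt|s Qs t Qt|c s Qs].
- exact: Qg.
- exact: Q1.
- by rewrite palg_classD; apply: QD.
- by rewrite palg_classM; apply: QM.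
- by rewrite palg_classZ; apply: QZ.
Qed.

Lemma fun_addE (T : Type) (M : nmodType) (f g : T -> M) x : (f + g) x = f x + g x.
Proof. by []. Qed.
Lemma fun_scaleE (T : Type) (K : pzRingType) (L : lmodType K) c (f : T -> L) x :
  (c *: f) x = c *: f x.
Proof. by []. Qed.

Section MatrixModel.
Variables (R : realType) (q : R).
Hypothesis q_gt0 : 0 < q.
Hypothesis q_lt1 : q < 1.
Local Notation C := (Cx R).
Local Notation V := ((int * int)%type -> C).
Local Notation qC := (q%:C : C).

Let qC0 : qC != 0.
Proof. by rewrite fmorph_eq0 gt_eqF. Qed.

Definition tgen_op (Y : qspace) (t : tgen) (v : V) : V := fun x =>
  let: (m, j) := x in
  match t with
  | T11 => v (m - 1, j)
  | T12 => qC ^ (- m) * v (m, j - 1)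
  | T21 => - qC ^ (- m - 1) * v (m, j + 1)
  | T22 => - (qC ^ (- (2 * (m + 1))) - qdelta R Y) * v (m + 1, j)
  end.

Lemma tgen_op_linear Y t : linear (tgen_op Y t).
Proof.
move=> a u v; apply/funext => -[m j].
rewrite -[RHS]/(a * tgen_op Y t u (m, j) + tgen_op Y t v (m, j)).
case: t => /=; rewrite -?[(a *: u + v) _]/(a * u _ + v _) //; ring.
Qed.

Lemma qzD (m n : int) : qC ^ (m + n) = qC ^ m * qC ^ n.
Proof. exact: expfzDr. Qed.
Lemma qzN (m : int) : qC ^ (- m) = (qC ^ m)^-1.
Proof. by rewrite invr_expz. Qed.
Lemma qz2 (m : int) : qC ^ (2 * m) = qC ^ m * qC ^ m.
Proof. by rewrite -qzD; congr (_ ^ _); ring. Qed.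
Lemma qz1 : qC ^ (1 : int) = qC.
Proof. exact: expr1z. Qed.
Lemma qz_neq0 (m : int) : qC ^ m != 0.
Proof. exact: expfz_neq0. Qed.
Definition qzE := (qz2, qzD, qzN, qz1, qz2).

Lemma tgen_op_rel Y s t : @rels _ (Pol_presentation q Y) s t ->
  forall v, @term_op _ (Pol_presentation q Y) V (tgen_op Y) s v
          = @term_op _ (Pol_presentation q Y) V (tgen_op Y) t v.
Proof.
move=> r v; apply/funext => -[m j].
have qX0 := qz_neq0 m.
case: r => /=; rewrite ?(fun_addE, fun_scaleE) /= ?(fun_addE, fun_scaleE) /=.
all: rewrite ?(addrK, subrK) ?qzE.
all: rewrite ?rmorphB ?fmorphV /= -?[_ *: _]/(_ * _).
all: by field; rewrite ?qX0 ?qC0.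
Qed.

Section Elements.
Variable Y : qspace.
Local Notation A := (Pol q Y).
Local Notation delta := (qdelta R Y).

Definition mop (f : A) : V -> V := palg_op (P := Pol_presentation q Y) (tgen_op Y) f.

Lemma mop_linear f : linear (mop f).
Proof. exact/term_op_linear/tgen_op_linear. Qed.

Lemma mopD f g v : mop (f + g) v = mop f v + mop g v.
Proof.
exact: (@palg_opD _ (Pol_presentation q Y) V (tgen_op Y) (@tgen_op_linear Y) (@tgen_op_rel Y)).
Qed.
Lemma mopM f g v : mop (f * g) v = mop f (mop g v).
Proof.
exact: (@palg_opM _ (Pol_presentation q Y) V (tgen_op Y) (@tgen_op_linear Y) (@tgen_op_rel Y)).
Qed.
Lemma mopZ c f v : mop (c *: f) v = c *: mop f v.
Proof.
exact: (@palg_opZ _ (Pol_presentation q Y) V (tgen_op Y) (@tgen_op_linear Y) (@tgen_op_rel Y)).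
Qed.
Lemma mop1 v : mop 1 v = v.
Proof.
exact: (@palg_op1 _ (Pol_presentation q Y) V (tgen_op Y) (@tgen_op_linear Y) (@tgen_op_rel Y)).
Qed.
Lemma mopN f v : mop (- f) v = - mop f v.
Proof.
exact: (@palg_opN _ (Pol_presentation q Y) V (tgen_op Y) (@tgen_op_linear Y) (@tgen_op_rel Y)).
Qed.
Lemma mop0 v : mop 0 v = 0.
Proof.
exact: (@palg_op0 _ (Pol_presentation q Y) V (tgen_op Y) (@tgen_op_linear Y) (@tgen_op_rel Y)).
Qed.
Lemma mop_tY t v : mop (tY q Y t) v = tgen_op Y t v.
Proof.
exact: (@palg_op_gen _ (Pol_presentation q Y) V (tgen_op Y) (@tgen_op_linear Y) (@tgen_op_rel Y)).
Qed.

Definition dirac (x : int * int) : V := fun y => (y == x)%:R.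

(** The column is taken at z-degree 0 because every operator commutes with the shift of [j]; see
    [mop_dirac]. *)
Definition mc (f : A) (m' m'' j : int) : C := mop f (dirac (m'', 0)) (m', j).

Lemma mcD f g m' m'' j : mc (f + g) m' m'' j = mc f m' m'' j + mc g m' m'' j.
Proof. by rewrite /mc mopD. Qed.
Lemma mcZ c f m' m'' j : mc (c *: f) m' m'' j = c * mc f m' m'' j.
Proof. by rewrite /mc mopZ. Qed.
Lemma mc0 m' m'' j : mc 0 m' m'' j = 0.
Proof. by rewrite /mc mop0. Qed.

(* [m] indexes the point q^(-2m) of P_Y. *)
Definition okY (m : int) : bool := if Y is Xtilde then 0 <= m else true.

Local Notation band := (seq ((int -> C) * (int * int))).

(* A triple (w, (n, k)) stands for the operator v |-> w(m) v(m - n, j - k). By the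
   second clause the span of the e_m with [okY m] is invariant. *)
Definition band_spec (f : A) (L : band) : Prop :=
  (forall v m j, mop f v (m, j) =
     \sum_(x <- L) x.1 m * v (m - x.2.1, j - x.2.2)) /\
  (forall x m, x \in L -> okY (m - x.2.1) -> ~~ okY m -> x.1 m = 0).

Lemma mop_band f : exists L, band_spec f L.
Proof.
elim/palg_gen_ind: f => [t||f g [L [Le Lo]] [M [Me Mo]]|f g [L [Le Lo]] [M [Me Mo]]
    |c f [L [Le Lo]]].
- exists [:: match t with
    | T11 => (fun=> 1, (1, 0))
    | T12 => (fun m => qC ^ (- m), (0, 1))
    | T21 => (fun m => - qC ^ (- m - 1), (0, - 1))
    | T22 => (fun m => - (qC ^ (- (2 * (m + 1))) - delta), (- 1, 0))
    end]; split=> [v m j|x m].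
    rewrite mop_tY big_seq1; case: t => /=; rewrite ?mul1r ?subr0 ?opprK //.
  rewrite mem_seq1 => /eqP -> /=; rewrite /okY; case: t => /=.
  + by case: Y => //; lia.
  + by case: Y => //; rewrite subr0 => ->.
  + by case: Y => //; rewrite subr0 => ->.
  (* Only t_22 lowers m, so the single way out of m >= 0 is from 0 to -1, where its factor is q^0 -
     1. *)
  + case: Y => // m0 m1; have -> : m = - 1 by lia.
    by rewrite addNr mulr0 oppr0 expr0z subrr oppr0.
- exists [:: (fun=> 1, (0, 0))]; split=> [v m j|x m].
    by rewrite mop1 big_seq1 /= mul1r !subr0.
  by rewrite mem_seq1 => /eqP -> /=; rewrite subr0 => ->.
- exists (L ++ M); split=> [v m j|x m].
    by rewrite mopD fun_addE Le Me big_cat.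
  by rewrite mem_cat => /orP[]; [exact: Lo|exact: Mo].
- exists [seq (fun m => x.1 m * y.1 (m - x.2.1), (x.2.1 + y.2.1, x.2.2 + y.2.2))
    | x <- L, y <- M]; split=> [v m j|x m].
    rewrite mopM Le big_allpairs_dep /=; apply: eq_bigr => x _.
    rewrite Me mulr_sumr; apply: eq_bigr => y _ /=.
    by rewrite mulrA !opprD !addrA.
  move=> /allpairsP[[y z] /= [yL zM ->]] /= o1 o2.
  (* A composite step that leaves the admissible rows leaves them in one of its two halves, and the
     coefficient of that half vanishes. *)
  have [k3|k3] := boolP (okY (m - y.2.1)); first by rewrite Lo ?mul0r.
  by rewrite (Mo _ _ zM) ?mulr0 // -addrA -opprD.
- exists [seq (fun m => c * x.1 m, x.2) | x <- L]; split=> [v m j|x m].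
    rewrite mopZ fun_scaleE Le big_map /= scaler_sumr; apply: eq_bigr => x _.
    by rewrite -mulrA.
  by move=> /mapP[y yL ->] /= o1 o2; rewrite Lo ?mulr0.
Qed.

Lemma mc_outside f m' m'' j : okY m'' -> ~~ okY m' -> mc f m' m'' j = 0.
Proof.
have [L [Le Lo]] := mop_band f => k2 k1; rewrite /mc Le big_seq big1 // => x xL.
rewrite /dirac; case: eqP => [[e _]|]; last by rewrite mulr0.
by rewrite Lo ?mul0r // e.
Qed.

(** A band lists the entries of [g] row by row; here it is read by columns. Column [m''] of [g]
    lives in the rows m'' + n, which are the columns of [f] that contribute. *)
Lemma mc_mulr f g L m' m'' j : band_spec g L -> mc (f * g) m' m'' j =
  \sum_(x <- L) x.1 (m'' + x.2.1) * mc f m' (m'' + x.2.1) (j - x.2.2).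
Proof.
move=> [Le _]; have [M [Me _]] := mop_band f.
rewrite /mc mopM Me; under eq_bigr do rewrite Le mulr_sumr.
rewrite exchange_big /=; apply: eq_bigr => x _.
rewrite Me mulr_sumr; apply: eq_bigr => y _.
rewrite /dirac; have [e|ne] := eqVneq (m' - y.2.1) (m'' + x.2.1).
  by rewrite e addrK mulrCA !xpair_eqE !eqxx -(addrA j) [- y.2.2 - _]addrC addrA.
by rewrite !xpair_eqE subr_eq (negPf ne) !mulr0.
Qed.

Lemma mc_mull f g L m' m'' j : band_spec f L -> mc (f * g) m' m'' j =
  \sum_(x <- L) x.1 m' * mc g (m' - x.2.1) m'' (j - x.2.2).
Proof. by move=> [Le _]; rewrite /mc mopM Le. Qed.

End Elements.
End MatrixModel.

(** * Normal forms *)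

Section QCommutation.
Variables (K : comNzRingType) (A : algType K).

Lemma qcommXr (x y : A) (k : K) i : x * y = k *: (y * x) ->
  x * y ^+ i = k ^+ i *: (y ^+ i * x).
Proof.
move=> xy; elim: i => [|i IH]; first by rewrite !expr0 scale1r mul1r mulr1.
rewrite !exprSr mulrA IH -scalerAl -(mulrA _ x) xy -scalerAr scalerA.
by rewrite !mulrA.
Qed.

Lemma qcommV (F : fieldType) (B : algType F) (x y : B) (k : F) : k != 0 ->
  x * y = k *: (y * x) -> y * x = k^-1 *: (x * y).
Proof. by move=> k0 ->; rewrite scalerA mulVf // scale1r. Qed.

End QCommutation.

Section NormalForm.
Variables (R : realType) (q : R).
Hypothesis q_gt0 : 0 < q.
Variable Y : qspace.
Local Notation C := (Cx R).
Local Notation qC := (q%:C : C).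
Local Notation A := (Pol q Y).
Local Notation delta := (qdelta R Y).
Local Notation a := (tY q Y T11).
Local Notation b := (tY q Y T12).
Local Notation c := (tY q Y T21).
Local Notation d := (tY q Y T22).

Let qC0 : qC != 0.
Proof. by rewrite fmorph_eq0 gt_eqF. Qed.

Lemma tab : a * b = qC *: (b * a).
Proof. by have := Pol_relE (Pol_11_12 q Y); rewrite palg_classZ !palg_classM. Qed.
Lemma tcd : c * d = qC *: (d * c).
Proof. by have := Pol_relE (Pol_21_22 q Y); rewrite palg_classZ !palg_classM. Qed.
Lemma tac : a * c = qC *: (c * a).
Proof. by have := Pol_relE (Pol_11_21 q Y); rewrite palg_classZ !palg_classM. Qed.
Lemma tbd : b * d = qC *: (d * b).
Proof. by have := Pol_relE (Pol_12_22 q Y); rewrite palg_classZ !palg_classM. Qed.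
Lemma tbc : b * c = c * b.
Proof. by have := Pol_relE (Pol_12_21 q Y); rewrite !palg_classM. Qed.
Lemma tad : a * d = delta *: 1 + qC *: (b * c).
Proof.
have := Pol_relE (Pol_det q Y).
rewrite palg_classD !palg_classZ !palg_classM scaleN1r palg_class1 => <-.
by rewrite subrK.
Qed.
Lemma tda : d * a = delta *: 1 + qC^-1 *: (b * c).
Proof.
have := Pol_relE (Pol_11_22 q Y).
rewrite palg_classD !palg_classZ !palg_classM scaleN1r => e.
have -> : d * a = a * d - (a * d - d * a) by rewrite opprB addrC subrK.
rewrite [X in _ - X]e.
rewrite -[X in _ - _ *: X]/(b * c) tad rmorphB /= fmorphV scalerBl opprB -addrA.
by congr (_ + _); rewrite addrC subrK.
Qed.

(** Both t_11 t_22 and t_22 t_11 are polynomials in t_12 t_21, so no monomial has to contain both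
    letters. These are the normal monomials before the powers of t_12 t_21 are gathered into a
    polynomial. *)
Inductive monomial_span : A -> Prop :=
| mspan_a i m n : monomial_span (a ^+ i * b ^+ m * c ^+ n)
| mspan_d i m n : monomial_span (b ^+ m * c ^+ n * d ^+ i)
| mspanD x y of monomial_span x & monomial_span y : monomial_span (x + y)
| mspanZ k x of monomial_span x : monomial_span (k *: x).

Let qcomm_bc i j x (k : C) : x * b = k *: (b * x) -> x * c = k *: (c * x) ->
  x * (b ^+ i * c ^+ j) = k ^+ (i + j) *: (b ^+ i * c ^+ j * x).
Proof.
move=> xb xc; rewrite mulrA (qcommXr _ xb) -scalerAl -(mulrA _ x) (qcommXr _ xc).
by rewrite -scalerAr scalerA mulrA exprD.
Qed.

Let mul_bc_front (M x : A) : b * M = M * b -> c * M = M * c ->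
  M * (qC *: (b * c)) * x = qC *: (b * (c * (M * x))).
Proof.
by move=> bM cM; rewrite -scalerAr -scalerAl !mulrA -(mulrA b c) cM (mulrA b) bM.
Qed.

Lemma mspan_mulb x : monomial_span x -> monomial_span (b * x).
Proof.
elim=> [i m n|i m n|x1 y _ IH1 _ IH2|k x1 _ IH].
- rewrite !mulrA (qcommXr _ (qcommV qC0 tab)) -!scalerAl -[_ * b * _]mulrA -exprS.
  exact/mspanZ/mspan_a.
- by rewrite !mulrA -exprS; apply: mspan_d.
- by rewrite mulrDr; apply: mspanD.
- by rewrite -scalerAr; apply: mspanZ.
Qed.

Lemma mspan_mulc x : monomial_span x -> monomial_span (c * x).
Proof.
have cb m : c * b ^+ m = b ^+ m * c.
  by rewrite (qcommXr (k := 1)) ?expr1n ?scale1r ?tbc.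
elim=> [i m n|i m n|x1 y _ IH1 _ IH2|k x1 _ IH].
- rewrite !mulrA (qcommXr _ (qcommV qC0 tac)) -!scalerAl -[_ * c * _]mulrA cb.
  by rewrite mulrA -[_ * c * _]mulrA -exprS; apply/mspanZ/mspan_a.
- by rewrite !mulrA cb -[_ * c * _]mulrA -exprS; apply: mspan_d.
- by rewrite mulrDr; apply: mspanD.
- by rewrite -scalerAr; apply: mspanZ.
Qed.

Lemma mspan_mula x : monomial_span x -> monomial_span (a * x).
Proof.
elim=> [i m n|[|i] m n|x1 y _ IH1 _ IH2|k x1 _ IH].
- by rewrite !mulrA -exprS; apply: mspan_a.
- by rewrite expr0 mulr1 mulrA -[X in X * b ^+ m]expr1; apply: mspan_a.
(* The one case where a forbidden product appears: [a] is moved next to [d], and [a * d] is replaced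
   by its value in [b * c]. *)
- rewrite exprS !mulrA -(mulrA a) (qcomm_bc _ _ tab tac) -!scalerAl; apply: mspanZ.
  rewrite -(mulrA _ a) tad mulrDr mulrDl -scalerAr mulr1 -scalerAl.
  apply: mspanD; first exact/mspanZ/mspan_d.
  have -> : b ^+ m * c ^+ n * (qC *: (b * c)) * d ^+ i =
      qC *: (b * (c * (b ^+ m * c ^+ n * d ^+ i))).
    have bM : b * (b ^+ m * c ^+ n) = b ^+ m * c ^+ n * b.
      by rewrite (@qcomm_bc _ _ _ 1) ?expr1n ?scale1r ?tbc.
    have cM : c * (b ^+ m * c ^+ n) = b ^+ m * c ^+ n * c.
      by rewrite (@qcomm_bc _ _ _ 1) ?expr1n ?scale1r ?tbc.
    exact: mul_bc_front.
  exact/mspanZ/mspan_mulb/mspan_mulc/mspan_d.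
- by rewrite mulrDr; apply: mspanD.
- by rewrite -scalerAr; apply: mspanZ.
Qed.

Lemma mspan_muld x : monomial_span x -> monomial_span (d * x).
Proof.
have dbc := qcomm_bc _ _ (qcommV qC0 tbd) (qcommV qC0 tcd).
elim=> [[|i] m n|i m n|x1 y _ IH1 _ IH2|k x1 _ IH].
- by rewrite expr0 mul1r dbc -[X in _ * X]expr1; apply/mspanZ/mspan_d.
- rewrite exprS !mulrA tda !mulrDl -!scalerAl mul1r.
  apply: mspanD; first exact/mspanZ/mspan_a.
  rewrite -!mulrA; apply/mspanZ/mspan_mulb/mspan_mulc.
  by rewrite mulrA; apply: mspan_a.
- by rewrite mulrA dbc -scalerAl -(mulrA _ d) -exprS; apply/mspanZ/mspan_d.
- by rewrite mulrDr; apply: mspanD.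
- by rewrite -scalerAr; apply: mspanZ.
Qed.

Lemma mspan_all f : monomial_span f.
Proof.
suff H g : monomial_span g -> monomial_span (f * g).
  by rewrite -[f]mulr1; apply: H; have := mspan_a 0 0 0; rewrite !expr0 !mulr1.
elim/palg_gen_ind: f g => [[]||f f' IH IH'|f f' IH IH'|k f IH] g gS.
- exact: mspan_mula.
- exact: mspan_mulb.
- exact: mspan_mulc.
- exact: mspan_muld.
- by rewrite mul1r.
- by rewrite mulrDl; apply: mspanD; [apply: IH|apply: IH'].
- by rewrite -mulrA; apply: IH; apply: IH'.
- by rewrite -scalerAl; apply/mspanZ/IH.
Qed.

Local Open Scope fset_scope.

(** Any finite set outside which [w] vanishes may serve as index set, so two normal forms can be
    summed over a common one. *)
Lemma is_normal_formP f (w : Mpp -> {poly C}) : is_normal_form f w <->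
  exists D : {fset Mpp}, (forall m, m \notin D -> w m = 0) /\
    f = \sum_(m <- D) normal_term q Y m (w m).
Proof.
have nt0 m : normal_term q Y m 0 = 0.
  by rewrite /normal_term; case: (val m) => [[[i1 i2] j1] j2]; rewrite rmorph0 mulr0 !mul0r.
split=> [[/finite_fsetP[D eD] ->]|[D [wD ->]]].
  have wD m : m \notin D -> w m = 0.
    move=> mD; apply/eqP/negP => /negP w0; move/negP: mD; apply.
    by have : [set m | w m != 0] m by []; rewrite eD.
  by exists D; split => //; apply: fsbigTE => m mD; rewrite wD ?nt0.
split; last by symmetry; apply: fsbigTE => m mD; rewrite wD ?nt0.
apply: (@sub_finite_set _ _ [set` D]) => // m /= w0.
by apply/negP => /negP mD; rewrite wD ?eqxx in w0.
Qed.

End NormalForm.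

(** * Coefficients of the normal form as matrix entries *)

Section Coefficients.
Variables (R : realType) (q : R).
Hypothesis q_gt0 : 0 < q.
Hypothesis q_lt1 : q < 1.
Variable Y : qspace.
Local Notation C := (Cx R).
Local Notation qC := (q%:C : C).
Local Notation A := (Pol q Y).
Local Notation delta := (qdelta R Y).
Local Notation a := (tY q Y T11).
Local Notation b := (tY q Y T12).
Local Notation c := (tY q Y T21).
Local Notation d := (tY q Y T22).
Local Notation V := ((int * int)%type -> C).
Local Notation mopD := (mopD q_gt0).
Local Notation mopM := (mopM q_gt0).
Local Notation mopZ := (mopZ q_gt0).
Local Notation mopN := (mopN q_gt0).
Local Notation mop1 := (mop1 q_gt0).
Local Notation mop0 := (mop0 q_gt0).
Local Notation mop_tY := (mop_tY q_gt0).

Let qC0 : qC != 0.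
Proof. by rewrite fmorph_eq0 gt_eqF. Qed.

(* Product of the matrix entries of t_11^* along the path from m + k down to m. *)
Definition lower (m : int) (k : nat) : C :=
  \prod_(i < k) (qC ^ (- (2 * (m + 1 + i%:Z))) - delta).

Lemma mop_t12s (v : V) m j : mop (t12s q Y) v (m, j) = qC ^ (- m) * v (m, j + 1).
Proof.
rewrite mopZ mop_tY fun_scaleE /= -[_ *: _]/(_ * _) !(qzE q_gt0).
by field; rewrite qC0 qz_neq0.
Qed.

Lemma mop_t11s (v : V) m j :
  mop (t11s q Y) v (m, j) = (qC ^ (- (2 * (m + 1))) - delta) * v (m + 1, j).
Proof. by rewrite mopN mop_tY -[LHS]/(- _) /= mulNr opprK. Qed.

Lemma mop_a_exp i (v : V) m j : mop (a ^+ i) v (m, j) = v (m - i%:Z, j).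
Proof.
elim: i m => [|i IH] m; first by rewrite expr0 mop1 subr0.
rewrite exprS mopM mop_tY /= IH; congr (v (_, _)); rewrite intS; ring.
Qed.

Lemma mop_b_exp i (v : V) m j :
  mop (b ^+ i) v (m, j) = (qC ^ (- m)) ^+ i * v (m, j - i%:Z).
Proof.
elim: i j => [|i IH] j; first by rewrite !expr0 mop1 subr0 mul1r.
rewrite !exprS mopM mop_tY /= IH mulrA; congr (_ * v (_, _)); rewrite intS; ring.
Qed.

Lemma mop_t12s_exp i (v : V) m j :
  mop (t12s q Y ^+ i) v (m, j) = (qC ^ (- m)) ^+ i * v (m, j + i%:Z).
Proof.
elim: i j => [|i IH] j; first by rewrite !expr0 mop1 addr0 mul1r.
rewrite !exprS mopM mop_t12s /= IH mulrA; congr (_ * v (_, _)); rewrite intS; ring.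
Qed.

Lemma mop_t11s_exp i (v : V) m j :
  mop (t11s q Y ^+ i) v (m, j) = lower m i * v (m + i%:Z, j).
Proof.
rewrite /lower; elim: i m => [|i IH] m.
  by rewrite big_ord0 expr0 mop1 addr0 mul1r.
rewrite exprS mopM mop_t11s /= IH mulrA big_ord_recl addr0.
congr (_ * _ * v (_, _)); last by rewrite intS; ring.
by apply: eq_bigr => k _; rewrite /bump /= intS !addrA.
Qed.

Lemma mop_horner psi (v : V) m j :
  mop (horner_alg (b * t12s q Y) psi) v (m, j) = psi.[qC ^ (- (2 * m))] * v (m, j).
Proof.
elim/poly_ind: psi v m j => [|p k IH] v m j; first by rewrite rmorph0 mop0 horner0 mul0r.
rewrite rmorphD rmorphM /= horner_algX horner_algC hornerMXaddC.
rewrite mopD mopM mopZ mop1 fun_addE fun_scaleE IH mopM mop_tY /= mop_t12s.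
rewrite subrK -[_ *: _]/(_ * _) !(qzE q_gt0) invfM; ring.
Qed.

(** The nonzero factor between a coefficient and its matrix entry: a power of q^(-m) from t_12 and
    t_12^*, and a path product from t_11^*; t_11 contributes 1. *)
Definition kap (M : nat * nat * nat * nat) (m : int) : C :=
  let: (i1, i2, j1, j2) := M in (qC ^ (- m)) ^+ (i2 + j2) * lower m j1.

Lemma mop_normal_term (M : Mpp) psi (v : V) m j :
  let: (i1, i2, j1, j2) := val M in
  mop (normal_term q Y M psi) v (m, j) =
    kap (val M) (m - i1%:Z) * psi.[qC ^ (- (2 * (m - i1%:Z)))]
     * v (m - i1%:Z + j1%:Z, j - i2%:Z + j2%:Z).
Proof.
rewrite /normal_term /kap; case: (val M) => [[[i1 i2] j1] j2].
rewrite !mopM mop_a_exp mop_b_exp mop_horner mop_t12s_exp mop_t11s_exp exprD.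
ring.
Qed.

Lemma qz_eq1 (k : int) : (qC ^ k == 1) = (k == 0).
Proof.
have -> : qC ^ k = (q ^ k)%:C by rewrite fmorphXz.
rewrite fmorph_eq1 -(expr0z q); apply/eqP/eqP => [|-> //].
by apply: ieexprIz => //; rewrite lt_eqF.
Qed.

(** For X~ the exponents 2 (m + 1 + i) are positive when m >= 0, so no factor is q^0 - 1; for Xi~
    nothing is subtracted. *)
Lemma lower_neq0 m k : okY Y m -> lower m k != 0.
Proof.
move=> om; rewrite prodf_seq_neq0; apply/allP => i _ /=; rewrite subr_eq0.
case: Y om => /= om; last exact: qz_neq0.
by rewrite qz_eq1; lia.
Qed.

Lemma kap_neq0 M m : okY Y m -> kap M m != 0.
Proof.
case: M => [[[i1 i2] j1] j2] om /=.
by rewrite mulf_neq0 ?lower_neq0 // expf_neq0 // qz_neq0.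
Qed.

Definition pt (k : int) : R := q ^ (- (2 * k)).

Lemma pt_inj : injective pt.
Proof.
move=> k l; rewrite /pt => /ieexprIz => /(_ q_gt0).
by rewrite lt_eqF // => /(_ isT); lia.
Qed.

Lemma ptC k : (pt k)%:C = qC ^ (- (2 * k)) :> C.
Proof. by rewrite fmorphXz. Qed.

Lemma PYP x : PY q Y x <-> exists2 k, okY Y k & x = pt k.
Proof.
rewrite /PY /okY /pt; case: Y => /=; split.
- by move=> [m _ <-]; exists m%:Z => //; rewrite -exprnN.
- by move=> [k k0 ->]; exists `|k|%N => //; rewrite exprnN PoszM gez0_abs.
- by move=> [m _ <-]; exists (- m) => //; rewrite mulrN opprK.
- by move=> [k _ ->]; exists (- k) => //; rewrite mulrN.
Qed.

Lemma PY_exp_ex (x : PY q Y) : {k | okY Y k & val x = pt k}.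
Proof. by apply: cid2; apply/PYP; apply: set_valP. Qed.

Definition PY_exp (x : PY q Y) : int := s2val (PY_exp_ex x).

Lemma PY_exp_ok x : okY Y (PY_exp x).
Proof. exact: (s2valP (PY_exp_ex x)). Qed.
Lemma PY_expE x : val x = pt (PY_exp x).
Proof. exact: (s2valP' (PY_exp_ex x)). Qed.

Definition PY_of k (ok : okY Y k) : PY q Y :=
  SigSub (mem_set ((PYP (pt k)).2 (ex_intro2 _ _ k ok erefl))).

Lemma PY_ofK k (ok : okY Y k) : PY_exp (PY_of ok) = k.
Proof. by apply: pt_inj; rewrite -PY_expE. Qed.

Lemma PY_exp_inj : injective PY_exp.
Proof. by move=> x y e; apply: val_inj; rewrite !PY_expE e. Qed.

(* The matrix entry (row, column, power of t_12) governed by a coefficient. *)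
Definition enc (i : idx q Y) : int * int * int :=
  let: (i1, i2, j1, j2) := val i.1 in
  (PY_exp i.2 + i1%:Z, PY_exp i.2 + j1%:Z, i2%:Z - j2%:Z).

Definition wt (i : idx q Y) : C := kap (val i.1) (PY_exp i.2).

Lemma wt_neq0 i : wt i != 0.
Proof. by case: i => M x; apply/kap_neq0/PY_exp_ok. Qed.

Definition mct (f : A) (t : int * int * int) : C := mc f t.1.1 t.1.2 t.2.

(** This is what i1 j1 = i2 j2 = 0 is for: the point is then the minimum of row and column, i1 and
    j1 are the distances to it, and i2, j2 are the positive and negative parts of the z-degree.
    [enc_surj] uses the same recipe as its witness. *)
Lemma enc_inj : injective enc.
Proof.
move=> [[[[[i1 i2] j1] j2] hM] x] [[[[[i1' i2'] j1'] j2'] hM'] x'].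
rewrite /enc /= => -[e1 e2 e3].
have /andP[h1 h2] : in_Mpp (i1, i2, j1, j2) := hM.
have /andP[h1' h2'] : in_Mpp (i1', i2', j1', j2') := hM'.
have [? [? [? [? e]]]] : i1 = i1' /\ i2 = i2' /\ j1 = j1' /\ j2 = j2'
  /\ PY_exp x = PY_exp x' by nia.
by subst; rewrite (bool_irrelevance hM hM') (PY_exp_inj e).
Qed.

Definition okt (t : int * int * int) : bool := okY Y t.1.1 && okY Y t.1.2.

Lemma enc_ok i : okt (enc i).
Proof.
case: i => M x; have := PY_exp_ok x.
rewrite /okt /enc /=; case: (val M) => [[[i1 i2] j1] j2] /=.
by rewrite /okY; case: Y => // h; lia.
Qed.

Lemma enc_surj t : okt t -> exists i, enc i = t.
Proof.
case: t => [[m' m''] j] /andP[/= h' h''].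
pose k : int := Num.min m' m''.
have hk : okY Y k by rewrite /k /Num.min; case: ifP.
have [jp [jm [jpm ej]]] : exists jp jm : nat, (jp * jm = 0)%N /\ jp%:Z - jm%:Z = j.
  case: j => n; first by exists n, 0%N; rewrite muln0 subr0.
  by exists 0%N, n.+1; rewrite mul0n sub0r NegzE.
have hk' : k <= m' by rewrite /k ge_min lexx.
have hk'' : k <= m'' by rewrite /k ge_min lexx orbT.
have hM : in_Mpp (`|m' - k|%N, jp, `|m'' - k|%N, jm).
  by rewrite /in_Mpp jpm eqxx andbT /k /Num.min; case: ifP => ?; lia.
exists (exist in_Mpp _ hM, PY_of hk); rewrite /enc /= PY_ofK.
by congr (_, _, _) => //; lia.
Qed.

(** Normal terms with different indices occupy disjoint sets of matrix positions, so entries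
    separate the coefficients. *)
Lemma mct_normal_term (M : Mpp) psi (i : idx q Y) :
  mct (normal_term q Y M psi) (enc i) =
  if M == i.1 then wt i * psi.[(val i.2)%:C] else 0.
Proof.
have := mop_normal_term M psi.
case EM : (val M) => [[[i1 i2] j1] j2] H.
case Ei : (val i.1) => [[[i1' i2'] j1'] j2'].
rewrite /mct /enc Ei /mc /= H PY_expE ptC /wt /dirac.
have [e|ne] := eqVneq M i.1.
  move: EM; rewrite e Ei => -[-> -> -> ->]; rewrite addrK.
have -> : i2%:Z - j2%:Z - i2%:Z + j2%:Z = 0 by ring.
  by rewrite eqxx mulr1.
case: eqP => [[e1 e2]|]; last by rewrite mulr0.
case/eqP: ne; apply: val_inj; rewrite EM Ei.
have := valP M; have := valP i.1; rewrite EM Ei /= => /andP[h1 h2] /andP[h1' h2'].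
by congr (_, _, _, _); nia.
Qed.

(** Since t_12 t_12^* = -q t_12 t_21, [minn m n] pairs b c become a power of t_12 t_12^*. Of the
    truncated differences [m - n] and [n - m] at least one is zero, which gives i2 j2 = 0. *)
Lemma scaled_monomial m n : exists2 k : C, k != 0 &
  b ^+ m * c ^+ n = k *: (b ^+ (m - n) * horner_alg (b * t12s q Y) 'X^(minn m n)
                           * t12s q Y ^+ (n - m)).
Proof.
have x_exp k : (b * t12s q Y) ^+ k = (- qC) ^+ k *: (b ^+ k * c ^+ k).
  rewrite /t12s -scalerAr exprZn exprMn_comm //.
  exact: tbc.
have cs_exp k : t12s q Y ^+ k = (- qC) ^+ k *: c ^+ k by rewrite /t12s exprZn.
have mq0 k : (- qC) ^+ k != 0 by rewrite expf_neq0 // oppr_eq0.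
exists ((- qC) ^+ minn m n * (- qC) ^+ (n - m))^-1.
  by rewrite invr_eq0 mulf_neq0.
rewrite rmorphXn /= horner_algX x_exp cs_exp -!scalerAr -!scalerAl !scalerA.
rewrite -mulrA [X in _^-1 * X]mulrC mulVf ?mulf_neq0 // scale1r.
rewrite !mulrA -exprD -mulrA -exprD.
by congr (_ ^+ _ * _ ^+ _); rewrite /minn; case: ltnP; lia.
Qed.

Lemma has_normal_form (f : A) : exists w, is_normal_form f w.
Proof.
have nt_linear M k (p p' : {poly C}) : normal_term q Y M (k *: p + p') =
    k *: normal_term q Y M p + normal_term q Y M p'.
  rewrite /normal_term; case: (val M) => [[[i1 i2] j1] j2].
  rewrite -mul_polyC rmorphD rmorphM /= horner_algC mulr_algl.
  by rewrite mulrDr !mulrDl -!scalerAr -!scalerAl.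
have single (M : Mpp) p : is_normal_form (normal_term q Y M p) (fun m => if m == M then p else 0).
  apply/is_normal_formP; exists [fset M]%fset; split=> [m|].
    by rewrite inE => /negPf ->.
  by rewrite big_seq_fset1 eqxx.
have ntZ M k p : normal_term q Y M (k *: p) = k *: normal_term q Y M p.
  have n0 : normal_term q Y M 0 = 0.
    by have := nt_linear M (-1) 0 0; rewrite scaler0 addr0 scaleN1r addNr.
  by have := nt_linear M k p 0; rewrite n0 !addr0.
have t11s_exp l : t11s q Y ^+ l = (-1) ^+ l *: d ^+ l.
  by rewrite -exprZn scaleN1r.
have mono i m n l : (i * l = 0)%N -> exists w,
    is_normal_form (a ^+ i * (b ^+ m * c ^+ n) * d ^+ l) w.
  move=> il; have [k _ ->] := scaled_monomial m n.
  have hM : in_Mpp (i, m - n, l, n - m)%N.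
    by rewrite /in_Mpp il eqxx /=; apply/eqP; nia.
  (* The sign (-1)^l compensates t_11^* = - t_22. *)
  exists (fun M => if M == exist in_Mpp _ hM then ((-1) ^+ l * k) *: 'X^(minn m n) else 0).
  suff -> : a ^+ i * (k *: (b ^+ (m - n) * horner_alg (b * t12s q Y) 'X^(minn m n)
      * t12s q Y ^+ (n - m))) * d ^+ l =
      normal_term q Y (exist in_Mpp _ hM) (((-1) ^+ l * k) *: 'X^(minn m n)).
    exact: single.
  rewrite ntZ /normal_term /= t11s_exp -!scalerAr -!scalerAl !scalerA.
  congr (_ *: _); last by rewrite !mulrA.
  by rewrite mulrAC -exprD addnn -mul2n exprM sqrrN !expr1n mul1r.
have := mspan_all q_gt0 f; elim=> [i m n|i m n|x y _ [w wP] _ [w' wP']|k x _ [w wP]].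
- by have := mono i m n 0; rewrite muln0 expr0 mulr1 mulrA; apply.
- by have := mono 0 m n i; rewrite mul0n expr0 mul1r; apply.
- exists (fun M => w M + w' M); apply/is_normal_formP.
  move/is_normal_formP: wP => [D [wD ->]]; move/is_normal_formP: wP' => [D' [wD' ->]].
  exists (D `|` D')%fset; split=> [m|].
    by rewrite inE negb_or => /andP[h h']; rewrite wD // wD' // addr0.
  have n0 M : normal_term q Y M 0 = 0 by rewrite -(scale0r 0) ntZ scale0r.
  have wide (E F : {fset Mpp}) w0 : (forall m, m \notin E -> w0 m = 0) ->
      \sum_(m <- E) normal_term q Y m (w0 m) = \sum_(m <- (E `|` F)%fset) normal_term q Y m (w0 m).
    move=> w00; transitivity (\sum_(m \in [set: Mpp]) normal_term q Y m (w0 m)).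
      by symmetry; apply: fsbigTE => m mE; rewrite w00 ?n0.
    apply: fsbigTE => m; rewrite inE negb_or => /andP[mE _].
    by rewrite w00 ?n0.
  rewrite (wide D D') // (wide D' D) // fsetUC -big_split; apply: eq_bigr => m _.
  by have := nt_linear m 1 (w m) (w' m); rewrite !scale1r.
- exists (fun M => k *: w M); apply/is_normal_formP.
  move/is_normal_formP: wP => [D [wD ->]]; exists D; split=> [m mD|].
    by rewrite wD ?scaler0.
  by rewrite scaler_sumr; apply: eq_bigr => M _; rewrite ntZ.
Qed.

(** [coefs] picks some normal form of [f]; at the position [enc i] only its term of index [i.1] has
    an entry, so the value at a point of P_Y does not depend on the choice. *)
Lemma Pol_seriesE (f : A) i : Pol_series f i = mct f (enc i) / wt i.
Proof.
have := xgetPex (fun=> 0) (has_normal_form f).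
rewrite -/(coefs f) => /is_normal_formP[D [cD e]].
rewrite /Pol_series [in RHS]e.
have -> : mct (\sum_(m <- D) normal_term q Y m (coefs f m)) (enc i)
   = \sum_(m <- D) mct (normal_term q Y m (coefs f m)) (enc i).
  elim/big_ind2: _ => [|x s y s' <- <-|//]; first by rewrite /mct mc0.
  by rewrite /mct mcD.
under eq_bigr do rewrite mct_normal_term.
have [iD|iD] := boolP (i.1 \in D).
  rewrite (big_fsetD1 _ iD) /= eqxx big1_fset ?addr0; last first.
    by move=> m; rewrite !inE => /andP[/negPf ->].
  by rewrite mulrC mulKf ?wt_neq0.
rewrite big1_fset => [|m mD _]; first by rewrite cD ?horner0 ?mul0r.
by case: eqP => // e'; rewrite -e' mD in iD.
Qed.

End Coefficients.

(** * Extension by continuity *)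

Section ContinuousExtension.
Variables (V : Type) (X T : topologicalType) (iota : V -> X).

Definition approach (x : X) : set_system V :=
  filter_from (nbhs x) (fun A => iota @^-1` A).

Lemma approach_filter x : Filter (approach x).
Proof.
apply: filter_from_filter; first by exists setT; apply: filterT.
by move=> A B nA nB; exists (A `&` B); [apply: filterI|].
Qed.

Lemma approach_proper x : closure (range iota) x -> ProperFilter (approach x).
Proof.
move=> cx; apply: Build_ProperFilter_ex; last exact: approach_filter.
move=> P [A /cx[_ [[v _ <-] Av]] AP].
by exists v; apply: AP.
Qed.

Lemma cvg_approach (G : X -> T) x : {for x, continuous G} ->
  (fun v => G (iota v)) @ approach x --> G x.
Proof. by move=> cG A nA; exists (G @^-1` A); [apply: cG|]. Qed.

Hypothesis T_hausdorff : hausdorff_space T.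

(** Every extension by continuity is computed through this lemma: a continuous [G] that agrees with
    [g] along [iota] is the limit, unique in a Hausdorff space, so the default [t0] is not
    reached. *)
Lemma cont_ext_eq (t0 : T) (g : V -> T) (G : X -> T) x :
  closure (range iota) x -> continuous G -> (forall v, g v = G (iota v)) ->
  cont_ext t0 iota g x = G x.
Proof.
move=> cx cG gG; have PF := approach_proper cx.
have gx : g @ approach x --> G x.
  by rewrite (funext gG : g = _); apply/cvg_approach/cG.
rewrite /cont_ext; apply: (@cvg_unique _ T_hausdorff (g @ approach x)).
  exact: (xgetPex t0 (ex_intro (fun y => g @ approach x --> y) (G x) gx)).
exact: gx.
Qed.

Lemma continuous_eq_on_closure (G G' : X -> T) x :
  continuous G -> continuous G' -> (forall v, G (iota v) = G' (iota v)) ->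
  closure (range iota) x -> G x = G' x.
Proof.
move=> cG cG' GG' cx; have PF := approach_proper cx.
apply: (@cvg_unique _ T_hausdorff ((fun v => G (iota v)) @ approach x)).
  exact/cvg_approach/cG.
by rewrite (funext GG' : (fun v => G (iota v)) = _); apply/cvg_approach/cG'.
Qed.

End ContinuousExtension.

Section Pointwise.
Variables (I : Type) (K : topologicalType).

Lemma eval_continuous (i : I) : continuous (fun f : I -> K => f i).
Proof. exact: (@proj_continuous {classic I} (fun=> K) i). Qed.

Lemma cvg_pointwise (F : set_system (I -> K)) (f : I -> K) : Filter F ->
  (forall i, (fun g : I -> K => g i) @ F --> f i) -> F --> f.
Proof.
move=> FF cF; apply/cvg_sup => i A [_ [[B oB <-] Bfi] BA].
apply: (filterS BA); apply: cF; exact: open_nbhs_nbhs.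
Qed.

Lemma continuous_pointwise (X : topologicalType) (G : X -> I -> K) :
  (forall i, continuous (fun x => G x i)) -> continuous G.
Proof.
by move=> cG x; apply: cvg_pointwise => i; apply: cG.
Qed.

Lemma pointwise_hausdorff : hausdorff_space K -> hausdorff_space (I -> K).
Proof. by move=> hK; apply: (@hausdorff_product {classic I} (fun=> K)). Qed.

End Pointwise.

Lemma Cx_hausdorff (R : realType) : hausdorff_space (Cx R).
Proof. exact: norm_hausdorff. Qed.

Section ComplexContinuity.
Variables (R : realType) (X : topologicalType).
Local Notation C := (Cx R).

Lemma continuous_scale (k : C) (G : X -> C) :
  continuous G -> continuous (fun x => k * G x).
Proof. by move=> cG x; apply: cvgM; [exact: cvg_cst|exact: cG]. Qed.

Lemma continuous_add (G G' : X -> C) :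
  continuous G -> continuous G' -> continuous (fun x => G x + G' x).
Proof. by move=> cG cG' x; apply: cvgD; [exact: cG|exact: cG']. Qed.

Lemma continuous_lincomb (J : Type) (s : seq J) (k : J -> C) (G : J -> X -> C) :
  (forall j, continuous (G j)) ->
  continuous (fun x => \sum_(j <- s) k j * G j x).
Proof.
move=> cG; elim: s => [|j s IH].
  by under eq_fun do rewrite big_nil; move=> x; exact: cvg_cst.
under eq_fun do rewrite big_cons.
apply: (@continuous_add (fun x => k j * G j x) (fun x => \sum_(i <- s) k i * G i x)).
  exact: continuous_scale (cG j).
exact: IH.
Qed.

End ComplexContinuity.

(** * Continuous functionals *)

Section Functionals.
Variables (R : realType) (q : R).
Hypothesis q_gt0 : 0 < q.
Hypothesis q_lt1 : q < 1.
Variable Y : qspace.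
Local Notation C := (Cx R).
Local Notation A := (Pol q Y).
Local Notation mct := (@mct R q Y).
Local Notation wt := (@wt R q Y).
Local Notation enc := (@enc R q Y).
Local Notation series := (@Pol_series R q Y).
Local Notation wt_neq0 := (wt_neq0 q_gt0 q_lt1).
Local Notation seriesE := (@Pol_seriesE R q q_gt0 q_lt1 Y).

Lemma mctD f g t : mct (f + g) t = mct f t + mct g t.
Proof. exact: mcD. Qed.
Lemma mctZ k f t : mct (k *: f) t = k * mct f t.
Proof. exact: mcZ. Qed.

Lemma seriesD f g i : series (f + g) i = series f i + series g i.
Proof. by rewrite !seriesE mctD mulrDl. Qed.
Lemma seriesZ k f i : series (k *: f) i = k * series f i.
Proof. by rewrite !seriesE mctZ mulrA. Qed.
Lemma series0 i : series 0 i = 0.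
Proof. by rewrite -(scale0r (0 : A)) seriesZ mul0r. Qed.
Lemma series_sum (J : Type) (s : seq J) (F : J -> A) i :
  series (\sum_(j <- s) F j) i = \sum_(j <- s) series (F j) i.
Proof.
elim/big_ind2: _ => [|x s1 y s2 <- <-|//]; first exact: series0.
exact: seriesD.
Qed.

(** Lagrange interpolation inside the single normal term of index [i0.1]: [psi] is 1 at the point of
    [i0] and 0 at the other points of [s]. Repetitions in [s] only repeat factors. *)
Lemma series_dual_basis (s : seq (idx q Y)) i0 : i0 \in s ->
  exists p, {in s, forall i, series p i = (i == i0)%:R}.
Proof.
move=> i0s; pose x (i : idx q Y) : C := (val i.2)%:C.
have x_inj i j : (x i == x j) = (i.2 == j.2).
  by apply/eqP/eqP => [/complexI /val_inj|/(congr1 val)/(congr1 (fun u => u%:C)) //].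
pose psi : {poly C} :=
  \prod_(i <- s | i.2 != i0.2) ((x i0 - x i)^-1 *: ('X - (x i)%:P)).
have psiE y : psi.[y] = \prod_(i <- s | i.2 != i0.2) ((x i0 - x i)^-1 * (y - x i)).
  by rewrite horner_prod; apply: eq_bigr => i _; rewrite !hornerE.
exists (normal_term q Y i0.1 psi) => i i_s; rewrite seriesE mct_normal_term //.
have [e1|ne1] := eqVneq i0.1 i.1; last first.
  by rewrite mul0r; case: eqP => // e; rewrite e eqxx in ne1.
rewrite mulrC mulKf ?wt_neq0 // psiE.
have [e2|ne2] := eqVneq i.2 i0.2.
  have -> : (i == i0) = true.
    by apply/eqP; case: i i0 e1 e2 {i_s i0s psi psiE} => [? ?] [? ?] /= -> ->.
  apply: big1_seq => j /andP[ne _]; rewrite -[(val i.2)%:C]/(x i).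
  have -> : x i = x i0 by apply/eqP; rewrite x_inj e2.
  by rewrite mulVf // subr_eq0 x_inj eq_sym.
have -> : (i == i0) = false by apply: contraNF ne2 => /eqP ->.
apply/eqP; rewrite prodf_seq_eq0; apply/hasP; exists i => //=.
by rewrite ne2 subrr mulr0 eqxx.
Qed.

Lemma series_interpolation (s : seq (idx q Y)) (g : idx q Y -> C) :
  exists p, {in s, series p =1 g}.
Proof.
have ex_p i : exists p, i \in s -> {in s, forall j, series p j = (j == i)%:R}.
  have [is_|is_] := boolP (i \in s); last by exists 0.
  by have [p pP] := series_dual_basis is_; exists p.
have [p pP] := choice ex_p.
exists (\sum_(i <- undup s) g i *: p i) => j js.
rewrite series_sum (bigD1_seq j) ?mem_undup ?undup_uniq //= seriesZ.
rewrite (pP _ js _ js) eqxx mulr1 big1_seq ?addr0 // => i /andP[ne].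
by rewrite mem_undup seriesZ => is_; rewrite (pP _ is_ _ js) eq_sym (negPf ne) mulr0.
Qed.

(** Exact agreement on finite lists of indices: these sets are nonempty by interpolation, and every
    coordinate is eventually constant along them. *)
Definition agree (g : idx q Y -> C) : set_system A :=
  filter_from [set: seq (idx q Y)] (fun s => [set p | {in s, series p =1 g}]).

Lemma agree_filter g : Filter (agree g).
Proof.
apply: filter_from_filter; first by exists [::].
move=> s s' _ _; exists (s ++ s') => // p pP; split=> i is_; apply: pP.
  by rewrite mem_cat is_.
by rewrite mem_cat is_ orbT.
Qed.

Lemma cvg_agree g : series @ agree g --> g.
Proof.
have FF := agree_filter g.
apply: cvg_pointwise => i B /nbhs_singleton Bg.
by exists [:: i] => // p /(_ i); rewrite mem_seq1 eqxx /= => ->.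
Qed.

Lemma series_dense (g : idx q Y -> C) : closure (range series) g.
Proof.
move=> B nB; have [s _ sB] := cvg_agree nB.
have [p pP] := series_interpolation s g.
by exists (series p); split; [exists p|apply: sB].
Qed.

(** Only admissible entries are allowed: an entry in a column m'' < 0 of X~ would involve
    coefficients at points outside P_Y. The inductive form lets properties of functionals be proved
    generator by generator. *)
Inductive mcspan : (A -> C) -> Prop :=
| mcspan_mct t of okt Y t : mcspan (mct^~ t)
| mcspan0 : mcspan (fun=> 0)
| mcspanD l l' of mcspan l & mcspan l' : mcspan (fun f => l f + l' f)
| mcspanZ k l of mcspan l : mcspan (fun f => k * l f).

Lemma mcspan_ext l l' : l =1 l' -> mcspan l -> mcspan l'.
Proof. by move=> /funext ->. Qed.

Lemma mcspan_series i : mcspan (series^~ i).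
Proof.
apply: (@mcspan_ext (fun f => (wt i)^-1 * mct f (enc i))).
  by move=> f; rewrite seriesE mulrC.
exact/mcspanZ/mcspan_mct/enc_ok.
Qed.

Lemma mcspan_sum (J : Type) (s : seq J) (k : J -> C) (l : J -> A -> C) :
  (forall j, mcspan (l j)) -> mcspan (fun f => \sum_(j <- s) k j * l j f).
Proof.
move=> ml; elim: s => [|j s IH].
  by apply: mcspan_ext mcspan0 => f; rewrite big_nil.
apply: mcspan_ext (mcspanD (mcspanZ (k j) (ml j)) IH) => f.
by rewrite big_cons.
Qed.

Lemma mcspan_linear l : mcspan l -> linear (l : A -> C^o).
Proof.
elim=> {l} [t _||l l' _ IH _ IH'|k l _ IH] a f g /=.
- by rewrite mctD mctZ.
- by rewrite scaler0 addr0.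
- by rewrite IH IH' scalerDr addrACA.
- by rewrite IH mulrDr -[a *: l f]/(a * l f) -[a *: _]/(a * _) mulrCA.
Qed.

Lemma mcspan_continuous l : mcspan l ->
  continuous (l : @initial_topology A (Dprime q Y) series -> C).
Proof.
have cs i : continuous (series^~ i : @initial_topology A (Dprime q Y) series -> C).
  move=> f; apply: (@continuous_comp (@initial_topology A (Dprime q Y) series)
      (Dprime q Y) C series (fun g => g i)).
    exact: (@initial_continuous A (Dprime q Y) series f).
  exact: (@eval_continuous (idx q Y) C i).
elim=> {l} [t /(enc_surj q_gt0 q_lt1)[i <-]||l l' _ IH _ IH'|k l _ IH].
- have -> : mct^~ (enc i) = (fun f => wt i * series f i).
    by apply/funext => g; rewrite seriesE mulrCA divff ?wt_neq0 ?mulr1.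
  exact: continuous_scale.
- by move=> f B /nbhs_singleton B0; apply: filterS (@filterT _ (nbhs f) _) => g _.
- exact: (@continuous_add R (@initial_topology A (Dprime q Y) series) l l' IH IH').
- exact: continuous_scale.
Qed.

Definition mcdual l (ml : mcspan l) : Pol_dual q Y :=
  exist _ l (conj (mcspan_linear ml) (mcspan_continuous ml)).

(* A continuous functional vanishes on the common kernel of finitely many
   coordinates, so a dual system for these coordinates expresses it. *)
Lemma Pol_dual_mcspan (l : Pol_dual q Y) : mcspan (sval l).
Proof.
case: l => l [l_lin l_cont] /=.
have l0 : l 0 = 0.
  by have := l_lin (-1) 0 0; rewrite scaler0 addr0 scaleN1r addNr.
have lZ k f : l (k *: f) = k * l f by have := l_lin k f 0; rewrite !addr0 l0 addr0.
have lD f g : l (f + g) = l f + l g by have := l_lin 1 f g; rewrite !scale1r.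
have FF := agree_filter (fun=> 0).
have cvg0 : agree (fun=> 0) --> (0 : @initial_topology A (Dprime q Y) series).
  move=> B [_ [[U oU <-] U0] UB]; apply: (filterS UB).
  apply: (@cvg_agree (fun=> 0)); apply: open_nbhs_nbhs; split => //.
  by have <- : series 0 = (fun=> 0) by apply/funext => i; apply: series0.
have nB : nbhs (l 0) [set z : C | `|z| < 1].
  rewrite l0; apply: filterS (@nbhsx_ballx _ C 0 1 ltr01) => z.
  by rewrite -ball_normE /= sub0r normrN.
have [s _ sP] := cvg0 _ (l_cont 0 _ nB).
(* The common kernel of the coordinates in [s] is a subspace on which l is bounded by 1; rescaling
   forces l to vanish there. *)
have ker p : {in s, series p =1 (fun=> 0)} -> l p = 0.
  move=> p0; apply/eqP/negP => /negP lp.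
  have /sP : {in s, series ((l p)^-1 *: p) =1 (fun=> 0)}.
    by move=> i /p0 pi; rewrite seriesZ pi mulr0.
  by rewrite /= lZ mulVf // normr1 ltxx.
have ex_p i : exists p, i \in s -> {in s, forall j, series p j = (j == i)%:R}.
  have [is_|is_] := boolP (i \in s); last by exists 0.
  by have [p pP] := series_dual_basis is_; exists p.
have [p pP] := choice ex_p.
apply: (@mcspan_ext (fun f => \sum_(i <- undup s) l (p i) * series f i)); last first.
  by apply: mcspan_sum => i; apply: mcspan_series.
move=> f; pose g := f - \sum_(i <- undup s) series f i *: p i.
have : l g = 0.
  apply: ker => j js; rewrite seriesD -scaleN1r seriesZ series_sum.
  rewrite (bigD1_seq j) ?mem_undup ?undup_uniq //= seriesZ (pP _ js _ js) eqxx mulr1.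
  rewrite big1_seq ?addr0 ?mulN1r ?subrr // => i /andP[ne].
  rewrite mem_undup seriesZ => is_.
  by rewrite (pP _ is_ _ js) eq_sym (negPf ne) mulr0.
rewrite lD -scaleN1r lZ mulN1r => /eqP; rewrite subr_eq0 => /eqP ->.
elim/big_ind2: _ => [|x s1 y s2 -> ->|i _]; rewrite ?l0 ?lD ?lZ //.
exact: mulrC.
Qed.

End Functionals.

(** * The action of the quantum group in the matrix model *)

Section QuantumAction.
Variables (R : realType) (q h : R).
Hypothesis q_gt0 : 0 < q.
Hypothesis q_lt1 : q < 1.
Hypothesis qE : q = expR (- (h / 2)).
Variable Y : qspace.
Local Notation C := (Cx R).
Local Notation qC := (q%:C : C).
Local Notation cC := ((expR (h / 4))%:C : C).
Local Notation A := (Pol q Y).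
Local Notation delta := (qdelta R Y).
Local Notation V := ((int * int)%type -> C).
Local Notation mop := (@mop R q Y).
Local Notation act := (@Pol_act R q h Y).

Let cC0 : cC != 0.
Proof. by rewrite fmorph_eq0 gt_eqF // expR_gt0. Qed.

Let qC0 : qC != 0.
Proof. by rewrite fmorph_eq0 gt_eqF. Qed.

Let qCc : qC = (cC * cC)^-1.
Proof.
rewrite qE -rmorphM -fmorphV /= -expRD -expRN; congr (expR _)%:C.
by field.
Qed.

Let ciE : (expR (- (h / 4)))%:C = cC^-1 :> C.
Proof. by rewrite expRN fmorphV. Qed.

Let cN1 : 1 - cC ^+ 4 != 0.
Proof.
have : qC ^+ 2 != 1.
  by rewrite -rmorphXn /= fmorph_eq1 lt_eqF // expr_lt1 // ltW.
apply: contraNneq => e; rewrite qCc exprVn -expr2 -exprM; apply/eqP.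
by move/eqP: e; rewrite subr_eq0 => /eqP <-; rewrite invr1.
Qed.

Let mop1 := @mop1 R q q_gt0 Y.
Let mopN := @mopN R q q_gt0 Y.
Let mop0 := @mop0 R q q_gt0 Y.
Let mopD := @mopD R q q_gt0 Y.
Let mopM := @mopM R q q_gt0 Y.
Let mopZ := @mopZ R q q_gt0 Y.
Let mop_tY := @mop_tY R q q_gt0 Y.

Lemma mop_addv f u v : mop f (u + v) = mop f u + mop f v.
Proof. exact: linear_addE (mop_linear f) u v. Qed.
Lemma mop_scalev f k v : mop f (k *: v) = k *: mop f v.
Proof. exact: linear_scaleE (mop_linear f) k v. Qed.

Lemma mop_subv f u v : mop f (u - v) = mop f u - mop f v.
Proof. by rewrite mop_addv -scaleN1r mop_scalev scaleN1r. Qed.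

(* The weight operator c^(n (m - j)) implements E and E^-1 by conjugation. *)
Definition weight_op (n : int) (v : V) : V := fun x => cC ^ (n * (x.1 - x.2)) * v x.

Lemma weight_opK n v : weight_op (- n) (weight_op n v) = v.
Proof.
apply/funext => x; rewrite /weight_op mulrA -expfzDr // mulNr addNr.
by rewrite expr0z mul1r.
Qed.
Lemma weight_opK1 v : weight_op 1 (weight_op (-1) v) = v.
Proof. exact: (weight_opK (-1)). Qed.
Lemma weight_op_linear n : linear (weight_op n).
Proof.
move=> a u v; apply/funext => x; rewrite -[RHS]/(a * _ + _) /weight_op.
rewrite -[(a *: u + v) x]/(a * u x + v x); ring.
Qed.
Lemma weight_opB n u v : weight_op n (u - v) = weight_op n u - weight_op n v.
Proof.
by rewrite addrC -scaleN1r weight_op_linear scaleN1r addrC.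
Qed.
Lemma weight_opD n u v : weight_op n (u + v) = weight_op n u + weight_op n v.
Proof. exact: linear_addE (weight_op_linear n) u v. Qed.
Lemma weight_opZ n k v : weight_op n (k *: v) = k *: weight_op n v.
Proof.
by apply/funext => x; rewrite -[RHS]/(k * _) /weight_op -[(k *: v) x]/(k * v x) mulrCA.
Qed.

Let act_ind (g : Ugen) (F : A -> V -> V) :
  (forall t v, mop (Pol_act_gen q h Y g t) v = F (tY q Y t) v) ->
  (forall v x, (Ucounit_gen R g : C) * v x = F 1 v x) ->
  (forall f f' v, F (f + f') v = F f v + F f' v) ->
  (forall k f v, F (k *: f) v = k *: F f v) ->
  (forall f f', (forall v, mop (act g f) v = F f v) ->
     (forall v, mop (act g f') v = F f' v) ->
     forall v, mop (act g (f * f')) v = F (f * f') v) ->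
  forall f v, mop (act g f) v = F f v.
Proof.
move=> Fg F1 FD FZ FM; have lin := Pol_act_linear (Y := Y) qE g.
elim/palg_gen_ind=> [t||x y IHx IHy|x y IHx IHy|k x IHx] v.
- by rewrite -[palg_gen t]/(tY q Y t) Pol_act_tY.
- by rewrite Pol_act1 // mopZ mop1; apply/funext => x; exact: F1.
- by rewrite (linear_addE lin) mopD IHx IHy FD.
- exact: FM.
- by rewrite (linear_scaleE lin) mopZ IHx FZ.
Qed.


Lemma mop_actE f v : mop (act gE f) v = weight_op 1 (mop f (weight_op (-1) v)).
Proof.
move: f v; apply: act_ind => [t v|v x|f f' v|k f v|f f' IH IH' v].
- apply/funext => -[m j]; rewrite /weight_op.
  case: t => /=; rewrite mopZ !mop_tY fun_scaleE /= -[_ *: _]/(_ * _) ?ciE;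
  rewrite ?mul1r ?mulN1r ?opprD ?opprK ?(expfzDr _ _ cC0) ?expr1z ?invr_expz -?invr_expz
   ?expr1z;
  move: (qC0) (cC0); move: (qC) (cC) => r c r0 c0; by field; rewrite ?c0 ?r0 ?expfz_neq0.
- by rewrite /= mul1r !mop1 weight_opK1.
- by rewrite mopD weight_opD.
- by rewrite mopZ weight_opZ.
- rewrite (Pol_actM qE) /Ucoprod big_seq1 /= !mopM IH IH' -{2}[1]opprK.
  by rewrite (weight_opK 1).
Qed.

Lemma mop_actEi f v : mop (act gEi f) v = weight_op (-1) (mop f (weight_op 1 v)).
Proof.
move: f v; apply: act_ind => [t v|v x|f f' v|k f v|f f' IH IH' v].
- apply/funext => -[m j]; rewrite /weight_op.
  case: t => /=; rewrite mopZ !mop_tY fun_scaleE /= -[_ *: _]/(_ * _) ?ciE;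
  rewrite ?mul1r ?mulN1r ?opprD ?opprK ?(expfzDr _ _ cC0) ?expr1z ?invr_expz -?invr_expz
   ?expr1z;
  move: (qC0) (cC0); move: (qC) (cC) => r c r0 c0; by field; rewrite ?c0 ?r0 ?expfz_neq0.
- by rewrite /= mul1r !mop1 weight_opK.
- by rewrite mopD weight_opD.
- by rewrite mopZ weight_opZ.
- by rewrite (Pol_actM qE) /Ucoprod big_seq1 /= !mopM IH IH' (weight_opK (-1)).
Qed.

Definition degree_op (v : V) : V := fun x => (x.1 - x.2)%:~R * v x.

Lemma mop_actH f v : mop (act gH f) v = degree_op (mop f v) - mop f (degree_op v).
Proof.
have dD u w : degree_op (u + w) = degree_op u + degree_op w.
  by apply/funext => x; rewrite -[RHS]/(_ + _) /degree_op -[(u + w) x]/(u x + w x) mulrDr.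
have dZ k u : degree_op (k *: u) = k *: degree_op u.
  by apply/funext => x; rewrite -[RHS]/(k * _) /degree_op -[(k *: u) x]/(k * u x) mulrCA.
move: f v; apply: act_ind => [t v|v x|f f' v|k f v|f f' IH IH' v].
- have oppE (u : V) x : (- u) x = - u x by [].
  apply/funext => -[m j]; rewrite -[RHS]/(_ + - _) /degree_op.
  case: t => /=; rewrite ?mopN !mop_tY -?[(- tgen_op _ _ _) _]/(- _) /=;
  by rewrite ?oppE /= !rmorphB /= ?rmorphD /= ?rmorphB /=; ring.
- by rewrite /= mul0r !mop1 subrr.
- by rewrite !mopD dD opprD addrACA.
- by rewrite !mopZ dZ scalerBr.
- rewrite (Pol_actM qE) /Ucoprod !big_cons big_nil addr0 /= mopD !mopM IH IH'.
  by rewrite mop_subv addrA subrK.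
Qed.

(* Since X (f g) = X f . E g + E^-1 f . X g, each X = X^+, X^- has the form
   X f = k (y . E f - E^-1 f . y), with y = t_11 t_12^-1 for X^+ and
   y = t_22 t_21^-1 for X^-. *)
Definition inner_op (k : C) (y : V -> V) (f : A) (v : V) : V :=
  k *: (y (weight_op 1 (mop f (weight_op (-1) v))) -
        weight_op (-1) (mop f (weight_op 1 (y v)))).

(** For a product f f' the two terms E^-1 f . y . E f' cancel, so the twisted commutator obeys the
    same product rule as X^+ and X^-; only the generators t_ij remain to be checked. *)
Let mop_act_inner (g : Ugen) k (y : V -> V) :
  linear y ->
  (forall f f', act g (f * f') = act g f * act gE f' + act gEi f * act g f') ->
  (Ucounit_gen R g : C) = 0 ->
  (forall t v, mop (Pol_act_gen q h Y g t) v = inner_op k y (tY q Y t) v) ->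
  forall f v, mop (act g f) v = inner_op k y f v.
Proof.
move=> ylin gM g0 gt.
have yD := linear_addE ylin; have yZ := linear_scaleE ylin.
apply: act_ind => [t v|v x|f f' v|a f v|f f' IH IH' v].
- exact: gt.
- rewrite g0 mul0r /inner_op !mop1.
  by rewrite weight_opK1 (weight_opK 1) subrr scaler0.
- by rewrite /inner_op !mopD !weight_opD yD opprD addrACA scalerDr.
- by rewrite /inner_op !mopZ !weight_opZ yZ -scalerBr !scalerA mulrC.
- rewrite gM mopD !mopM IH IH' mop_actE mop_actEi /inner_op !mopM.
  rewrite weight_opZ mop_scalev weight_opZ -scalerDr; congr (_ *: _).
  rewrite weight_opB mop_subv weight_opB.
  by rewrite weight_opK1 (weight_opK 1) addrA subrK.
Qed.

Definition yplus (v : V) : V := fun x => qC ^ (x.1 - 1) * v (x.1 - 1, x.2 + 1).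
Definition yminus (v : V) : V := fun x =>
  (qC ^ (- (2 * (x.1 + 1))) - delta) * qC ^ (x.1 + 2) * v (x.1 + 1, x.2 - 1).

Let qcz (n : int) : qC ^ n = (cC ^ n * cC ^ n)^-1.
Proof. by rewrite qCc exprz_inv -invr_expz expfzMl. Qed.

(** The constant is dictated by X^+ t_12 = t_11: with c = [cC] and q = c^(-2), y . E t_12 - E^-1
    t_12 . y equals (c^(-1) - c^3) t_11. *)
Lemma mop_actXp f v : mop (act gXp f) v = inner_op (cC / (1 - cC ^+ 4)) yplus f v.
Proof.
move: f v; apply: mop_act_inner => [k u v|f f'||t v] //.
- apply/funext => x; rewrite -[RHS]/(k * _ + _) /yplus -[(_ + _ : V) _]/(k * u _ + v _).
  ring.
- by rewrite (Pol_actM qE) /Ucoprod !big_cons big_nil addr0.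
apply/funext => -[m j]; rewrite /inner_op -[RHS]/(_ * (_ - _)) /weight_op /yplus.
have two (k : int) : 2 * k = k + k by ring.
have zeroE (y : int * int) : (0 : V) y = 0 by [].
case: t; rewrite /Pol_act_gen ?mop0 ?mop_tY ?zeroE /= ?(addrK, subrK).
all: rewrite ?(two, mul1r, mulN1r, opprD, opprK) !qcz.
all: move: (cC0) (cN1); move: (cC) => c c0 c1.
all: rewrite !(expfzDr _ _ c0) -?invr_expz ?expr1z.
all: by field; rewrite ?c0 ?expfz_neq0.
Qed.

(** Here X^- t_21 = t_22 fixes the constant: y . E t_21 - E^-1 t_21 . y equals (c - c^(-3)) t_22. *)
Lemma mop_actXm f v : mop (act gXm f) v = inner_op (- cC ^+ 3 / (1 - cC ^+ 4)) yminus f v.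
Proof.
move: f v; apply: mop_act_inner => [k u v|f f'||t v] //.
- apply/funext => x; rewrite -[RHS]/(k * _ + _) /yminus -[(_ + _ : V) _]/(k * u _ + v _).
  ring.
- by rewrite (Pol_actM qE) /Ucoprod !big_cons big_nil addr0.
apply/funext => -[m j]; rewrite /inner_op -[RHS]/(_ * (_ - _)) /weight_op /yminus.
have two (k : int) : 2 * k = k + k by ring.
have zeroE (y : int * int) : (0 : V) y = 0 by [].
case: t; rewrite /Pol_act_gen ?mop0 ?mop_tY ?zeroE /= ?(addrK, subrK).
all: rewrite ?(two, mul1r, mulN1r, opprD, opprK) !qcz.
all: move: (cC0) (cN1); move: (cC) => c c0 c1.
all: rewrite !(expfzDr _ _ c0) -?invr_expz ?expr1z.
all: by field; rewrite ?c0 ?expfz_neq0.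
Qed.

End QuantumAction.

(** * The transposed action on continuous functionals *)

Section QuantumActionEntries.
Variables (R : realType) (q h : R).
Hypothesis q_gt0 : 0 < q.
Hypothesis q_lt1 : q < 1.
Hypothesis qE : q = expR (- (h / 2)).
Variable Y : qspace.
Local Notation C := (Cx R).
Local Notation qC := (q%:C : C).
Local Notation cC := ((expR (h / 4))%:C : C).
Local Notation delta := (qdelta R Y).
Local Notation V := ((int * int)%type -> C).
Local Notation mop := (@mop R q Y).
Local Notation act := (@Pol_act R q h Y).
Local Notation mcspan := (@mcspan R q Y).
Local Notation weight_op := (@weight_op R h).

Lemma mop_dirac f m m'' j k : mop f (dirac R (m'', k)) (m, j) = mc f m m'' (j - k).
Proof.
have [L [Le _]] := mop_band q_gt0 q_lt1 f.
rewrite /mc !Le; apply: eq_bigr => x _; rewrite /dirac !xpair_eqE.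
by rewrite -[_ == k]subr_eq0 addrAC -addrA addrCA addrA.
Qed.

Let weight_dirac n (x : int * int) :
  weight_op n (dirac R x) = cC ^ (n * (x.1 - x.2)) *: dirac R x.
Proof.
apply/funext => y; rewrite -[RHS]/(_ * _) /weight_op /dirac.
by case: eqP => [->|]; rewrite ?mulr0.
Qed.

Lemma mcspan_mc m m'' j : okY Y m'' -> mcspan (fun f => mc f m m'' j).
Proof.
move=> ok2; have [ok1|nok1] := boolP (okY Y m).
  by apply: (@mcspan_mct R q Y (m, m'', j)); rewrite /okt ok1.
apply: (@mcspan_ext _ _ _ (fun=> 0)); last exact: mcspan0.
by move=> f; rewrite mc_outside //.
Qed.

(** Weight operators are diagonal and [yplus], [yminus] send one basis vector to a multiple of
    another, so an entry of g . f combines at most two entries of f. *)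
Lemma mcspan_act_mc g m m'' j : okY Y m'' -> mcspan (fun f => mc (act g f) m m'' j).
Proof.
move=> ok2; rewrite /mc; case: g.
- apply: (@mcspan_ext _ _ _ (fun f => ((m - j)%:~R - m''%:~R) * mc f m m'' j)).
    move=> f; rewrite (mop_actH q_gt0 qE) -[RHS]/(_ + - _) mulrBl; congr (_ - _).
    have -> : degree_op (dirac R (m'', 0)) = m''%:~R *: dirac R (m'', 0).
      apply/funext => y; rewrite -[RHS]/(_ * _) /degree_op /dirac.
      by case: eqP => [-> /=|]; rewrite ?mulr0 // subr0.
    by rewrite mop_scalev -[RHS]/(_ * _).
  exact/mcspanZ/mcspan_mc.
- set kx := cC / (1 - cC ^+ 4).
  apply: (@mcspan_ext _ _ _ (fun f =>
    kx * (qC ^ (m - 1) * cC ^ (m - 1 - (j + 1)) * cC ^ (- m'')) * mc f (m - 1) m'' (j + 1)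
    + (- kx * (cC ^ (- (m - j)) * cC ^ (m'' + 2) * qC ^ m'')) * mc f m (m'' + 1) (j + 1))).
    move=> f; rewrite (mop_actXp q_gt0 q_lt1 qE) /inner_op -[RHS]/(_ * (_ - _)) /yplus weight_dirac.
    have -> : (fun x : int * int => qC ^ (x.1 - 1) * dirac R (m'', 0) (x.1 - 1, x.2 + 1))
        = qC ^ m'' *: dirac R (m'' + 1, -1).
      apply/funext => -[x1 x2]; rewrite -[RHS]/(_ * _) /dirac /= !xpair_eqE.
      rewrite subr_eq addr_eq0; case: eqP => [->|]; rewrite ?addrK //= ?mulr0 //.
    rewrite weight_opZ weight_dirac !mop_scalev /weight_op /=.
    rewrite -![(_ *: _ : V) _]/(_ * _) !mop_dirac.
    rewrite ?(mul1r, mulN1r, opprK, subr0).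
    have -> : m'' + 1 + 1 = m'' + 2 by ring.
    rewrite -/kx; move: (kx) (cC ^ _) (cC ^ _) (cC ^ _) (cC ^ _) => k1 c1 c2 c3 c4.
    ring.
  by apply: mcspanD; apply/mcspanZ/mcspan_mc => //; move: ok2; rewrite /okY; case: Y; lia.
- set kx := - cC ^+ 3 / (1 - cC ^+ 4).
  pose k' : C := (qC ^ (- (2 * m'')) - delta) * qC ^ (m'' + 1).
  apply: (@mcspan_ext _ _ _ (fun f =>
    kx * ((qC ^ (- (2 * (m + 1))) - delta) * qC ^ (m + 2) * cC ^ (m + 1 - (j - 1))
          * cC ^ (- m'')) * mc f (m + 1) m'' (j - 1)
    + - kx * (cC ^ (- (m - j)) * cC ^ (m'' - 2)) * (k' * mc f m (m'' - 1) (j - 1)))).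
    move=> f; rewrite (mop_actXm q_gt0 q_lt1 qE) /inner_op -[RHS]/(_ * (_ - _)) /yminus.
    rewrite weight_dirac.
    have -> : (fun x : int * int => (qC ^ (- (2 * (x.1 + 1))) - delta) * qC ^ (x.1 + 2) *
        dirac R (m'', 0) (x.1 + 1, x.2 - 1)) = k' *: dirac R (m'' - 1, 1).
      apply/funext => -[x1 x2]; rewrite -[RHS]/(_ * _) /dirac /= !xpair_eqE /k'.
      rewrite subr_eq0 [x1 == m'' - 1]eq_sym subr_eq [m'' == _]eq_sym.
      case: eqVneq => [<-|_]; rewrite ?mulr0 //=.
      by congr (_ * qC ^ _ * _); ring.
    rewrite weight_opZ weight_dirac !mop_scalev /weight_op /=.
    rewrite -![(_ *: _ : V) _]/(_ * _) !mop_dirac.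
    rewrite ?(mul1r, mulN1r, opprK, subr0).
    have -> : m'' - 1 - 1 = m'' - 2 by ring.
    rewrite -/kx; move: (kx) (cC ^ _) (cC ^ _) (cC ^ _) (cC ^ _) => k1 c1 c2 c3 c4.
    ring.
  apply: mcspanD; first by apply/mcspanZ/mcspan_mc.
  (* The column m'' - 1 is inadmissible only for m'' = 0 and X~, and then [k'] contains the factor
     q^0 - 1. *)
  apply: mcspanZ; have [ok|nok] := boolP (okY Y (m'' - 1)); first by apply/mcspanZ/mcspan_mc.
  apply: (@mcspan_ext _ _ _ (fun=> 0)); last exact: mcspan0.
  have k0 : k' = 0; last by move=> f; rewrite k0 mul0r.
  move: ok2 nok; rewrite /k' /okY; case: (Y) => //= m0 m1.
  have -> : m'' = 0 by lia.
  by rewrite mulr0 oppr0 expr0z subrr !mul0r.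
- apply: (@mcspan_ext _ _ _ (fun f => cC ^ (m - j) * cC ^ (- m'') * mc f m m'' j)).
    move=> f; rewrite (mop_actE q_gt0 qE) weight_dirac mop_scalev weight_opZ.
    by rewrite -[RHS]/(_ * (_ * _)) /= mul1r mulN1r subr0 mulrCA mulrA.
  exact/mcspanZ/mcspan_mc.
- apply: (@mcspan_ext _ _ _ (fun f => cC ^ (- (m - j)) * cC ^ m'' * mc f m m'' j)).
    move=> f; rewrite (mop_actEi q_gt0 qE) weight_dirac mop_scalev weight_opZ.
    by rewrite -[RHS]/(_ * (_ * _)) /= mulN1r mul1r subr0 mulrCA mulrA.
  exact/mcspanZ/mcspan_mc.
Qed.

Lemma mcspan_act g l : mcspan l -> mcspan (fun f => l (act g f)).
Proof.
elim=> {l} [t /andP[_ ok2]||l l' _ IH _ IH'|k l _ IH].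
- exact: mcspan_act_mc.
- exact: mcspan0.
- exact: mcspanD.
- exact: mcspanZ.
Qed.

End QuantumActionEntries.

(** * Finite functions and the invariant integral *)

Section FiniteFunctions.
Variables (R : realType) (q : R).
Hypothesis q_gt0 : 0 < q.
Hypothesis q_lt1 : q < 1.
Variable Y : qspace.
Local Notation C := (Cx R).
Local Notation I := (idx q Y).
Local Notation mct := (@mct R q Y).
Local Notation wt := (@wt R q Y).
Local Notation enc := (@enc R q Y).
Local Notation series := (@Pol_series R q Y).
Local Notation wt_neq0 := (wt_neq0 q_gt0 q_lt1).
Local Notation enc_inj := (enc_inj q_gt0 q_lt1).
Local Notation enc_ok := (enc_ok q_gt0 q_lt1).
Local Notation band := (seq ((int -> C) * (int * int))).

(** The matrix of an arbitrary element of D(Y)_q', with 0 at the inadmissible positions; multiplying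
    by [wt] inverts the division in [Pol_seriesE]. *)
Definition entry (g : I -> C) (t : int * int * int) : C :=
  if pselect (exists i, enc i = t) is left e then wt (sval (cid e)) * g (sval (cid e))
  else 0.

Lemma entry_enc g i : entry g (enc i) = wt i * g i.
Proof.
rewrite /entry; case: pselect => [e|[]]; last by exists i.
by case: (cid e) => /= j /enc_inj ->.
Qed.

Lemma entry_outside g t : ~~ okt Y t -> entry g t = 0.
Proof.
rewrite /entry; case: pselect => // e; case: (cid e) => /= i <-.
by rewrite enc_ok.
Qed.

Lemma entry_series p t : okt Y t -> entry (series p) t = mct p t.
Proof.
move=> /(enc_surj q_gt0 q_lt1)[i <-]; rewrite entry_enc (Pol_seriesE q_gt0 q_lt1).
by rewrite mulrCA divff ?wt_neq0 ?mulr1.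
Qed.

Lemma entry_linear k g g' t : entry (k *: g + g') t = k * entry g t + entry g' t.
Proof.
rewrite /entry; case: pselect => [e|_]; last by rewrite mulr0 addr0.
by rewrite fun_addE fun_scaleE mulrDr -[k *: _]/(k * _) mulrCA.
Qed.

Lemma entry_continuous t : continuous (fun g : I -> C => entry g t).
Proof.
rewrite /entry; case: pselect => [e|_]; last exact: cst_continuous.
exact/continuous_scale/eval_continuous.
Qed.

(* The maps G |-> G a and G |-> a G on matrices G, where [a] has band [L]. *)
Definition rband (L : band) (g : I -> C) : I -> C := fun i =>
  \sum_(x <- L) (x.1 ((enc i).1.2 + x.2.1) / wt i) *
    entry g ((enc i).1.1, (enc i).1.2 + x.2.1, (enc i).2 - x.2.2).
Definition lband (L : band) (g : I -> C) : I -> C := fun i =>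
  \sum_(x <- L) (x.1 (enc i).1.1 / wt i) *
    entry g ((enc i).1.1 - x.2.1, (enc i).1.2, (enc i).2 - x.2.2).

(** A series only knows admissible entries. On the right, an inadmissible column is killed by the
    band coefficient (second clause of [band_spec]); on the left, in [lband_series], an inadmissible
    row is killed by the entry itself ([mc_outside]). *)
Lemma rband_series p a L : band_spec a L -> series (p * a) = rband L (series p).
Proof.
move=> La; apply/funext => i; rewrite (Pol_seriesE q_gt0 q_lt1) /mct /rband.
rewrite (mc_mulr q_gt0 q_lt1 _ _ _ _ La) mulr_suml big_seq [in RHS]big_seq.
apply: eq_bigr => x xL; have /andP[ok1 ok2] := enc_ok i.
have [ok|nok] := boolP (okY Y ((enc i).1.2 + x.2.1)).
  by rewrite entry_series /okt ?ok1 //= mulrAC.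
by rewrite (La.2 _ _ xL) ?mul0r // addrK.
Qed.

Lemma lband_series p a L : band_spec a L -> series (a * p) = lband L (series p).
Proof.
move=> La; apply/funext => i; rewrite (Pol_seriesE q_gt0 q_lt1) /mct /lband.
rewrite (mc_mull q_gt0 _ _ _ _ La) mulr_suml.
apply: eq_bigr => x _; have /andP[ok1 ok2] := enc_ok i.
have [ok|nok] := boolP (okY Y ((enc i).1.1 - x.2.1)).
  by rewrite entry_series /okt ?ok2 ?ok //= mulrAC.
by rewrite entry_outside /okt /= ?(negPf nok) // mc_outside // !mulr0 mul0r.
Qed.

Lemma rband_continuous L : continuous (rband L).
Proof.
apply: continuous_pointwise => i; apply: continuous_lincomb => x.
exact: entry_continuous.
Qed.
Lemma lband_continuous L : continuous (lband L).
Proof.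
apply: continuous_pointwise => i; apply: continuous_lincomb => x.
exact: entry_continuous.
Qed.

Lemma rband_linear L : linear (rband L).
Proof.
move=> k g g'; apply/funext => i; rewrite fun_addE fun_scaleE /rband scaler_sumr -big_split.
by apply: eq_bigr => x _; rewrite entry_linear mulrDr -[k *: _]/(k * _) mulrCA.
Qed.
Lemma lband_linear L : linear (lband L).
Proof.
move=> k g g'; apply/funext => i; rewrite fun_addE fun_scaleE /lband scaler_sumr -big_split.
by apply: eq_bigr => x _; rewrite entry_linear mulrDr -[k *: _]/(k * _) mulrCA.
Qed.

Lemma finsuppP (g : I -> C) : g \in @Defs.finsupp R q Y <->
  exists s : seq (int * int * int), forall t, entry g t != 0 -> t \in s.
Proof.
have -> : (g \in @Defs.finsupp R q Y) = `[< finite_set [set i | g i != 0] >] by [].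
split=> [/asboolP/finite_seqP[s es]|[s sP]].
  exists [seq enc i | i <- s] => t; rewrite /entry.
  case: pselect => [e|_]; last by rewrite eqxx.
  case: (cid e) => /= i <-; rewrite mulf_eq0 negb_or => /andP[_ gi].
  by apply: map_f; have : [set i | g i != 0] i by []; rewrite es.
apply/asboolP; apply: (@sub_finite_set _ _ (enc @^-1` [set` s])).
  by move=> i /= gi; apply: sP; rewrite entry_enc mulf_neq0 ?wt_neq0.
by apply: finite_preimage => // i j _ _; apply: enc_inj.
Qed.

Lemma rband_finsupp L g : g \in @Defs.finsupp R q Y -> rband L g \in @Defs.finsupp R q Y.
Proof.
move=> /finsuppP[s sP]; apply/finsuppP.
exists [seq (t.1.1, t.1.2 - x.2.1, t.2 + x.2.2) | t <- s, x <- L] => t.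
have [/(enc_surj q_gt0 q_lt1)[i <-]|nok] := boolP (okt Y t); last first.
  by rewrite entry_outside ?eqxx.
rewrite entry_enc mulf_eq0 negb_or => /andP[_]; apply: contraNT => /allpairsP notin.
rewrite /rband big_seq big1 // => x xL; apply/eqP; rewrite mulf_eq0; apply/orP; right.
apply: contra_notT notin => /sP ts.
exists (((enc i).1.1, (enc i).1.2 + x.2.1, (enc i).2 - x.2.2), x); split=> //=.
by rewrite addrK subrK -!surjective_pairing.
Qed.

Lemma lband_finsupp L g : g \in @Defs.finsupp R q Y -> lband L g \in @Defs.finsupp R q Y.
Proof.
move=> /finsuppP[s sP]; apply/finsuppP.
exists [seq (t.1.1 + x.2.1, t.1.2, t.2 + x.2.2) | t <- s, x <- L] => t.
have [/(enc_surj q_gt0 q_lt1)[i <-]|nok] := boolP (okt Y t); last first.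
  by rewrite entry_outside ?eqxx.
rewrite entry_enc mulf_eq0 negb_or => /andP[_]; apply: contraNT => /allpairsP notin.
rewrite /lband big_seq big1 // => x xL; apply/eqP; rewrite mulf_eq0; apply/orP; right.
apply: contra_notT notin => /sP ts.
exists (((enc i).1.1 - x.2.1, (enc i).1.2, (enc i).2 - x.2.2), x); split=> //=.
by rewrite !subrK -!surjective_pairing.
Qed.

Local Notation D := (Dfin q Y).

Lemma DfinP (f : D) : dval f \in @Defs.finsupp R q Y.
Proof. exact: valP f. Qed.

Lemma dval_inj : injective (@dval R q Y).
Proof. exact: val_inj. Qed.

Lemma Dfin_linearE k (f g : D) : dval (k *: f + g) = k *: dval f + dval g.
Proof. by []. Qed.

Let Dpt_hausdorff := @pointwise_hausdorff I C (@Cx_hausdorff R).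

(** Density of Pol(Y)_q excludes the default value of [cont_ext], and finiteness of the support of
    [G (dval f)] excludes that of [insubd]. *)
Lemma dval_Dmulr (f : D) a (G : (I -> C) -> I -> C) : continuous G ->
  (forall p, series (p * a) = G (series p)) -> G (dval f) \in @Defs.finsupp R q Y ->
  dval (Dmulr f a) = G (dval f).
Proof.
move=> cG eG fG; rewrite /Dmulr.
rewrite (@cont_ext_eq _ _ _ _ Dpt_hausdorff _ _ G) //; last exact: series_dense.
by rewrite -[dval _]/(val _) insubdK.
Qed.

Lemma dval_Dmull (f : D) a (G : (I -> C) -> I -> C) : continuous G ->
  (forall p, series (a * p) = G (series p)) -> G (dval f) \in @Defs.finsupp R q Y ->
  dval (Dmull a f) = G (dval f).
Proof.
move=> cG eG fG; rewrite /Dmull.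
rewrite (@cont_ext_eq _ _ _ _ Dpt_hausdorff _ _ G) //; last exact: series_dense.
by rewrite -[dval _]/(val _) insubdK.
Qed.

Lemma Dmulr_band f a L : band_spec a L -> dval (Dmulr f a) = rband L (dval f).
Proof.
move=> La; apply: dval_Dmulr; first exact: rband_continuous.
  by move=> p; apply: rband_series.
exact/rband_finsupp/DfinP.
Qed.

Lemma Dmull_band f a L : band_spec a L -> dval (Dmull a f) = lband L (dval f).
Proof.
move=> La; apply: dval_Dmull; first exact: lband_continuous.
  by move=> p; apply: lband_series.
exact/lband_finsupp/DfinP.
Qed.

Lemma Dmulr_linearl a : linear (fun f : D => Dmulr f a).
Proof.
have [L La] := mop_band q_gt0 q_lt1 a => k f g; apply: dval_inj.
by rewrite (Dmulr_band _ La) !Dfin_linearE rband_linear !(Dmulr_band _ La).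
Qed.

Lemma Dmull_linearr a : linear (fun f : D => Dmull a f).
Proof.
have [L La] := mop_band q_gt0 q_lt1 a => k f g; apply: dval_inj.
by rewrite (Dmull_band _ La) !Dfin_linearE lband_linear !(Dmull_band _ La).
Qed.

Let lin_continuous k (G G' : (I -> C) -> I -> C) : continuous G -> continuous G' ->
  continuous (fun g => k *: G g + G' g).
Proof.
move=> cG cG'; apply: continuous_pointwise => i; apply: continuous_add.
  apply: continuous_scale => x.
  apply: (@continuous_comp _ _ _ G (fun g : I -> C => g i)); first exact: cG.
  exact: eval_continuous.
move=> x; apply: (@continuous_comp _ _ _ G' (fun g : I -> C => g i)); first exact: cG'.
exact: eval_continuous.
Qed.

(** The combination of the two band operators is a continuous extension of multiplication by
    [k *: a + b]; uniqueness of the extension gives linearity. *)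
Lemma Dmulr_linearr f : linear (fun a => Dmulr f a : D).
Proof.
move=> k a b; have [La LaP] := mop_band q_gt0 q_lt1 a.
have [Lb LbP] := mop_band q_gt0 q_lt1 b; apply: dval_inj.
rewrite Dfin_linearE (Dmulr_band _ LaP) (Dmulr_band _ LbP).
apply: (@dval_Dmulr f (k *: a + b) (fun g => k *: rband La g + rband Lb g)).
- by apply: lin_continuous; apply: rband_continuous.
- move=> p; rewrite -(rband_series p LaP) -(rband_series p LbP) mulrDr -scalerAr.
  by apply/funext => i; rewrite (seriesD q_gt0 q_lt1) (seriesZ q_gt0 q_lt1).
- by rewrite rpredD ?rpredZ ?rband_finsupp ?DfinP.
Qed.

Lemma Dmull_linearl f : linear (fun a => Dmull a f : D).
Proof.
move=> k a b; have [La LaP] := mop_band q_gt0 q_lt1 a.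
have [Lb LbP] := mop_band q_gt0 q_lt1 b; apply: dval_inj.
rewrite Dfin_linearE (Dmull_band _ LaP) (Dmull_band _ LbP).
apply: (@dval_Dmull f (k *: a + b) (fun g => k *: lband La g + lband Lb g)).
- by apply: lin_continuous; apply: lband_continuous.
- move=> p; rewrite -(lband_series p LaP) -(lband_series p LbP) mulrDl -scalerAl.
  by apply/funext => i; rewrite (seriesD q_gt0 q_lt1) (seriesZ q_gt0 q_lt1).
- by rewrite rpredD ?rpredZ ?lband_finsupp ?DfinP.
Qed.

End FiniteFunctions.

(** * The integral as a weighted trace *)

Section InvariantIntegral.
Variables (R : realType) (q : R).
Hypothesis q_gt0 : 0 < q.
Hypothesis q_lt1 : q < 1.
Local Notation C := (Cx R).
Local Notation A := (Pol q).
Local Notation D := (Dfin q).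
Local Notation mct := (@mct R q _).
Local Notation wt := (@wt R q _).
Local Notation enc := (@enc R q _).
Local Notation entry := (@entry R q _).
Local Notation ptC k := ((pt q k)%:C : C).

Lemma psi0_pt (Y : qspace) (f : D Y) k : psi0 f (pt q k) = entry (dval f) (k, k, 0).
Proof.
have [ok|nok] := boolP (okY Y k); last first.
  rewrite (entry_outside q_gt0 q_lt1) /okt ?(negPf nok) //.
  rewrite /psi0 insubF //; apply/negP; rewrite inE => /(PYP q)[l ok_l].
  by move=> /(pt_inj q_gt0 q_lt1) e; rewrite e ok_l in nok.
have e : pt q k = val (PY_of q ok) by [].
have enc0 : enc (Mpp0, PY_of q ok) = (k, k, 0).
  by rewrite /enc /= PY_ofK // !addr0.
rewrite -enc0 (entry_enc q_gt0 q_lt1) /psi0 e valK /=.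
by rewrite /wt /kap /= expr0 mul1r /lower big_ord0 mul1r.
Qed.

(** By [psi0_pt] the coefficient psi_0000(q^(-2k)) is the diagonal entry at k. Since inadmissible
    entries are 0, the sums over nat and over int both become a trace weighted by q^(-2k). *)
Lemma nu_sum (Y : qspace) (f : D Y) (s : seq int) : uniq s ->
    (forall k, k \notin s -> entry (dval f) (k, k, 0) = 0) ->
  nu f = (1 - q ^+ 2)%:C * \sum_(k <- s) entry (dval f) (k, k, 0) * ptC k.
Proof.
move=> us sP; rewrite /nu; congr (_ * _).
have outside k : ~~ okY Y k -> entry (dval f) (k, k, 0) = 0.
  by move=> nok; rewrite (entry_outside q_gt0 q_lt1) /okt ?(negPf nok).
case: Y f sP outside => f sP outside.
  pose r : seq nat := [seq `|k|%N | k <- s & 0 <= k].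
  have ur : uniq r.
    rewrite map_inj_in_uniq ?filter_uniq // => k l.
    by rewrite !mem_filter => /andP[k0 _] /andP[l0 _]; lia.
  have termE m : psi0 f (q ^- (2 * m)) * (q ^- (2 * m))%:C =
      entry (dval f) (m%:Z, m%:Z, 0) * ptC m%:Z.
    by rewrite -psi0_pt /pt -exprnN.
  rewrite (fsbigE r) //; last first.
    move=> m _ mr; rewrite termE sP ?mul0r //; apply: contra mr => ms.
    by apply/mapP; exists m%:Z; rewrite ?mem_filter.
  rewrite big_map big_filter_cond big_mkcond [RHS]big_seq /=.
  rewrite [LHS]big_seq; apply: eq_bigr => k _.
  rewrite in_setT andbT; case: ifP => [k0|/negbT k0].
    by rewrite termE gez0_abs.
  by rewrite outside ?mul0r.
rewrite (fsbigE s) //; last first.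
  move=> k _ /sP e.
  by rewrite -[q ^ _]/(pt q k) psi0_pt e mul0r.
rewrite big_mkcond /=.
by apply: eq_bigr => k _; rewrite in_setT -psi0_pt.
Qed.

Lemma nu_linear (Y : qspace) : linear (@nu R q Y : D Y -> C^o).
Proof.
move=> k f g; have [s sP] := (finsuppP q_gt0 q_lt1 _).1 (DfinP f).
have [s' sP'] := (finsuppP q_gt0 q_lt1 _).1 (DfinP g).
pose r := undup [seq t.1.1 | t <- s ++ s'].
have ur : uniq r by apply: undup_uniq.
have rf m : m \notin r -> entry (dval f) (m, m, 0) = 0.
  apply: contraNeq => /sP ts; rewrite mem_undup; apply/mapP.
  by exists (m, m, 0); rewrite // mem_cat ts.
have rg m : m \notin r -> entry (dval g) (m, m, 0) = 0.
  apply: contraNeq => /sP' ts; rewrite mem_undup; apply/mapP.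
  by exists (m, m, 0); rewrite // mem_cat ts orbT.
rewrite !(nu_sum ur) // => [|m mr]; last first.
  by rewrite Dfin_linearE entry_linear rf // rg // mulr0 addr0.
rewrite -[RHS]/(k * (_ * _) + _ * _) mulrCA -mulrDr; congr (_ * _).
rewrite mulr_sumr -big_split; apply: eq_bigr => m _ /=.
by rewrite entry_linear mulrDl mulrA.
Qed.

Definition unit_val Y (i : idx q Y) : idx q Y -> C := fun j => (j == i)%:R.

Lemma unit_finsupp Y (i : idx q Y) : unit_val i \in @Defs.finsupp R q Y.
Proof.
apply/(finsuppP q_gt0 q_lt1); exists [:: enc i] => t.
have [/(enc_surj q_gt0 q_lt1)[j <-]|nok] := boolP (okt Y t); last first.
  by rewrite (entry_outside q_gt0 q_lt1) ?eqxx.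
rewrite (entry_enc q_gt0 q_lt1) /unit_val mem_seq1.
by have [->|] := eqVneq j i; rewrite ?mulr0 ?eqxx.
Qed.

Definition Dunit Y (i : idx q Y) : D Y := MkDfin (unit_finsupp i).

Lemma entry_unit Y (i : idx q Y) t :
  entry (dval (Dunit i)) t = (t == enc i)%:R * wt i.
Proof.
have [/(enc_surj q_gt0 q_lt1)[j <-]|nok] := boolP (okt Y t); last first.
  rewrite (entry_outside q_gt0 q_lt1) //; case: eqP => [e|]; rewrite ?mul0r //.
  by rewrite e (enc_ok q_gt0 q_lt1) in nok.
rewrite (entry_enc q_gt0 q_lt1) /= /unit_val (inj_eq (@enc_inj _ _ q_gt0 q_lt1 Y)).
by case: eqP => [->|]; rewrite ?mul1r ?mulr1 // mulr0 mul0r.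
Qed.

(** The trace of a matrix unit in position (m'', m') times [a] is the entry of [a] in position (m',
    m''); the z-degree -j of the unit selects the z-degree j of [a]. *)
Lemma entry_Dmulr_unit Y (i : idx q Y) (a : A Y) m' m'' j k : enc i = (m'', m', - j) ->
  entry (dval (Dmulr (Dunit i) a)) (k, k, 0) = (k == m'')%:R * (wt i * mc a m' m'' j).
Proof.
move=> ei; have [ok|nok] := boolP (okY Y k); last first.
  have := enc_ok q_gt0 q_lt1 i; rewrite ei => /andP[/= okm _].
  rewrite (entry_outside q_gt0 q_lt1) /okt ?(negPf nok) //.
  by case: eqP => [e|]; rewrite ?mul0r //; rewrite e okm in nok.
have [L La] := mop_band q_gt0 q_lt1 a.
rewrite (Dmulr_band q_gt0 q_lt1 _ La).
have /(enc_surj q_gt0 q_lt1)[i' e'] : okt Y (k, k, 0) by rewrite /okt ok.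
rewrite -e' (entry_enc q_gt0 q_lt1) /rband e' /= mulr_sumr.
rewrite /mc La.1 !mulr_sumr; apply: eq_bigr => x _.
rewrite entry_unit ei !xpair_eqE /dirac xpair_eqE sub0r eqr_opp subr_eq0.
have [->|] := eqVneq k m''; last by rewrite /= !mul0r !mulr0.
rewrite /= mul1r (eq_sym j) subr_eq [m'' + _ == _]eq_sym.
have [->|] := eqVneq m' (m'' + x.2.1); last by rewrite /= !mulr0 mul0r !mulr0.
move: (wt i') (wt_neq0 q_gt0 q_lt1 i') => w w0; by field.
Qed.

Lemma entry_Dmull_unit Y (i : idx q Y) (a : A Y) m' m'' j k : enc i = (m'', m', - j) ->
  entry (dval (Dmull a (Dunit i))) (k, k, 0) = (k == m')%:R * (wt i * mc a m' m'' j).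
Proof.
move=> ei; have [ok|nok] := boolP (okY Y k); last first.
  have := enc_ok q_gt0 q_lt1 i; rewrite ei => /andP[_ /= okm].
  rewrite (entry_outside q_gt0 q_lt1) /okt ?(negPf nok) //.
  by case: eqP => [e|]; rewrite ?mul0r //; rewrite e okm in nok.
have [L La] := mop_band q_gt0 q_lt1 a.
rewrite (Dmull_band q_gt0 q_lt1 _ La).
have /(enc_surj q_gt0 q_lt1)[i' e'] : okt Y (k, k, 0) by rewrite /okt ok.
rewrite -e' (entry_enc q_gt0 q_lt1) /lband e' /= mulr_sumr.
rewrite /mc La.1 !mulr_sumr; apply: eq_bigr => x _.
rewrite entry_unit ei !xpair_eqE /dirac xpair_eqE sub0r eqr_opp subr_eq0.
have [->|] := eqVneq k m'; last by rewrite andbF /= !mul0r !mulr0.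
rewrite /= mul1r (eq_sym j) andbT.
move: (wt i') (wt_neq0 q_gt0 q_lt1 i') => w w0; by field.
Qed.

Let mass_neq0 : (1 - q ^+ 2)%:C != 0 :> C.
Proof. by rewrite fmorph_eq0 subr_eq0 gt_eqF // expr_lt1 // ltW. Qed.
Let pt_neq0 k : ptC k != 0.
Proof. by rewrite fmorph_eq0 expfz_neq0 // gt_eqF. Qed.

(** Turns integrals into entries. Right multiplication serves the factor Y_1, which carries the
    opposite product; [nu_Dmull_dual] serves Y_2. *)
Lemma nu_Dmulr_dual Y t : okt Y t -> exists (f : D Y) (k : C), k != 0 /\
  forall a, nu (Dmulr f a) = k * mct a t.
Proof.
case: t => [[m' m''] j] /andP[/= ok1 ok2].
have /(enc_surj q_gt0 q_lt1)[i ei] : okt Y (m'', m', - j) by rewrite /okt /= ok2.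
exists (Dunit i), ((1 - q ^+ 2)%:C * (wt i * ptC m'')); split.
  by rewrite mulf_neq0 ?mass_neq0 // mulf_neq0 ?pt_neq0 ?(wt_neq0 q_gt0 q_lt1).
move=> a; rewrite (@nu_sum _ _ [:: m'']) // => [|k]; last first.
  by rewrite mem_seq1 (entry_Dmulr_unit _ _ ei) => /negPf ->; rewrite mul0r.
by rewrite big_seq1 (entry_Dmulr_unit _ _ ei) eqxx mul1r /mct -!mulrA [_ * mc _ _ _ _]mulrC.
Qed.

Lemma nu_Dmull_dual Y t : okt Y t -> exists (f : D Y) (k : C), k != 0 /\
  forall a, nu (Dmull a f) = k * mct a t.
Proof.
case: t => [[m' m''] j] /andP[/= ok1 ok2].
have /(enc_surj q_gt0 q_lt1)[i ei] : okt Y (m'', m', - j) by rewrite /okt /= ok2.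
exists (Dunit i), ((1 - q ^+ 2)%:C * (wt i * ptC m')); split.
  by rewrite mulf_neq0 ?mass_neq0 // mulf_neq0 ?pt_neq0 ?(wt_neq0 q_gt0 q_lt1).
move=> a; rewrite (@nu_sum _ _ [:: m']) // => [|k]; last first.
  by rewrite mem_seq1 (entry_Dmull_unit _ _ ei) => /negPf ->; rewrite mul0r.
by rewrite big_seq1 (entry_Dmull_unit _ _ ei) eqxx mul1r /mct -!mulrA [_ * mc _ _ _ _]mulrC.
Qed.

End InvariantIntegral.

(** * Invariance of the kernels *)

Section InvariantPowers.
Variables (R : realType) (q h : R).
Hypothesis qE : q = expR (- (h / 2)).
Variables Y1 Y2 : qspace.
Local Notation C := (Cx R).
Local Notation A1 := ((Pol q Y1)^c).
Local Notation A2 := (Pol q Y2).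
Local Notation P2 := (Pol2 q Y1 Y2).
Local Notation act2 := (@Pol2_act R q h Y1 Y2).
Local Notation act1 := (@Pol_act R q h Y1).
Local Notation act := (@Pol_act R q h Y2).
Local Notation cC := ((expR (h / 4))%:C : C).
Local Notation ciC := ((expR (- (h / 4)))%:C : C).
Local Notation tp a b := (tpure (a : A1) (b : A2) : P2).

Let oact_linear Y (o : option Ugen) : linear (oapp (@Pol_act R q h Y) id o).
Proof. by case: o => [g|] //=; apply: Pol_act_linear. Qed.


Let act_linl g (b : A2) : linear (fun a : A1 => \sum_(d <- Ucoprod g)
  tp (oapp act1 id d.1 a) (oapp act id d.2 b)).
Proof.
move=> k a a'; rewrite scaler_sumr -big_split; apply: eq_bigr => d _.
by rewrite [oapp _ _ _ _](@oact_linear Y1 d.1 k a a'); apply: tpure_linl.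
Qed.
Let act_linr g (a : A1) : linear (fun b : A2 => \sum_(d <- Ucoprod g)
  tp (oapp act1 id d.1 a) (oapp act id d.2 b)).
Proof.
move=> k b b'; rewrite scaler_sumr -big_split; apply: eq_bigr => d _.
by rewrite [oapp act _ _ _](@oact_linear Y2 d.2 k b b'); apply: tpure_linr.
Qed.

Lemma Pol2_act_linear g : linear (act2 g).
Proof. by apply: tlift_linear; [apply: act_linl|apply: act_linr]. Qed.

Lemma Pol2_act_pure g (a : A1) (b : A2) : act2 g (tp a b) =
  \sum_(d <- Ucoprod g) tp (oapp act1 id d.1 a) (oapp act id d.2 b).
Proof. by apply: tlift_pure; [apply: act_linl|apply: act_linr]. Qed.

Lemma Pol2_actD g (x y : P2) : act2 g (x + y) = act2 g x + act2 g y.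
Proof. exact: linear_addE (Pol2_act_linear g) x y. Qed.
Lemma Pol2_actZ g k (x : P2) : act2 g (k *: x) = k *: act2 g x.
Proof. exact: linear_scaleE (Pol2_act_linear g) k x. Qed.

Lemma Pol2_mulE (a c : A1) (b d : A2) : tp a b * tp c d = tp (a * c) (b * d).
Proof. exact: tens_mulE. Qed.
Lemma Pol2_scalerAl k (x y : P2) : (k *: x) * y = k *: (x * y).
Proof. exact: tens_mulZl. Qed.
Lemma Pol2_scalerAr k (x y : P2) : x * (k *: y) = k *: (x * y).
Proof. exact: tens_mulZr. Qed.

Let actM1 g (x y : Pol q Y1) := @Pol_actM R q h Y1 qE g x y.
Let actM2 g (x y : Pol q Y2) := @Pol_actM R q h Y2 qE g x y.
Let convM (a c : A1) : a * c = (c : Pol q Y1) * (a : Pol q Y1) :> Pol q Y1.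
Proof. by []. Qed.

(** With x = a (x) b, the product with c (x) d is c a (x) b d, so x sits between c and d. The legs
    of the iterated coproduct therefore act on c, x, d in this order, which is not the usual product
    rule; this and the next four lemmas record it for each generator. *)
Lemma act_mul_pure_E (x : P2) c d :
  act2 gE (x * tp c d) = act2 gE x * tp (act1 gE c) (act gE d).
Proof.
elim/tens_pure_ind: x => [a b|x y IHx IHy|k x IHx].
- by rewrite Pol2_mulE !Pol2_act_pure /Ucoprod !big_seq1 /= convM actM1 actM2
    /Ucoprod !big_seq1 /= Pol2_mulE.
- by rewrite mulrDl !Pol2_actD IHx IHy mulrDl.
- by rewrite Pol2_scalerAl !Pol2_actZ IHx Pol2_scalerAl.
Qed.

Lemma act_mul_pure_Ei (x : P2) c d : act2 gEi (x * tp c d) =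
  act2 gEi x * tp (act1 gEi c) (act gEi d).
Proof.
elim/tens_pure_ind: x => [a b|x y IHx IHy|k x IHx].
- rewrite Pol2_mulE !Pol2_act_pure /Ucoprod !big_seq1 /= convM actM1 actM2 /Ucoprod !big_seq1 /= Pol2_mulE //.
- by rewrite mulrDl !Pol2_actD IHx IHy !mulrDl.
- by rewrite Pol2_scalerAl !Pol2_actZ IHx !Pol2_scalerAl -?scalerDr.
Qed.

Lemma act_mul_pure_H (x : P2) c d : act2 gH (x * tp c d) =
  act2 gH x * tp c d + x * act2 gH (tp c d).
Proof.
elim/tens_pure_ind: x => [a b|x y IHx IHy|k x IHx].
- rewrite Pol2_mulE !Pol2_act_pure /Ucoprod !(big_cons, big_nil) !addr0 /= convM actM1 actM2.
  rewrite /Ucoprod !(big_cons, big_nil) !addr0 /= mulrDl mulrDr !Pol2_mulE !convM.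
  by rewrite !tpureDl !tpureDr [X in X + _ = _]addrC addrACA.
- by rewrite mulrDl !Pol2_actD IHx IHy !mulrDl; rewrite addrACA.
- by rewrite Pol2_scalerAl !Pol2_actZ IHx !Pol2_scalerAl -?scalerDr.
Qed.

Lemma act_mul_pure_Xp (x : P2) c d : act2 gXp (x * tp c d) =
  act2 gE x * tp (act1 gXp c) (act gE d) + act2 gXp x * tp (act1 gEi c) (act gE d)
  + act2 gEi x * tp (act1 gEi c) (act gXp d).
Proof.
elim/tens_pure_ind: x => [a b|x y IHx IHy|k x IHx].
- rewrite Pol2_mulE !Pol2_act_pure /Ucoprod !(big_cons, big_nil) !addr0 /= convM !actM1 !actM2.
  rewrite /Ucoprod !(big_cons, big_nil) !addr0 /= mulrDl !Pol2_mulE !convM.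
  rewrite !tpureDl !tpureDr -!addrA; by [].
- by rewrite mulrDl !Pol2_actD IHx IHy !mulrDl; rewrite addrACA [X in X + _ = _]addrACA.
- by rewrite Pol2_scalerAl !Pol2_actZ IHx !Pol2_scalerAl -?scalerDr.
Qed.

Lemma act_mul_pure_Xm (x : P2) c d : act2 gXm (x * tp c d) =
  act2 gE x * tp (act1 gXm c) (act gE d) + act2 gXm x * tp (act1 gEi c) (act gE d)
  + act2 gEi x * tp (act1 gEi c) (act gXm d).
Proof.
elim/tens_pure_ind: x => [a b|x y IHx IHy|k x IHx].
- rewrite Pol2_mulE !Pol2_act_pure /Ucoprod !(big_cons, big_nil) !addr0 /= convM !actM1 !actM2.
  rewrite /Ucoprod !(big_cons, big_nil) !addr0 /= mulrDl !Pol2_mulE !convM.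
  rewrite !tpureDl !tpureDr -!addrA; by [].
- by rewrite mulrDl !Pol2_actD IHx IHy !mulrDl; rewrite addrACA [X in X + _ = _]addrACA.
- by rewrite Pol2_scalerAl !Pol2_actZ IHx !Pol2_scalerAl -?scalerDr.
Qed.

Definition act_invariant (x : P2) := forall g, act2 g x = (Ucounit_gen R g : C) *: x.

(** When x is invariant the middle leg of the iterated coproduct collapses to its counit, and the
    outer legs act on y alone. *)
Lemma act_invariant_mul (x y : P2) g : act_invariant x ->
  act2 g (x * y) = x * act2 g y.
Proof.
move=> xinv; have xE : act2 gE x = x by rewrite xinv scale1r.
have xEi : act2 gEi x = x by rewrite xinv scale1r.
have xH : act2 gH x = 0 by rewrite xinv scale0r.
have xp : act2 gXp x = 0 by rewrite xinv scale0r.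
have xm : act2 gXm x = 0 by rewrite xinv scale0r.
elim/tens_pure_ind: y => [c d|y z IHy IHz|k y IHy].
- case: g.
  + by rewrite act_mul_pure_H xH mul0r add0r.
  + rewrite act_mul_pure_Xp xE xEi xp mul0r addr0 Pol2_act_pure /Ucoprod.
    by rewrite !(big_cons, big_nil) addr0 mulrDr.
  + rewrite act_mul_pure_Xm xE xEi xm mul0r addr0 Pol2_act_pure /Ucoprod.
    by rewrite !(big_cons, big_nil) addr0 mulrDr.
  + by rewrite act_mul_pure_E xE Pol2_act_pure /Ucoprod big_seq1.
  + by rewrite act_mul_pure_Ei xEi Pol2_act_pure /Ucoprod big_seq1.
- by rewrite mulrDr !Pol2_actD IHy IHz mulrDr.
- by rewrite Pol2_scalerAr !Pol2_actZ IHy Pol2_scalerAr.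
Qed.

Lemma act_invariantM x y : act_invariant x -> act_invariant y -> act_invariant (x * y).
Proof. by move=> xi yi g; rewrite act_invariant_mul // yi Pol2_scalerAr. Qed.

Lemma act_invariant1 : act_invariant 1.
Proof.
move=> g; rewrite -[1]/(tp 1 1) Pol2_act_pure /Ucoprod.
have a1 g' : act1 g' 1 = (Ucounit_gen R g' : C) *: (1 : Pol q Y1) by apply: Pol_act1.
have a2 g' : act g' 1 = (Ucounit_gen R g' : C) *: (1 : Pol q Y2) by apply: Pol_act1.
case: g; rewrite !(big_cons, big_nil) !addr0 /= ?a1 ?a2 !(tpureZl, tpureZr) ?scalerA
  ?scale0r ?scale1r ?mul0r ?mulr0 ?mul1r ?scale0r ?scale1r ?addr0 //.
Qed.

Lemma act_invariantX x n : act_invariant x -> act_invariant (x ^+ n).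
Proof.
move=> xi; elim: n => [|n IH]; first by rewrite expr0; apply: act_invariant1.
by rewrite exprS; apply: act_invariantM.
Qed.

Lemma k11E : k11 q Y1 Y2 =
  tp (tY q Y1 T11) (tY q Y2 T22) - q%:C *: tp (tY q Y1 T12) (tY q Y2 T21).
Proof. by rewrite /k11 /t_ /tau_ !Pol2_mulE !convM !mul1r. Qed.

Lemma k22E : k22 q Y1 Y2 =
  (- q^-1)%:C *: tp (tY q Y1 T21) (tY q Y2 T12) + tp (tY q Y1 T22) (tY q Y2 T11).
Proof. by rewrite /k22 /t_ /tau_ !Pol2_mulE !convM !mul1r. Qed.

Let a1 g t : act1 g (tY q Y1 t) = Pol_act_gen q h Y1 g t.
Proof. exact: Pol_act_tY. Qed.
Let a2 g t : act g (tY q Y2 t) = Pol_act_gen q h Y2 g t.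
Proof. exact: Pol_act_tY. Qed.

Let tp0l (b : A2) : tp 0 b = 0. Proof. exact: tpure0l. Qed.
Let tp0r (a : A1) : tp a 0 = 0. Proof. exact: tpure0r. Qed.
Let tpZl k (a : A1) (b : A2) : tp (k *: a) b = k *: tp a b. Proof. exact: tpureZl. Qed.
Let tpZr k (a : A1) (b : A2) : tp a (k *: b) = k *: tp a b. Proof. exact: tpureZr. Qed.
Let tpNl (a : A1) (b : A2) : tp (- a) b = - tp a b.
Proof. by rewrite -scaleN1r tpZl scaleN1r. Qed.
Let tpNr (a : A1) (b : A2) : tp a (- b) = - tp a b.
Proof. by rewrite -scaleN1r tpZr scaleN1r. Qed.

Let c_ci := @cci R h.
Let q_cici := @qcici R q h qE.
Let qV_cc := @qVcc R q h qE.

Let cK (x : P2) : cC *: (ciC *: x) = x. Proof. by rewrite scalerA c_ci scale1r. Qed.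
Let ciK (x : P2) : ciC *: (cC *: x) = x. Proof. by rewrite scalerA mulrC c_ci scale1r. Qed.
Let qK (x : P2) : q%:C *: (cC *: x) = ciC *: x.
Proof. by rewrite q_cici scalerA -mulrA [ciC * cC]mulrC c_ci mulr1. Qed.
Let qVK (x : P2) : (q^-1)%:C *: (ciC *: x) = cC *: x.
Proof. by rewrite qV_cc scalerA -mulrA c_ci mulr1. Qed.

(** X^+ yields c^(-1) t_11 (x) t_21 from the first term and -q c times the same tensor from the
    second; they cancel because q = c^(-2). X^- does the same with t_12 (x) t_22. *)
Lemma k11_invariant : act_invariant (k11 q Y1 Y2).
Proof.
move=> g; rewrite k11E -scaleNr Pol2_actD Pol2_actZ !Pol2_act_pure /Ucoprod.
case: g; rewrite !(big_cons, big_nil) !addr0 /= ?a1 ?a2 /= ?(tp0l, tp0r, tpNl, tpNr, tpZl, tpZr).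
all: rewrite ?(cK, ciK).
all: by rewrite ?(scaleNr, qK, add0r, addr0, subrr, addNr, scaler0, oppr0, scale0r, scale1r).
Qed.

Lemma k22_invariant : act_invariant (k22 q Y1 Y2).
Proof.
move=> g; rewrite k22E Pol2_actD Pol2_actZ !Pol2_act_pure /Ucoprod rmorphN.
case: g; rewrite !(big_cons, big_nil) !addr0 /= ?a1 ?a2 /= ?(tp0l, tp0r, tpNl, tpNr, tpZl, tpZr).
all: rewrite ?(cK, ciK).
all: by rewrite ?(scaleNr, qVK, add0r, addr0, subrr, addNr, scaler0, oppr0, scale0r, scale1r).
Qed.

Lemma k_power_invariant l : act_invariant (k22 q Y1 Y2 ^+ l * k11 q Y1 Y2 ^+ l).
Proof.
by apply: act_invariantM; apply: act_invariantX; [apply: k22_invariant|apply: k11_invariant].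
Qed.

Lemma Uterm_act_linear s : linear (Uterm_act act2 s).
Proof.
elim: s => [g||s IHs t IHt|s IHs t IHt|c s IHs] k u v //=.
- exact: Pol2_act_linear.
- by rewrite IHs IHt scalerDr addrACA.
- by rewrite IHt IHs.
- by rewrite IHs scalerDr !scalerA mulrC.
Qed.

(** Both sides are computed on the same representative of [xi], so induction on that term
    suffices. *)
Lemma Uact_invariant (xi : Uq h) x : act_invariant x -> Uact act2 xi x = Ucounit xi *: x.
Proof.
move=> xinv; rewrite /Uact /Ucounit /palg_lift; elim: (repr xi) => [g||s IHs t IHt|s IHs t IHt|c s IHs] /=.
- exact: xinv.
- by rewrite scale1r.
- by rewrite IHs IHt scalerDl.
- by rewrite IHt (linear_scaleE (Uterm_act_linear s)) IHs scalerA mulrC.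
- by rewrite IHs scalerA.
Qed.

End InvariantPowers.

(** * The completion and polynomial vector-functions *)

Section Completion.
Variables (R : realType) (q h : R).
Hypothesis q_gt0 : 0 < q.
Hypothesis q_lt1 : q < 1.
Hypothesis qE : q = expR (- (h / 2)).
Variables Y1 Y2 : qspace.
Local Notation C := (Cx R).
Local Notation A1 := ((Pol q Y1)^c).
Local Notation A2 := (Pol q Y2).
Local Notation P2 := (Pol2 q Y1 Y2).
Local Notation J := (Pol_dual q Y1 * Pol_dual q Y2)%type.
Local Notation act2 := (@Pol2_act R q h Y1 Y2).
Local Notation compl := (@Pol2_compl R q Y1 Y2).

Let pair_linl (l : J) (b : A2) : linear (fun a : A1 => sval l.1 a * sval l.2 b : C^o).
Proof.
case: l => -[l1 [lin1 c1]] l2 k a a' /=.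
have -> : l1 (k *: a + a') = k * l1 a + l1 a' by exact: lin1.
by rewrite mulrDl -mulrA.
Qed.
Let pair_linr (l : J) (a : A1) : linear (fun b : A2 => sval l.1 a * sval l.2 b : C^o).
Proof.
case: l => l1 -[l2 [lin2 c2]] k b b' /=.
have -> : l2 (k *: b + b') = k * l2 b + l2 b' by exact: lin2.
by rewrite mulrDr mulrCA.
Qed.

Lemma compl_pure (a : A1) (b : A2) l : compl (tpure a b) l = sval l.1 a * sval l.2 b.
Proof. exact: (tlift_pure (pair_linl l) (pair_linr l)). Qed.

Lemma compl_linear k (x y : P2) l : compl (k *: x + y) l = k * compl x l + compl y l.
Proof. exact: (tlift_linear (pair_linl l) (pair_linr l)). Qed.

Lemma complD (x y : P2) l : compl (x + y) l = compl x l + compl y l.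
Proof. by have := compl_linear 1 x y l; rewrite scale1r mul1r. Qed.
Lemma compl0 l : compl 0 l = 0.
Proof. by apply: (addrI (compl 0 l)); rewrite -complD !addr0. Qed.
Lemma complZ k (x : P2) l : compl (k *: x) l = k * compl x l.
Proof. by have := compl_linear k x 0 l; rewrite compl0 !addr0. Qed.

(** A point of the completion is a function on pairs of functionals; linear relations between its
    values on the image of Pol(Y_1 x Y_2)_q survive in the closure. The next two lemmas deduce
    linearity in each functional. *)
Lemma Dprime2_lincomb (s : seq (C * J)) l :
  (forall K, compl K l = \sum_(x <- s) x.1 * compl K x.2) ->
  forall F, Dprime2 F -> F l = \sum_(x <- s) x.1 * F x.2.
Proof.
move=> e F; apply: (@continuous_eq_on_closure _ _ _ compl (@Cx_hausdorff R)
  (fun F => F l) (fun F => \sum_(x <- s) x.1 * F x.2)) => //.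
  exact: eval_continuous.
by apply: continuous_lincomb => x; apply: eval_continuous.
Qed.

Lemma Dprime2_comb1 (s : seq (C * Pol_dual q Y1)) (l : J) F : Dprime2 F ->
  (forall a, sval l.1 a = \sum_(x <- s) x.1 * sval x.2 a) ->
  F l = \sum_(x <- s) x.1 * F (x.2, l.2).
Proof.
move=> FD e; rewrite (@Dprime2_lincomb [seq (x.1, (x.2, l.2)) | x <- s]) // ?big_map //.
move=> K; rewrite big_map /=; elim/tens_pure_ind: K => [a b|x y IHx IHy|k x IHx].
- rewrite compl_pure e mulr_suml; apply: eq_bigr => y _.
  by rewrite compl_pure mulrA.
- by rewrite complD IHx IHy -big_split; apply: eq_bigr => z _; rewrite complD mulrDr.
- by rewrite complZ IHx mulr_sumr; apply: eq_bigr => z _; rewrite complZ mulrCA.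
Qed.

Lemma Dprime2_comb2 (s : seq (C * Pol_dual q Y2)) (l : J) F : Dprime2 F ->
  (forall b, sval l.2 b = \sum_(x <- s) x.1 * sval x.2 b) ->
  F l = \sum_(x <- s) x.1 * F (l.1, x.2).
Proof.
move=> FD e; rewrite (@Dprime2_lincomb [seq (x.1, (l.1, x.2)) | x <- s]) // ?big_map //.
move=> K; rewrite big_map /=; elim/tens_pure_ind: K => [a b|x y IHx IHy|k x IHx].
- rewrite compl_pure e mulr_sumr; apply: eq_bigr => y _.
  by rewrite compl_pure mulrCA.
- by rewrite complD IHx IHy -big_split; apply: eq_bigr => z _; rewrite complD mulrDr.
- by rewrite complZ IHx mulr_sumr; apply: eq_bigr => z _; rewrite complZ mulrCA.
Qed.

(** The transpose of one leg of the coproduct; [mcspan_act] ensures that the result is again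
    continuous. *)
Definition odual Y (o : option Ugen) (l : Pol_dual q Y) : Pol_dual q Y :=
  if o is Some g then
    mcdual q_gt0 q_lt1 (mcspan_act q_gt0 q_lt1 qE g (Pol_dual_mcspan q_gt0 q_lt1 l))
  else l.

Lemma odualE Y o (l : Pol_dual q Y) f : sval (odual o l) f = sval l (oapp (@Pol_act R q h Y) id o f).
Proof. by case: o. Qed.

Lemma compl_act g K l :
  compl (act2 g K) l = \sum_(d <- Ucoprod g) compl K (odual d.1 l.1, odual d.2 l.2).
Proof.
elim/tens_pure_ind: K => [a b|x y IHx IHy|k x IHx].
- rewrite Pol2_act_pure //; elim: (Ucoprod g) => [|d s IH].
    by rewrite !big_nil compl0.
  by rewrite !big_cons complD IH compl_pure compl_pure !odualE.
- rewrite Pol2_actD // complD IHx IHy -big_split; apply: eq_bigr => d _.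
  by rewrite complD.
- rewrite Pol2_actZ // complZ IHx mulr_sumr; apply: eq_bigr => d _.
  by rewrite complZ.
Qed.

Lemma compl_Uterm_act s l : exists L : seq (C * J), forall K,
  compl (Uterm_act act2 s K) l = \sum_(x <- L) x.1 * compl K x.2.
Proof.
elim: s l => [g||s IHs t IHt|s IHs t IHt|c s IHs] l /=.
- exists [seq (1, (odual d.1 l.1, odual d.2 l.2)) | d <- Ucoprod g] => K.
  by rewrite compl_act big_map; apply: eq_bigr => d _; rewrite mul1r.
- by exists [:: (1, l)] => K; rewrite big_seq1 mul1r.
- have [L LP] := IHs l; have [M MP] := IHt l; exists (L ++ M) => K.
  by rewrite complD LP MP big_cat.
- have [L LP] := IHs l; have [M MP] := choice IHt.
  exists [seq (x.1 * y.1, y.2) | x <- L, y <- M x.2] => K.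
  rewrite LP big_allpairs_dep /=; apply: eq_bigr => x _.
  by rewrite MP mulr_sumr; apply: eq_bigr => y _ /=; rewrite mulrA.
- have [L LP] := IHs l; exists [seq (c * x.1, x.2) | x <- L] => K.
  by rewrite complZ LP big_map mulr_sumr; apply: eq_bigr => x _; rewrite mulrA.
Qed.

Lemma Dprime2_actE (xi : Uq h) l : exists L : seq (C * J),
  (forall K, compl (Uact act2 xi K) l = \sum_(x <- L) x.1 * compl K x.2) /\
  (forall F, Dprime2 F -> Dprime2_act xi F l = \sum_(x <- L) x.1 * F x.2).
Proof.
(* A list is chosen for every pair of functionals, because the continuous extension has to be
   exhibited in all coordinates at once. *)
have [L LP] := choice (compl_Uterm_act (repr xi)).
exists (L l); split => [K|F FD]; first exact: LP.
have := @cont_ext_eq _ _ _ compl (@pointwise_hausdorff J C (@Cx_hausdorff R))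
  0 (fun K => compl (Uact act2 xi K)) (fun F l => \sum_(x <- L l) x.1 * F x.2) F FD.
rewrite -/(Dprime2_act xi F) => -> //.
  apply: continuous_pointwise => i; apply: continuous_lincomb => x.
  exact: eval_continuous.
by move=> K; apply/funext => i; apply: LP.
Qed.

(** * Laurent polynomials in lambda *)

Definition laurent (phi : C -> C) := exists (p : {poly C}) (n : nat),
  forall lambda, lambda != 0 -> phi lambda = p.[lambda] / lambda ^+ n.

Lemma laurent_ext phi psi : (forall lambda, lambda != 0 -> phi lambda = psi lambda) ->
  laurent phi -> laurent psi.
Proof. by move=> e [p [n H]]; exists p, n => x x0; rewrite -e // H. Qed.

Lemma laurent0 : laurent (fun=> 0).
Proof. by exists 0, 0%N => x _; rewrite horner0 mul0r. Qed.

Lemma laurentZ k phi : laurent phi -> laurent (fun x => k * phi x).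
Proof.
by move=> [p [n H]]; exists (k *: p), n => x x0; rewrite H // hornerZ mulrA.
Qed.

Lemma laurentD phi psi : laurent phi -> laurent psi -> laurent (fun x => phi x + psi x).
Proof.
move=> [p [n H]] [p' [n' H']]; exists (p * 'X^n' + p' * 'X^n), (n + n')%N => x x0.
rewrite H // H' // !hornerE exprD.
by field; rewrite ?expf_neq0.
Qed.

Lemma laurent_sum (T : Type) (s : seq T) (phi : T -> C -> C) :
  (forall t, laurent (phi t)) -> laurent (fun x => \sum_(t <- s) phi t x).
Proof.
move=> H; elim: s => [|t s IH].
  by apply: laurent_ext laurent0 => x _; rewrite big_nil.
by apply: laurent_ext (laurentD (H t) IH) => x _; rewrite big_cons.
Qed.

Lemma laurent_eq0 phi (u : nat -> C) : laurent phi -> injective u ->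
  (forall n, u n != 0) -> (forall n, phi (u n) = 0) ->
  forall lambda, lambda != 0 -> phi lambda = 0.
Proof.
move=> [p [n H]] u_inj u0 pu x x0; rewrite H //.
suff -> : p = 0 by rewrite horner0 mul0r.
apply/eqP/negP => /negP p0.
(* The first [size p] values of [u] are distinct roots, more than a nonzero [p] can have. *)
have := max_poly_roots p0 (rs := [seq u i | i <- iota 0 (size p)]).
rewrite map_inj_uniq ?iota_uniq // size_map size_iota ltnn => H'.
suff : false by []; apply: H' => //; apply/allP => _ /mapP[i _ ->].
have := pu i; rewrite H // => /eqP; rewrite mulf_eq0 invr_eq0 expf_eq0 (negPf (u0 i)).
by rewrite andbF orbF.
Qed.

(** * Integrals against pure tensors *)

Let Dm_linl (b : A2) (f1 : Dfin q Y1) (f2 : Dfin q Y2) :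
  linear (fun a : A1 => tpure (Dmulr f1 a) (Dmull b f2) : Dfin2 q Y1 Y2).
Proof.
move=> k a a'; have -> : Dmulr f1 (k *: a + a') = k *: Dmulr f1 a + Dmulr f1 a'.
  exact: (Dmulr_linearr q_gt0 q_lt1).
exact: tpure_linl.
Qed.
Let Dm_linr (a : A1) (f1 : Dfin q Y1) (f2 : Dfin q Y2) :
  linear (fun b : A2 => tpure (Dmulr f1 a) (Dmull b f2) : Dfin2 q Y1 Y2).
Proof.
move=> k b b'; have -> : Dmull (k *: b + b') f2 = k *: Dmull b f2 + Dmull b' f2.
  exact: (Dmull_linearl q_gt0 q_lt1).
exact: tpure_linr.
Qed.

Lemma Pol2_mul_Dfin2_pure (f1 : Dfin q Y1) (f2 : Dfin q Y2) (K : P2) :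
  Pol2_mul_Dfin2 K (tpure f1 f2) =
  tlift (fun (a : A1) (b : A2) => tpure (Dmulr f1 a) (Dmull b f2) : Dfin2 q Y1 Y2) K.
Proof.
rewrite /Pol2_mul_Dfin2; congr (tlift _ K); apply/funext => a; apply/funext => b.
apply: tlift_pure => [g|g] k u v.
  by rewrite (Dmulr_linearl q_gt0 q_lt1) tpure_linl.
by rewrite (Dmull_linearr q_gt0 q_lt1) tpure_linr.
Qed.

Let nu_linl (g : Dfin q Y2) : linear (fun f : Dfin q Y1 => nu f * nu g : C^o).
Proof. by move=> k u v; rewrite (nu_linear q_gt0 q_lt1) mulrDl -scalerAl. Qed.
Let nu_linr (f : Dfin q Y1) : linear (fun g : Dfin q Y2 => nu f * nu g : C^o).
Proof. by move=> k u v; rewrite (nu_linear q_gt0 q_lt1) mulrDr -scalerAr. Qed.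

Lemma nu2_mul_pure (f1 : Dfin q Y1) (f2 : Dfin q Y2) k1 k2 (l : J) :
  (forall a, nu (Dmulr f1 a) = k1 * sval l.1 a) ->
  (forall b, nu (Dmull b f2) = k2 * sval l.2 b) ->
  forall K : P2, nu2 (Pol2_mul_Dfin2 K (tpure f1 f2)) = k1 * k2 * compl K l.
Proof.
move=> e1 e2 K; rewrite Pol2_mul_Dfin2_pure.
have lin := tlift_linear (fun b => Dm_linl b f1 f2) (fun a => Dm_linr a f1 f2).
have nlin : linear (@nu2 R q Y1 Y2 : Dfin2 q Y1 Y2 -> C^o).
  exact: (tlift_linear nu_linl nu_linr).
elim/tens_pure_ind: K => [a b|x y IHx IHy|k x IHx].
- rewrite (tlift_pure (fun b => Dm_linl b f1 f2) (fun a => Dm_linr a f1 f2)).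
  rewrite /nu2 (tlift_pure nu_linl nu_linr) e1 e2 compl_pure; ring.
- rewrite complD mulrDr -IHx -IHy.
  by rewrite (linear_addE lin) (linear_addE nlin).
- by rewrite complZ mulrCA -IHx (linear_scaleE lin) (linear_scaleE nlin).
Qed.

Lemma integral2_pure (f1 : Dfin q Y1) (f2 : Dfin q Y2) k1 k2 (l : J) F :
  (forall a, nu (Dmulr f1 a) = k1 * sval l.1 a) ->
  (forall b, nu (Dmull b f2) = k2 * sval l.2 b) ->
  Dprime2 F -> integral2 F (tpure f1 f2) = k1 * k2 * F l.
Proof.
move=> e1 e2 FD.
apply: (@cont_ext_eq _ _ _ compl (@Cx_hausdorff R) 0
  (fun K => nu2 (Pol2_mul_Dfin2 K (tpure f1 f2))) (fun F => k1 * k2 * F l)) => //.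
  exact/continuous_scale/eval_continuous.
by move=> K; apply: nu2_mul_pure.
Qed.

Section PolynomialFamily.
Variable f : C -> J -> C.
Hypothesis f_poly : polynomial_vector_function f.

(** For a pair of entries, the value is a nonzero multiple of the integral against two matrix units;
    the other pairs follow by linearity in each functional. *)
Lemma polynomial_vector_function_laurent (l : J) : laurent (fun x => f x l).
Proof.
have [fD fint] := f_poly.
(* The equations on [sval] allow elimination of both memberships while f is still evaluated at a
   pair in [Pol_dual]. *)
suff H l1 : mcspan l1 -> forall l2, mcspan l2 -> forall l : J,
    sval l.1 = l1 -> sval l.2 = l2 -> laurent (fun x => f x l).
  exact: (H _ (Pol_dual_mcspan q_gt0 q_lt1 l.1) _ (Pol_dual_mcspan q_gt0 q_lt1 l.2)).
elim=> {l1} [t ot||l1 l1' m1 IH m1' IH'|k l1 m1 IH] l2.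
- elim=> {l2} [t' ot'||l2 l2' m2 IH m2' IH'|k l2 m2 IH] {}l el1 el2.
  + have [f1 [k1 [k10 e1]]] := nu_Dmulr_dual q_gt0 q_lt1 ot.
    have [f2 [k2 [k20 e2]]] := nu_Dmull_dual q_gt0 q_lt1 ot'.
    apply: (laurent_ext _ (laurentZ (k1 * k2)^-1 (fint (tpure f1 f2)))) => x x0.
    rewrite (@integral2_pure f1 f2 k1 k2 l) ?el1 ?el2 //; last exact: fD.
    by rewrite mulKf ?mulf_neq0.
  + apply: (laurent_ext _ laurent0) => x x0.
    by rewrite (@Dprime2_comb2 [::] l _ (fD _ x0)) ?big_nil // => b; rewrite big_nil el2.
  + have H := IH (l.1, mcdual q_gt0 q_lt1 m2) el1 erefl.
    have H' := IH' (l.1, mcdual q_gt0 q_lt1 m2') el1 erefl.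
    apply: laurent_ext (laurentD H H') => x x0.
    pose s := [:: (1 : C, mcdual q_gt0 q_lt1 m2); (1, mcdual q_gt0 q_lt1 m2')].
    rewrite (@Dprime2_comb2 s l _ (fD _ x0)) ?big_cons ?big_nil ?addr0 ?mul1r // => b.
    by rewrite !big_cons big_nil addr0 !mul1r el2.
  + have H := IH (l.1, mcdual q_gt0 q_lt1 m2) el1 erefl.
    apply: laurent_ext (laurentZ k H) => x x0.
    rewrite (@Dprime2_comb2 [:: (k, mcdual q_gt0 q_lt1 m2)] l _ (fD _ x0)) ?big_seq1 // => b.
    by rewrite big_seq1 el2.
- move=> _ {}l el1 _; apply: (laurent_ext _ laurent0) => x x0.
  by rewrite (@Dprime2_comb1 [::] l _ (fD _ x0)) ?big_nil // => b; rewrite big_nil el1.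
- move=> m2 {}l el1 el2.
  have H := IH _ m2 (mcdual q_gt0 q_lt1 m1, l.2) erefl el2.
  have H' := IH' _ m2 (mcdual q_gt0 q_lt1 m1', l.2) erefl el2.
  apply: laurent_ext (laurentD H H') => x x0.
  pose s := [:: (1 : C, mcdual q_gt0 q_lt1 m1); (1, mcdual q_gt0 q_lt1 m1')].
  rewrite (@Dprime2_comb1 s l _ (fD _ x0)) ?big_cons ?big_nil ?addr0 ?mul1r // => b.
  by rewrite !big_cons big_nil addr0 !mul1r el1.
- move=> m2 {}l el1 el2.
  have H := IH _ m2 (mcdual q_gt0 q_lt1 m1, l.2) erefl el2.
  apply: laurent_ext (laurentZ k H) => x x0.
  rewrite (@Dprime2_comb1 [:: (k, mcdual q_gt0 q_lt1 m1)] l _ (fD _ x0)) ?big_seq1 // => b.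
  by rewrite big_seq1 el1.
Qed.

End PolynomialFamily.
End Completion.

(** * Complex powers of q *)

Section QPowers.
Variables (R : realType) (q : R).
Hypothesis q_gt0 : 0 < q.
Local Notation C := (Cx R).

Lemma qpow_neq0 (z : C) : qpow q z != 0.
Proof.
rewrite /qpow /cexp mulf_neq0 //; first by rewrite fmorph_eq0 gt_eqF ?expR_gt0.
set y := complex.Im _; apply/eqP => -[c0 s0].
by have := cos2Dsin2 y; rewrite c0 s0 expr0n addr0 => /eqP; rewrite eq_sym oner_eq0.
Qed.

Lemma qpow_nat (l : nat) : qpow q (2 * l%:R) = (q ^+ (2 * l))%:C.
Proof.
have -> : (2 * l%:R : C) = ((2 * l)%:R : R)%:C by rewrite natrM rmorphM /= !rmorph_nat.
rewrite /qpow /cexp -rmorphM /= cos0 sin0.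
have -> : expR (ln q * (2 * l)%:R) = q ^+ (2 * l).
  by rewrite expRM_natr lnK // posrE.
by rewrite -[1 +i* 0]/(1%:C) mulr1.
Qed.

End QPowers.

Theorem mainTheorem18 (R : realType) (q h : R)
    (q01 : 0 < q < 1) (h_gt0 : 0 < h) (qE : q = expR (- (h / 2)))
    (Y1 Y2 : qspace)
    (Y12 : (Y1, Y2) = (Xtilde, Xtilde) \/ (Y1, Y2) = (Xtilde, Xitilde) \/
           (Y1, Y2) = (Xitilde, Xtilde))
    (f : Cx R -> Pol_dual q Y1 * Pol_dual q Y2 -> Cx R)
    (f_poly : polynomial_vector_function f)
    (f_int : forall l : nat,
       f (qpow q (2 * l%:R)) = Pol2_compl (k22 q Y1 Y2 ^+ l * k11 q Y1 Y2 ^+ l))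
    (l : Cx R) (xi : Uq h) :
  Dprime2_act xi (f (qpow q (2 * l))) = Ucounit xi *: f (qpow q (2 * l)).
Proof.
have /andP[q_gt0 q_lt1] := q01.
have fD x : x != 0 -> Dprime2 (f x) by case: f_poly => + _; apply.
have f_laurent := polynomial_vector_function_laurent q_gt0 q_lt1 f_poly.
apply/funext => p; have [L [LK LF]] := Dprime2_actE q_gt0 q_lt1 qE xi p.
rewrite LF; last exact/fD/qpow_neq0.
(* The coordinate [p] of xi . f(x) - eps(xi) f(x) as a function of the parameter x: being Laurent in
   x, it is settled by its zeros at x = q^(2n), also at q^(2l) with l complex. *)
pose phi x := \sum_(y <- L) y.1 * f x y.2 + - Ucounit xi * f x p.
suff : phi (qpow q (2 * l)) = 0.
  by move=> /eqP; rewrite /phi mulNr subr_eq0 => /eqP.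
apply: (@laurent_eq0 _ phi (fun n => qpow q (2 * n%:R))).
- apply: laurentD; last exact/laurentZ/f_laurent.
  by apply: laurent_sum => y; apply/laurentZ/f_laurent.
(* Since 0 < q < 1, the points q^(2n) are pairwise distinct. *)
- move=> m n; rewrite !qpow_nat // => /complexI /(ieexprIn q_gt0).
  by rewrite lt_eqF // => /(_ isT); lia.
- by move=> n; apply: qpow_neq0.
- move=> n; rewrite /phi f_int -LK (Uact_invariant qE); last exact: (k_power_invariant qE).
  by rewrite complZ // mulNr subrr.
- exact: qpow_neq0.
Qed.
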